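(* Let $[a,b]\subset\mathbb{R}$, let $P$ be a polynomial which is definite with respect to $a,b$, let $p=P'$ and $d_p=\deg p$, and fix $d_q\in\mathbb{N}$. Then there exist $\delta>0$ and $\rho>0$ (depending on $P,a,b,d_q$) such that for every polynomial $q$ with $\deg q\le d_q$ and $\|q\|<\delta$, the number of isolated periodic solutions of the Abel equation $$y'=p(x)y^2+q(x)y^3,\qquad x\in[a,b],$$ satisfying $|y(a)|<\rho$ is at most $5+d_q+3d_p^2$.
   Context: A periodic solution of the Abel equation $y'=p(x)y^2+q(x)y^3$ on $[a,b]$ is a solution $y(x)$ with $y(a)=y(b)$. It is isolated if it is isolated among periodic solutions, i.e. no other periodic solution has initial value $y(a)$ arbitrarily close to its initial value. The norm $\|q\|$ is any fixed norm on the finite-dimensional space of coefficients of polynomials of degree at most $d_q$. Polynomials $P,Q$ satisfy the composition condition (PCC) on $[a,b]$ if there exist a polynomial $W$ with $W(a)=W(b)$ and polynomials $\tilde P,\tilde Q$ such that $P(x)=\tilde P(W(x))$ and $Q(x)=\tilde Q(W(x))$. A polynomial $P$ is called definite (with respect to $a,b$) if for any polynomial $Q$ with derivative $q=Q'$, the vanishing of all the moments $\widetilde m_k(P,q)=\int_a^b P^k(x)q(x)\,dx$, $k=0,1,2,\dots$, implies that $P,Q$ satisfy PCC on $[a,b]$. *)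

(* Defs.v *)
From mathcomp Require Export all_boot all_order all_algebra.
From mathcomp Require Export all_classical all_reals all_analysis.

Set Implicit Arguments.
Unset Strict Implicit.
Unset Printing Implicit Defensive.

Import Order.TTheory GRing.Theory Num.Theory.
Import numFieldNormedType.Exports.

Local Open Scope classical_set_scope.
Local Open Scope ring_scope.

Definition PCC (R : realType) (a b : R) (P Q : {poly R}) : Prop :=
  exists W P1 Q1 : {poly R},
    [/\ W.[a] = W.[b], P = P1 \Po W & Q = Q1 \Po W].

Definition moment (R : realType) (a b : R) (P q : {poly R}) (k : nat) : R :=
  (\int[@lebesgue_measure R]_(x in `[a, b]) (P.[x] ^+ k * q.[x]))%R.

Definition definite (R : realType) (a b : R) (P : {poly R}) : Prop :=
  forall Q : {poly R},
    (forall k : nat, moment a b P Q^`() k = 0) -> PCC a b P Q.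

(* The difference quotient is restricted to [a, b], so that y' is one-sided
   at the endpoints and only the values of y on [a, b] matter. *)
Definition abel_solution (R : realType) (a b : R) (p q : {poly R})
    (y : R -> R) : Prop :=
  forall x : R, x \in `[a, b] ->
    (y t - y x) / (t - x) @[t --> within `[a, b] x^']
      --> p.[x] * y x ^+ 2 + q.[x] * y x ^+ 3.

Definition periodic_solution (R : realType) (a b : R) (p q : {poly R})
    (y : R -> R) : Prop :=
  abel_solution a b p q y /\ y a = y b.

Definition isolated_periodic (R : realType) (a b : R) (p q : {poly R})
    (y : R -> R) : Prop :=
  periodic_solution a b p q y /\
  exists2 e : R, 0 < e &
    forall z : R -> R, periodic_solution a b p q z -> `|z a - y a| < e ->
      {in `[a, b], z =1 y}.

(* Two functions on R are the same solution on [a, b] when they agree there;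
   taking restrictions to [a, b] picks one representative of each. *)
Definition small_isolated_periodic (R : realType) (a b : R) (p q : {poly R})
    (rho : R) : set (R -> R) :=
  [set y \_ `[a, b] | y in
    [set y : R -> R | isolated_periodic a b p q y /\ `|y a| < rho]].

Definition is_norm (R : realType) (V : lmodType R) (N : V -> R) : Prop :=
  [/\ forall u v, N (u + v) <= N u + N v,
      forall c v, N (c *: v) = `|c| * N v
    & forall v, N v = 0 -> v = 0].

(* Main.v *)
(* Normalise [P(a) = 0]; put [n = deg P], [p = P'] and [K = 5 + dq + 3 deg(p)^2].

   Moments.  If [P(b) = 0] and [deg q <= dq], then [m_0 = ... = m_(K-1) = 0] forces
   all moments [m_j = \int_a^b P^j q] to vanish.  As a function of [t = P(x)],
   [q / p] satisfies a linear differential equation of order at most [deg p] with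
   polynomial coefficients of bounded degree, and so does [I = \sum_j m_j t^(-j-1)].
   Subtracting some [g(P) p] from [q], assume that [q / p] has trace [0] over [R(t)].
   For a differential operator [A], let [u] be [A (q / p)], up to a fixed factor,
   and [e] the index of the first nonzero coefficient of [A I].  Composing [A] with
   [n t d/dt - c], where [c] is chosen to cancel the leading term of [u], preserves
   [e] because the trace condition forbids the one bad exponent; reducing by the
   equation then makes [deg u + n e] strictly smaller.  This cannot go on for ever:
   modulo the equation, [A] has coefficients of degree at most [deg u / n + C], and
   [I] has no terms of small index.  Hence [I = 0].

   Return map.  For small [y0] and [q] the solution with [y(a) = y0] is [y0 B(x)],
   where [A = 1 + y0^2 \int_a^x q A^2 B] and [B = A + y0 P A B].  If [P(b) <> 0], no
   small nonzero solution is periodic.  If [P(b) = 0] and [y0 <> 0], periodicity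
   means [H_q(y0) = 0] for [H_q = \int_a^b q A^2 B = \sum_j m_j(q) y0^j + O(|q|^2)].
   Write [q = z + w], where the first [K] moments of [z] vanish and [w] is bounded
   by its first [K] moments.  All moments of [z] vanish, so [P] and a primitive of
   [z] are polynomials in some [W] with [W(a) = W(b)], and [H_z = 0]; this improves
   the error: [H_q = \sum_j m_j(w) y0^j + O(|q| |w|)].  If [H_q] has [K] zeros of
   modulus at most [r], its first [K] coefficients are [O(r |w|)].  For small [r] and
   [|q|] this gives [w = 0]: every small solution is periodic and none isolated. *)

From HB Require Import structures.
Require Import Defs.
From mathcomp Require Import all_boot all_order all_algebra.
From mathcomp Require Import finmap polyorder polyrcf.
From mathcomp Require Import all_classical all_reals all_analysis.
From mathcomp Require Import ring lra zify.

Set Implicit Arguments.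
Unset Strict Implicit.
Unset Printing Implicit Defensive.

Import Order.TTheory GRing.Theory Num.Theory.
Import numFieldNormedType.Exports.

Local Open Scope ring_scope.

(** * Expansions in powers of a polynomial *)

Section Adic.
Variables (R : fieldType) (P : {poly R}).
Hypotheses (monP : P \is monic) (sP : (1 < size P)%N).
Implicit Types (w g v : {poly R}).

Local Notation n := (size P).-1.

(* The coefficients [c_j] of the expansion [w = \sum_(j < n) c_j(P) X^j],
   stored as a polynomial in [X] over [R[t]], where [t] stands for [P]. *)
Definition adic (w : {poly R}) : {poly {poly R}} :=
  Pdiv.Ring.rmodp (map_poly polyC w) (map_poly polyC P - 'X%:P).

Definition adic_eval (C : {poly {poly R}}) : {poly R} :=
  (map_poly (comp_poly P) C).['X].

(** By Euler's formula, when [P' <> 0] this is the trace of [w / P'] from [R(X)] down to [R(P)]. *)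
Definition adic_top (w : {poly R}) : {poly R} := (adic w)`_n.-1.

Let PX := map_poly polyC P - ('X : {poly R})%:P.

Lemma size_adic_modulus : size PX = size P.
Proof.
rewrite /PX size_polyDl ?size_map_polyC // size_polyN size_polyC polyX_eq0.
by rewrite sP.
Qed.

Lemma adic_modulus_monic : PX \is monic.
Proof.
rewrite /PX monicE lead_coefDl ?size_map_polyC ?size_polyN ?size_polyC ?polyX_eq0 //.
by rewrite lead_coef_map_eq ?(eqP monP) ?oner_eq0.
Qed.

Lemma adicD w1 w2 : adic (w1 + w2) = adic w1 + adic w2.
Proof.
rewrite /adic -/PX rmorphD /=.
exact: (Pdiv.RingMonic.rmodpD adic_modulus_monic).
Qed.

Lemma adic0 : adic 0 = 0.
Proof. by rewrite /adic rmorph0 Pdiv.Ring.rmod0p. Qed.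

Lemma adic_sum (I : Type) (r : seq I) (Q : pred I) (F : I -> {poly R}) :
  adic (\sum_(i <- r | Q i) F i) = \sum_(i <- r | Q i) adic (F i).
Proof. exact: (big_morph _ adicD adic0). Qed.

Lemma adic_mulP w : adic (P * w) = 'X *: adic w.
Proof.
rewrite /adic -/PX rmorphM /= -(Pdiv.RingMonic.rmodpZ adic_modulus_monic).
rewrite -[map_poly polyC P in LHS](subrK ('X : {poly R})%:P) mulrDl mulrC.
rewrite (Pdiv.RingMonic.rmodpD adic_modulus_monic).
by rewrite (Pdiv.RingMonic.rmodp_mull adic_modulus_monic) add0r mul_polyC.
Qed.

Lemma adicZ c w : adic (c *: w) = c%:P *: adic w.
Proof.
rewrite /adic -/PX map_polyZ /=; exact: (Pdiv.RingMonic.rmodpZ adic_modulus_monic).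
Qed.

Lemma adic_comp_mul g w : adic ((g \Po P) * w) = g *: adic w.
Proof.
elim/poly_ind: g => [|g c IH]; first by rewrite comp_poly0 mul0r adic0 scale0r.
rewrite comp_poly_MXaddC mulrDl adicD mulrAC [_ * P]mulrC adic_mulP IH.
by rewrite mul_polyC adicZ scalerDl scalerA [g * 'X]mulrC.
Qed.

Lemma size_adic w : (size (adic w) <= n)%N.
Proof.
have := @Pdiv.Ring.ltn_rmodpN0 _ (map_poly polyC w) PX (monic_neq0 adic_modulus_monic).
by rewrite size_adic_modulus -/(adic w) -{1}(prednK (ltnW sP)) ltnS.
Qed.

Lemma adic_evalK w : adic_eval (adic w) = w.
Proof.
have e0 : adic_eval PX = 0.
  rewrite /adic_eval /PX rmorphB /= map_polyC /= hornerD hornerN hornerC.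
  rewrite comp_polyX -map_poly_comp /=.
  rewrite (eq_map_poly (g := polyC)); last by move=> x /=; rewrite comp_polyC.
  by rewrite [X in X - _](comp_polyXr P) subrr.
have ew : adic_eval (map_poly polyC w) = w.
  rewrite /adic_eval -map_poly_comp /=.
  rewrite (eq_map_poly (g := polyC)); last by move=> x /=; rewrite comp_polyC.
  by rewrite -[RHS]comp_polyXr.
rewrite -[RHS]ew (Pdiv.RingMonic.rdivp_eq adic_modulus_monic (map_poly polyC w)).
by rewrite /adic_eval rmorphD rmorphM /= hornerD hornerM -/(adic_eval _) -/(adic_eval PX) e0 mulr0 add0r.
Qed.

Lemma adic_small w : (size w <= n)%N -> adic w = map_poly polyC w.
Proof.
move=> sw; rewrite /adic Pdiv.Ring.rmodp_small // -/PX size_adic_modulus size_map_polyC.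
by move: sP sw; case: (size P) => // -[].
Qed.

Lemma adic_expand w : w = \sum_(j < n) ((adic w)`_j \Po P) * 'X^j.
Proof.
rewrite -{1}[w]adic_evalK /adic_eval (@horner_coef_wide _ n); last first.
  exact: leq_trans (size_poly _ _) (size_adic _).
by apply: eq_bigr => i _; rewrite coef_map.
Qed.

Lemma size_comp_mulXn g j : g != 0 ->
  size ((g \Po P) * 'X^j) = ((size g).-1 * n + j).+1.
Proof.
move=> g0.
have gP0 : g \Po P != 0 by rewrite comp_poly_eq0 // size_poly_gt0.
have h2 := size_comp_poly g P; rewrite size_mulXn //.
by rewrite -size_poly_gt0 in gP0; rewrite addnC -h2 -addSn prednK.
Qed.

(** The terms [c_j(P) X^j] have degrees [n deg c_j + j], distinct modulo [n], so the leading terms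
    cannot cancel. *)
Lemma adic_size w : w != 0 -> exists2 j : 'I_n, (adic w)`_j != 0 &
  size w = ((size (adic w)`_j).-1 * n + j).+1 /\
  forall i : 'I_n, (adic w)`_i != 0 ->
    (((size ((adic w)`_i)%R).-1 * n + i).+1 <= size w)%N.
Proof.
move=> w0; pose F (i : 'I_n) := ((adic w)`_i \Po P) * 'X^i.
have [j0 Hj0] : exists j : 'I_n, (adic w)`_j != 0.
  apply/existsP; apply: contraNT w0 => /existsPn H.
  rewrite [w]adic_expand big1 // => i _.
  by move: (H i); rewrite negbK => /eqP ->; rewrite comp_poly0 mul0r.
case: (@arg_maxnP _ j0 (fun i : 'I_n => (adic w)`_i != 0) (fun i : 'I_n => ((size ((adic w)`_i)%R).-1 * n + i)%N) Hj0) => j Hj Hmax0.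
have Hmax (i : 'I_n) : (adic w)`_i != 0 -> ((size ((adic w)`_i)%R).-1 * n + i <= (size ((adic w)`_j)%R).-1 * n + j)%N by move=> /Hmax0.
have sw : size w = ((size (adic w)`_j).-1 * n + j).+1.
  rewrite {1}[w]adic_expand (bigD1 j) //= size_polyDl size_comp_mulXn //.
  rewrite ltnS; apply: leq_trans (size_sum _ _ _) _; apply/bigmax_leqP => i nij.
  have [->|Hi] := eqVneq (adic w)`_i 0; first by rewrite comp_poly0 mul0r size_poly0.
  rewrite size_comp_mulXn // ltn_neqAle (Hmax i Hi) andbT.
  apply: contraNneq nij => e; apply/eqP/val_inj => /=.
  move: (congr1 (fun m => m %% n)%N e); rewrite !modnMDl !modn_small //.
exists j => //; split=> // i Hi; rewrite sw ltnS; exact: Hmax.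
Qed.

Lemma size_adic_coef w (i : 'I_n) (d : nat) :
  (size w <= d.+1)%N -> (size ((adic w)`_i)%R <= (d %/ n).+1)%N.
Proof.
move=> sw; have [w0|w0] := eqVneq w 0; first by rewrite w0 adic0 coef0 size_poly0.
have [->|wi] := eqVneq (adic w)`_i 0; first by rewrite size_poly0.
have [j _ [_ /(_ i wi) H]] := adic_size w0.
have n0 : (0 < n)%N by lia.
have H2 : ((size ((adic w)`_i)%R).-1 * n <= d)%N by lia.
have : ((size ((adic w)`_i)%R).-1 <= d %/ n)%N by rewrite leq_divRL.
lia.
Qed.

Lemma adic_inj w : (forall i : 'I_n, (adic w)`_i = 0) -> w = 0.
Proof.
move=> H; rewrite [w]adic_expand big1 // => i _; by rewrite H comp_poly0 mul0r.
Qed.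

(** One term [c_j(P) X^j] gives the degree, and [j < n - 1] when the top coefficient vanishes; so
    [size w], one more than the degree, is not [0] modulo [n]. *)
Lemma adic_top0_size w : w != 0 -> adic_top w = 0 -> ~~ (n %| size w)%N.
Proof.
move=> w0 t0; have [j Hj [-> _]] := adic_size w0.
rewrite -addnS dvdn_addr ?dvdn_mull // gtnNdvd //.
rewrite ltn_neqAle ltn_ord andbT; apply: contraNneq Hj => e.
rewrite -[X in _ == X]t0 /adic_top; have -> : n.-1 = j by lia.
by [].
Qed.

Lemma adic_topD w1 w2 : adic_top (w1 + w2) = adic_top w1 + adic_top w2.
Proof. by rewrite /adic_top adicD coefD. Qed.

Lemma adic_topB w1 w2 : adic_top (w1 - w2) = adic_top w1 - adic_top w2.
Proof. by apply: (addIr (adic_top w2)); rewrite -adic_topD !subrK. Qed.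

Lemma adic_top_comp_mul g w : adic_top ((g \Po P) * w) = g * adic_top w.
Proof. by rewrite /adic_top adic_comp_mul coefZ. Qed.

Lemma adic_top_sum (I : Type) (r : seq I) (Q : pred I) (F : I -> {poly R}) :
  adic_top (\sum_(i <- r | Q i) F i) = \sum_(i <- r | Q i) adic_top (F i).
Proof. by rewrite /adic_top adic_sum coef_sum. Qed.

Lemma adic_top_small w : (size w <= n)%N -> adic_top w = (w`_n.-1)%:P.
Proof. by move=> sw; rewrite /adic_top adic_small // coef_map. Qed.

(* Up to the factor [P'], [adic_top] is the trace of [R(X)] over [R(P)]; here
   [Tr (v' / P') = d/dt Tr v]. *)
Lemma adic_top_deriv v : adic_top v^`() = (adic_top (P^`() * v))^`().
Proof.
(* [P' X^j] has degree at most [n - 1 + j < 2 n - 1], while a coefficient of positive degree on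
   [X^(n-1)] would require at least [2 n - 1]. *)
have sXP (j : 'I_n) : exists c : R, adic_top (P^`() * 'X^j) = c%:P.
  apply/(ex_intro _ _ _).
  apply: size1_polyC; rewrite /adic_top.
  have n0 : (0 < n)%N by lia.
  have ln : (n.-1 < n)%N by rewrite prednK.
  have [->|x0] := eqVneq (adic (P^`() * 'X^j))`_(Ordinal ln) 0; first by rewrite size_poly0.
  have [e|w0] := eqVneq (P^`() * 'X^j) 0; first by rewrite e adic0 coef0 eqxx in x0.
  have [_ _ [_ /(_ _ x0) /= H]] := adic_size w0.
  have : (size (P^`() * 'X^j)%R <= n.-1 + j + 1)%N.
    apply: leq_trans (size_polyMleq _ _) _; rewrite size_polyXn.
    have aux (p m i : nat) : (1 < p)%N -> (m < p)%N -> ((m + i.+1).-1 <= p.-2 + i + 1)%N.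
      lia.
    exact: aux sP (lt_size_deriv (monic_neq0 monP)).
  have aux (c m i s : nat) : (i < m)%N -> (c.-1 * m + m.-1 < s)%N ->
      (s <= m.-1 + i + 1)%N -> (c <= 1)%N.
    by case: c => [|[|c]] //; rewrite /= mulSn; lia.
  exact: aux (ltn_ord j) H.

rewrite [v in LHS]adic_expand [v in RHS]adic_expand raddf_sum mulr_sumr !adic_top_sum raddf_sum.
apply: eq_bigr => j _ /=.
have [c Hc] := sXP j.
rewrite [P^`() * _]mulrCA adic_top_comp_mul Hc derivM derivC mulr0 addr0.
rewrite derivM deriv_comp adic_topD -[_ * P^`() * _]mulrA adic_top_comp_mul Hc.
(* The remaining term carries the derivative of [X^j], of degree below [n - 1]: it has no top
   coefficient. *)
rewrite [X in _ + X](_ : _ = 0) ?addr0 //.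
have sj : (size ('X^j : {poly R})^`() <= n.-1)%N.
  apply: leq_trans (_ : j <= n.-1)%N; last by have := ltn_ord j; lia.
  rewrite derivXn; case: (nat_of_ord j) => [|i]; first by rewrite mulr0n size_poly0.
  by rewrite /= -scaler_nat (leq_trans (size_scale_leq _ _)) // size_polyXn.
rewrite adic_top_comp_mul adic_top_small ?(leq_trans sj) ?leq_pred //.
by rewrite (nth_default 0 sj) polyC0 mulr0.
Qed.

End Adic.

(** * Polynomials vanishing at the critical values *)

Section CriticalValues.
Variable R : realFieldType.
Implicit Types P D : {poly R}.

(** With [d = deg D], the [d + 1] powers [P^0, ..., P^d] are linearly dependent modulo [D]; the
    coefficients of a dependence form [delta]. *)
Lemma dvdp_comp_exists P D : D != 0 ->
  exists delta : {poly R},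
    [/\ delta != 0, (size delta <= size D)%N & D %| delta \Po P].
Proof.
move=> D0; have sD : (0 < size D)%N by rewrite size_poly_gt0.
pose d := (size D).-1.
pose M : 'M[R]_(d.+1, d) := \matrix_i poly_rV ((P ^+ i) %% D).
have : kermx M != 0.
  rewrite -mxrank_eq0 mxrank_ker subn_eq0 -ltnNge ltnS; exact: rank_leq_col.
case/rowV0Pn => v /sub_kermxP vM v0.
exists (rVpoly v); split.
- by apply: contra_neq v0 => e; rewrite -[v]rVpolyK e linear0.
- by rewrite (leq_trans (size_poly _ _)) // prednK.
rewrite -[_ %| _]/((_ %% D) == 0) comp_polyE.
have sm (p : {poly R}) : (size (p %% D)%R <= d)%N by rewrite -ltnS prednK // ltn_modp.
have -> : \sum_(i < size (rVpoly v)) (rVpoly v)`_i *: P ^+ i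
   = \sum_(i < d.+1) v 0 i *: P ^+ i.
  rewrite (big_ord_widen d.+1 (fun i => (rVpoly v)`_i *: P ^+ i)) ?size_poly //.
  rewrite big_mkcond /=; apply: eq_bigr => i _; case: ltnP => h.
    by rewrite coef_rVpoly_ord.
  by rewrite -(coef_rVpoly_ord v i) nth_default // scale0r.
rewrite (big_morph _ (modpD D) (mod0p D)).
rewrite -(poly_rV_K (_ : (size (\sum_(i < d.+1) ((v 0 i *: P ^+ i) %% D))%R <= d)%N)); last first.
  by apply: (leq_trans (size_sum _ _ _)); apply/bigmax_leqP => i _; exact: sm.
rewrite raddf_sum /= [X in rVpoly X](_ : _ = v *m M); first by rewrite vM linear0 eqxx.
rewrite mulmx_sum_row; apply: eq_bigr => i _.
by rewrite rowK modpZl linearZ.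
Qed.

Lemma irreducible_or_split D : (1 < size D)%N ->
  irreducible_poly D \/
  exists D1 D2, [/\ D = D1 * D2, (1 < size D1)%N, (1 < size D2)%N,
                 (size D1 < size D)%N & (size D2 < size D)%N].
Proof.
move=> sD.
have [[q [q1 qD nq]]|h] :=
    EM (exists q : {poly R}, [/\ size q != 1, q %| D & ~~ (q %= D)]); last first.
  left; split=> // q q1 qD; apply/negPn/negP => nq; apply: h; by exists q.
right.
have D0 : D != 0 by rewrite -size_poly_gt0 ltnW.
have eD := divpK qD.
have q0 : q != 0 by apply: contraNneq D0 => e; rewrite -eD e mulr0.
have u0 : D %/ q != 0 by apply: contraNneq D0 => e; rewrite -eD e mul0r.
have sq : (1 < size q)%N by move: q1; rewrite -size_poly_gt0 in q0; lia.
have sqD : (size q < size D)%N.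
  rewrite ltn_neqAle dvdp_leq // andbT; apply: contraNneq nq => e.
  by rewrite -dvdp_size_eqp // e.
have sm : (size D).+1 = (size (D %/ q)%R + size q)%N.
  rewrite -{1}eD size_mul // prednK // addn_gt0 !size_poly_gt0 u0 //.
exists (D %/ q), q; rewrite eD.
move: sm sq sqD; set x := size (D %/ q); set y := size q; set z := size D.
clearbody x y z => h1 h2 h3; split=> //; clear -h1 h2 h3; lia.
Qed.

(* The values of [P] at its critical points, with multiplicity, are the roots of
   [delta]. *)
Lemma dvdp_sqr_comp_exists P D : D != 0 -> D %| P^`() ->
  exists delta : {poly R},
    [/\ delta != 0, (size delta <= size D)%N & D ^+ 2 %| delta \Po P].
Proof.
have [m] := ubnP (size D); elim: m => // m IH in D * => sDm D0 DP.
have sD : (0 < size D)%N by rewrite size_poly_gt0.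
have [s1|s1] := leqP (size D) 1.
  exists 1; rewrite oner_neq0 size_poly1 comp_polyC polyC1; split=> //.
  by rewrite dvdp1 (size1_polyC s1) -polyC_exp size_polyC expf_eq0 /= -polyC_eq0 -(size1_polyC s1) D0.
have [irr|[D1 [D2 [eD s11 s21 h1 h2]]]] := irreducible_or_split s1; last first.
  have [d10 d20] : D1 != 0 /\ D2 != 0.
    by rewrite -!size_poly_gt0; split; apply: ltnW.
  have [||e1 [e10 s1e dv1]] := IH D1 _ d10; first exact: leq_trans h1 _.
    by apply: dvdp_trans DP; rewrite eD dvdp_mulr.
  have [||e2 [e20 s2e dv2]] := IH D2 _ d20; first exact: leq_trans h2 _.
    by apply: dvdp_trans DP; rewrite eD dvdp_mull.
  exists (e1 * e2); rewrite mulf_neq0 // comp_polyM eD exprMn dvdp_mul //.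
  split=> //; rewrite !size_mul //.
  by rewrite -!subn1 leq_sub2r // leq_add.
(* For [D] irreducible the same [delta] works. Write [delta(P) = G D] and differentiate: [D] divides
   [P'], hence [G D'], and [D] is prime to [D'] in characteristic 0, so [D] divides [G]. *)
have [delta [d0 sd dv]] := dvdp_comp_exists P D0.
exists delta; split => //.
have /divpK eG := dv; set G := _ %/ D in eG.
have D'0 : D^`() != 0.
  by rewrite -size_poly_gt0 size_deriv -subn1 subn_gt0.
have cop : coprimep D D^`().
  have [e|e] := irredp_XsubCP irr (dvdp_gcdl D D^`()).
    by rewrite /coprimep size_poly_eq1.
  have : D %| D^`() by rewrite -(eqp_dvdl _ e) dvdp_gcdr.
  by move/(dvdp_leq D'0); rewrite leqNgt lt_size_deriv.
rewrite -eG expr2 dvdp_mul // -(Gauss_dvdpl _ cop).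
have := congr1 (@deriv R) eG; rewrite derivM deriv_comp => e.
rewrite -(dvdp_addr _ (dvdp_mull G^`() (dvdpp D))) e.
by apply: dvdp_mull.
Qed.

End CriticalValues.

(** * Degrees of determinants and nonzero minors *)

Section PolyMatrix.
Variable R : fieldType.

Lemma size_prod_leq_const (I : finType) (F : I -> {poly R}) d :
  (forall i, size (F i) <= d.+1)%N -> (size (\prod_i F i)%R <= (#|I| * d).+1)%N.
Proof.
move=> sF; apply: leq_trans (size_poly_prod_leq _ _) _.
rewrite leq_subLR addnS ltnS -mulnS -sum_nat_const.
by apply: leq_sum => i _; apply: sF.
Qed.

Lemma size_det_leq m (M : 'M[{poly R}]_m) d :
  (forall i j, size (M i j) <= d.+1)%N -> (size (\det M)%R <= (m * d).+1)%N.
Proof.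
move=> sM; apply: (leq_trans (size_sum _ _ _)); apply/bigmax_leqP => s _.
rewrite -signr_odd; case: (odd _); rewrite ?expr1 ?expr0 ?mulN1r ?size_polyN ?mul1r.
all: rewrite -[X in (X * d)%N](card_ord m).
all: by apply: size_prod_leq_const => i; apply: sM.
Qed.

Lemma size_mul_adj_leq m (v : 'rV[{poly R}]_m) (M : 'M[{poly R}]_m) d :
  (forall i j, size (M i j) <= d.+1)%N -> (forall j, size (v 0%R j) <= d.+1)%N ->
  forall i, (size ((v *m \adj M) 0 i)%R <= (m * d).+1)%N.
Proof.
case: m => [|m] in v M *; first by move=> _ _ [].
move=> sM sv i; rewrite mxE; apply: (leq_trans (size_sum _ _ _)).
apply/bigmax_leqP => k _; apply: leq_trans (size_polyMleq _ _) _.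
have : (size ((\adj M) k i)%R <= (m * d).+1)%N.
  rewrite mxE /cofactor -signr_odd.
  case: (odd _); rewrite ?expr1 ?expr0 ?mulN1r ?size_polyN ?mul1r;
  by apply: size_det_leq => i1 j1; rewrite !mxE; apply: sM.
move: (sv k); set x := size _; set y := size _; rewrite mulSn; lia.
Qed.

(** Border a nonzero [m]-minor by row [m] and an arbitrary column. If all these determinants
    vanished, the cofactors along the added column would be a relation between the rows whose last
    coefficient is that minor. *)
Lemma independent_rows_minor (D : idomainType) n (W : nat -> 'I_n.+1 -> D) m :
  (forall beta : nat -> D, (forall j, \sum_(i < m) beta i * W i j = 0) ->
     forall i : 'I_m, beta i = 0) ->
  exists c : nat -> 'I_n.+1, \det (\matrix_(i < m, j < m) W i (c j)) != 0.
Proof.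
elim: m => [|m IH] indep.
  by exists (fun _ => ord0); rewrite det_mx00 oner_neq0.
have [|c dc] := IH.
  move=> beta Hb i.
  have := indep (fun k => if k == m then 0 else beta k).
  move=> /(_ _ (widen_ord (leqnSn m) i)) /=; rewrite ltn_eqF //; apply=> j.
  rewrite big_ord_recr /= eqxx mul0r addr0 -[RHS](Hb j).
  by apply: eq_bigr => k _ /=; rewrite ltn_eqF.
pose cc j k := if k == m then j else c k.
pose M j : 'M[D]_m.+1 := \matrix_(i, k) W i (cc j k).
apply: contrapT => /forallNP H.
have detM j : \det (M j) = 0.
  by apply/eqP; apply: contrapT => e; apply: (H (cc j)); apply/negP.
pose beta i := cofactor (M ord0) (inord i) ord_max.
have E (i : 'I_m) : bump m i = i by rewrite /bump leqNgt ltn_ord.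
have Ecof j (i : 'I_m.+1) : cofactor (M j) i ord_max = beta i.
  rewrite /beta /cofactor inord_val; congr (_ * \det _); apply/matrixP => k l.
  by rewrite !mxE /cc /= E ltn_eqF.
have Hbm : beta m = 0.
  apply: (indep beta _ ord_max) => j.
  rewrite -[RHS](detM j) (expand_det_col _ ord_max).
  apply: eq_bigr => i _; rewrite Ecof mulrC; congr (_ * _).
  by rewrite !mxE /cc /= eqxx.
have : beta m != 0.
  rewrite /beta /cofactor mulf_eq0 signr_eq0 /=.
  rewrite [X in \det X](_ : _ = \matrix_(i < m, j < m) W i (c j)) //.
  apply/matrixP => k l; rewrite !mxE /cc /= (_ : inord m = ord_max).
    by rewrite /= !E ltn_eqF.
  by apply: val_inj; rewrite /= inordK.
by rewrite Hbm eqxx.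
Qed.

End PolyMatrix.

(** * Minimal linear relations over [R[P]], with degree bounds *)

Section MinimalRelation.
Variables (R : fieldType) (P : {poly R}).
Hypotheses (monP : P \is monic) (sP : (1 < size P)%N).
Local Notation n := (size P).-1.

(** In the application [W i] is [(d/dt)^i (q / P')] times a factor independent of [i], so this is
    the operator [\sum_i a_i(t) (d/dt)^i] applied to [q / P'], up to that factor. *)
Definition comp_comb (W : nat -> {poly R}) (a : nat -> {poly R}) r :=
  \sum_(i < r) (a i \Po P) * W i.

Lemma comp_comb_minimal (W : nat -> {poly R}) s :
  (exists2 b : nat -> {poly R}, exists i : 'I_s.+1, b i != 0 & comp_comb W b s.+1 = 0) ->
  exists r (b : nat -> {poly R}), [/\ (r <= s)%N, b r != 0, comp_comb W b r.+1 = 0 &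
    forall a, comp_comb W a r = 0 -> forall i : 'I_r, a i = 0].
Proof.
elim: s => [|s IH] [b [i bi] Hb].
  exists 0%N, b; split=> //; first by move: bi; rewrite ord1.
  by move=> a _ [].
have [[c [j cj] Hc]|H] := EM (exists2 b : nat -> {poly R},
  exists i : 'I_s.+1, b i != 0 & comp_comb W b s.+1 = 0).
  have [|r [d [rs dr Hd ind]]] := IH; first by exists c => //; exists j.
  by exists r, d; split=> //; apply: leqW.
exists s.+1, b; split=> //.
  apply: contra_notN H => /eqP bs; exists b; last first.
    by move: Hb; rewrite /comp_comb big_ord_recr /= bs comp_poly0 mul0r addr0.
  have lis : (i < s.+1)%N.
    rewrite ltn_neqAle -ltnS ltn_ord andbT.
    by apply: contraNneq bi => ->; rewrite bs.
  by exists (Ordinal lis).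
move=> a Ha j; apply: contra_notP H => /eqP aj; exists a => //; by exists j.
Qed.

Lemma adic_comp_comb W a r j :
  (adic P (comp_comb W a r))`_j = \sum_(i < r) a i * (adic P (W i))`_j.
Proof.
rewrite /comp_comb adic_sum // coef_sum; apply: eq_bigr => i _.
by rewrite adic_comp_mul // coefZ.
Qed.

(** Cramer's rule for a nonzero minor of the coordinates of [W 0, ..., W (r-1)]. It gives a relation
    with coefficients of controlled degree; it also recovers [a] from the value of its combination,
    whose degree therefore bounds that of [a]. *)
Lemma comp_comb_bounded_relation (W : nat -> {poly R}) s d :
  (forall i, (i <= s)%N -> (size (W i) <= d.+1)%N) ->
  (exists2 b : nat -> {poly R}, exists i : 'I_s.+1, b i != 0 & comp_comb W b s.+1 = 0) ->
  exists r (alpha : nat -> {poly R}) C,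
  [/\ (r <= s)%N, alpha r != 0, comp_comb W alpha r.+1 = 0,
      forall i, (i <= r)%N -> (size (alpha i) <= (r * (d %/ n)).+1)%N &
      forall a, (comp_comb W a r = 0 -> forall i : 'I_r, a i = 0) /\
        forall i : 'I_r, (size (a i) <= (size (comp_comb W a r)).-1 %/ n + C)%N].
Proof.
move=> sW /comp_comb_minimal[r [b [rs br Hb ind]]].
have n0 : (0 < n)%N by rewrite -subn1 subn_gt0.
pose n' := n.-1; have en : n = n'.+1 by rewrite /n' prednK.
pose V i (j : 'I_n'.+1) : {poly R} := (adic P (W i))`_j.
have [|c dA] := @independent_rows_minor {poly R} n' V r.
  move=> a Ha; apply: ind; apply: (adic_inj monP sP) => j.
  by rewrite adic_comp_comb; apply: (Ha (cast_ord en j)).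
set A := (X in \det X) in dA.
pose rho := \row_(j < r) V r (c j) : 'rV[{poly R}]_r.
pose v := rho *m \adj A.
(* [insub] succeeds exactly for [i < r]: these are the Cramer numerators, and the coefficient of
   index [r] is the minor itself. *)
pose alpha i := if insub i is Some k then - v 0 k else \det A.
have alE (i : 'I_r) : alpha i = - v 0 i by rewrite /alpha valK.
have alr : alpha r = \det A by rewrite /alpha insubF // ltnn.
have sA i j : (size (A i j) <= (d %/ n).+1)%N.
  rewrite mxE; apply: (@size_adic_coef _ P monP sP _ (cast_ord (esym en) (c j))).
  by apply: sW; apply: leq_trans rs; apply: ltnW.
have zero_from_minor (a : nat -> {poly R}) :
    (forall j : 'I_r, (adic P (comp_comb W a r))`_(c j) = 0) -> forall i : 'I_r, a i = 0.
  move=> Ha i; pose ra := \row_(k < r) a k.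
  have raA : ra *m A = 0.
    apply/rowP => j; rewrite !mxE -[RHS](Ha j) adic_comp_comb.
    by apply: eq_bigr => k _; rewrite !mxE.
  have := congr1 (fun M => (M *m \adj A) 0 i) raA.
  rewrite -mulmxA mul_mx_adj mul0mx mul_mx_scalar !mxE => /eqP.
  by rewrite mulf_eq0 (negPf dA) => /eqP.
(* The constant comes from the entries of the adjugate, which do not depend on [a]. *)
exists r, alpha, (\max_(i < r) \max_(j < r) size (\adj A i j)).+1; split=> //.
- by rewrite alr.
(* So far [u] is known to vanish only in the chosen coordinates. Eliminating the term of index [r]
   with the minimal relation [b] turns [b_r(P) u] into a combination of lower terms, to which the
   minor applies. *)
- set u := comp_comb _ _ _.
  pose g i := b r * alpha i - alpha r * b i.
  have bu : (b r \Po P) * u = comp_comb W g r.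
    transitivity ((b r \Po P) * u - (alpha r \Po P) * comp_comb W b r.+1).
      by rewrite Hb mulr0 subr0.
    rewrite /u /comp_comb !big_ord_recr /= !mulrDr opprD !mulrA -!comp_polyM.
    rewrite [alpha r * b r]mulrC addrACA subrr addr0 !mulr_sumr -sumrB.
    apply: eq_bigr => i _; rewrite /g comp_polyB !comp_polyM; ring.
  have uc (j : 'I_r) : (adic P u)`_(c j) = 0.
    rewrite adic_comp_comb big_ord_recr /= alr.
    have -> : \sum_(i < r) alpha i * (adic P (W i))`_(c j) = - (v *m A) 0 j.
      rewrite mxE -sumrN; apply: eq_bigr => i _; rewrite alE mulNr; congr (- (_ * _)).
      by rewrite mxE.
    by rewrite /v -mulmxA mul_adj_mx mul_mx_scalar !mxE addNr.
  have g0 : comp_comb W g r = 0.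
    have H := zero_from_minor g _; rewrite /comp_comb big1 // => i _; rewrite H ?comp_poly0 ?mul0r //.
    by move=> j; rewrite -bu adic_comp_mul // coefZ uc mulr0.
  move/eqP: bu; rewrite g0 mulf_eq0 => /orP[|/eqP //].
  by rewrite comp_poly_eq0 ?(negPf br).
- move=> i; rewrite leq_eqVlt => /orP[/eqP ->|ir].
    by rewrite alr; apply: size_det_leq.
  rewrite -[i]/(val (Ordinal ir)) alE size_polyN; apply: size_mul_adj_leq => // j.
  rewrite mxE; apply: (@size_adic_coef _ P monP sP _ (cast_ord (esym en) (c j))).
  exact: sW.
move=> a; split; first exact: ind.
move=> i; set u := comp_comb _ _ _.
have [->|ai] := eqVneq (a i) 0; first by rewrite size_poly0.
pose ra := \row_(k < r) a k; pose uc := \row_(j < r) (adic P u)`_(c j).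
have raA : ra *m A = uc.
  apply/rowP => j; rewrite !mxE adic_comp_comb.
  by apply: eq_bigr => k _; rewrite !mxE.
have e : a i * \det A = (uc *m \adj A) 0 i.
  by rewrite -raA -mulmxA mul_mx_adj mul_mx_scalar !mxE mulrC.
have : (size (a i) <= size (a i * \det A)%R)%N.
  rewrite size_mul //; move: dA; rewrite -size_poly_gt0; set x := size _; set y := size _; lia.
move/leq_trans; apply; rewrite e mxE.
apply: (leq_trans (size_sum _ _ _)); apply/bigmax_leqP => k _.
apply: leq_trans (size_polyMleq _ _) _.
have h1 : (size (uc 0%R k) <= ((size u).-1 %/ n).+1)%N.
  rewrite mxE; apply: (@size_adic_coef _ P monP sP _ (cast_ord (esym en) (c k))).
  exact: leqSpred.
have h2 : (size (\adj A k i) <= \max_(i < r) \max_(j < r) size (\adj A i j))%N.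
  apply: leq_trans (leq_bigmax_cond _ _) => //=.
  by apply: (@leq_bigmax_cond _ _ (fun j => size (\adj A k j))).
rewrite addnS -addSn.
apply: leq_trans (leq_add h1 h2).
exact: leq_pred.
Qed.

End MinimalRelation.

(** * Vanishing of the moments *)

Section Primitive.
Variable R : realFieldType.
Implicit Types f g : {poly R}.

(* The coefficient of index 0 is [f`_0 / 0 = 0]. *)
Definition prim f : {poly R} := \poly_(i < (size f).+1) (f`_i.-1 / i%:R).

Lemma coef_prim f i : (prim f)`_i = f`_i.-1 / i%:R.
Proof.
rewrite coef_poly; case: ltnP => // h; rewrite nth_default ?mul0r //.
by case: i h.
Qed.

Lemma prim_is_linear : linear prim.
Proof.
move=> c f g; apply/polyP => i.
rewrite coef_prim !coefD !coefZ !coef_prim /= mulrDl; congr (_ + _); exact/esym/mulrA.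
Qed.

HB.instance Definition _ := GRing.isLinear.Build R {poly R} {poly R} _ prim prim_is_linear.

Lemma deriv_prim f : (prim f)^`() = f.
Proof.
apply/polyP => i; rewrite coef_deriv coef_prim /= -[LHS]mulr_natr.
by rewrite divfK ?pnatr_eq0.
Qed.

Lemma deriv_eq0 f : f^`() = 0 -> f = (f`_0)%:P.
Proof.
move=> f0; apply: size1_polyC; have := size_deriv f; rewrite f0 size_poly0.
by case: (size f) => [|[]].
Qed.

(** The integral of [f] from [a] to [b], taken through a primitive so that the algebraic part works
    over any ordered field; [moment_mom] links it to the Lebesgue integral. *)
Definition mom (a b : R) f : R := (prim f).[b] - (prim f).[a].

Lemma mom_deriv a b f : mom a b f^`() = f.[b] - f.[a].
Proof.
have /deriv_eq0 e : (prim f^`() - f)^`() = 0 by rewrite derivB deriv_prim subrr.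
move: e; set c := _`_0; move/(canRL (subrK f)); rewrite /mom => ->.
rewrite !hornerD !hornerC; ring.
Qed.

Lemma mom_is_linear a b : linear_for *%R (mom a b).
Proof. by move=> c f g; rewrite /mom linearP !hornerD !hornerZ /=; ring. Qed.

HB.instance Definition _ a b :=
  GRing.isLinear.Build R {poly R} R _ (mom a b) (@mom_is_linear a b).

End Primitive.

Lemma comp_poly_nat (R : comNzRingType) (P : {poly R}) i : i%:R \Po P = i%:R.
Proof. by rewrite -polyC_natr comp_polyC. Qed.

(** * Differentiation with respect to [t = P(x)] and integration by parts *)

Section MomentOperator.
Variables (R : realFieldType) (a b : R) (P : {poly R}).
Hypotheses (monP : P \is monic) (sP : (2 < size P)%N).
Hypotheses (Pa0 : P.[a] = 0) (Pb0 : P.[b] = 0).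
Local Notation n := (size P).-1.
Local Notation s := (size P).-2.
Local Notation P1 := P^`().
Local Notation P2 := P^`()^`().

Variables Delta E : {poly R}.
Hypotheses (D0 : Delta != 0) (HE : Delta \Po P = E * P1 ^+ 2).

(* With [d/dt = (1/P') d/dx], the [i]-th derivative of [q / P'] is
   [iter_dt q i / P' ^+ (2 * i + 1)]. *)
Fixpoint iter_dt (q : {poly R}) i : {poly R} :=
  if i is i'.+1 then (iter_dt q i')^`() * P1 - (iter_dt q i' * P2) *+ (2 * i').+1
  else q.

(** For [i <= s] this is [P'^(2 s + 1) (d/dt)^i (q / P')]: one common denominator for all the
    derivatives in use. *)
Definition iter_dt_common q i := P1 ^+ (2 * (s - i)) * iter_dt q i.

Let P1_neq0 : P1 != 0.
Proof. by rewrite -size_poly_gt0 size_deriv -subn1 subn_gt0 ltnW. Qed.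

Lemma critical_factor_deriv : E^`() * P1 + (E * P2) *+ 2 = Delta^`() \Po P.
Proof.
have := congr1 (@deriv R) HE; rewrite deriv_comp derivM.
rewrite deriv_exp /= expr1 => e; apply: (mulIf P1_neq0); rewrite e; ring.
Qed.

(** [E^i iter_dt q i] equals [P' Delta(t)^i (d/dt)^i (q / P')], and trace zero survives both [d/dt]
    and multiplication by a polynomial in [t]. *)
Lemma adic_top_iter_dt q i : adic_top P q = 0 -> adic_top P (E ^+ i * iter_dt q i) = 0.
Proof.
have sP1 : (1 < size P)%N by apply: ltnW.
move=> q0; elim: i => [|i IH]; first by rewrite mul1r.
have -> : E ^+ i.+1 * iter_dt q i.+1 = (E ^+ i.+1 * P1 * iter_dt q i)^`()
   - ((Delta^`() * i.+1%:R) \Po P) * (E ^+ i * iter_dt q i).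
  have -> : (Delta^`() * i.+1%:R) \Po P = (E^`() * P1 + E * P2 *+ 2) * i.+1%:R.
    by rewrite comp_polyM critical_factor_deriv comp_poly_nat.
  have aux (A : comNzRingType) (e f f' p p2 w w' : A) :
    f * e * (w' * p - w * p2 *+ (2 * i).+1) = ((f' * e) *+ i.+1 * p + f * e * p2) * w
      + f * e * p * w' - (f' * p + f * p2 *+ 2) * i.+1%:R * (e * w).
    rewrite -(mulr_natr (f' * e)) -(mulr_natr (w * p2)) -addn1 natrD natrM -(addn1 i) natrD.
    by move: i%:R => c; ring.
  by rewrite !derivM deriv_exp /= !exprS; apply: aux.
rewrite adic_topB // adic_top_comp_mul // IH mulr0 subr0 adic_top_deriv //.
rewrite (_ : P1 * _ = (Delta \Po P) * (E ^+ i * iter_dt q i)).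
  by rewrite adic_top_comp_mul // IH mulr0 derivC.
rewrite HE !exprS; ring.
Qed.

Lemma size_iter_dt (q : {poly R}) d i : (size q <= d.+1)%N -> (size (iter_dt q i) <= (d + i * s.-1).+1)%N.
Proof.
move=> sq; elim: i => [|i IH] /=; first by rewrite addn0.
have sP1 : size P1 = s.+1 by rewrite size_deriv; case: (size P) sP => [|[]].
have sP2 : size P2 = s by rewrite size_deriv sP1.
have s0 : (0 < s)%N by case: (size P) sP => [|[|[]]].
have aux (x y z : nat) : (0 < z)%N -> (x <= y.+1)%N -> ((x.-1 + z.+1).-1 <= (y + z.-1).+1)%N.
  by clear; lia.
have aux2 (x y z : nat) : (0 < z)%N -> (x <= y.+1)%N -> ((x + z).-1 <= (y + z.-1).+1)%N.
  by clear; lia.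
have -> : (d + i.+1 * s.-1 = (d + i * s.-1) + s.-1)%N by rewrite mulSn addnCA addnC.
apply: leq_trans (size_polyD _ _) _; rewrite size_polyN geq_max; apply/andP; split.
  apply: leq_trans (size_polyMleq _ _) _; rewrite size_deriv sP1.
  exact: aux s0 IH.
rewrite -scaler_nat; apply: leq_trans (size_scale_leq _ _) _.
by apply: leq_trans (size_polyMleq _ _) _; rewrite sP2; apply: aux2.
Qed.

Lemma size_iter_dt_common (q : {poly R}) d i : (size q <= d.+1)%N -> (i <= s)%N ->
  (size (iter_dt_common q i) <= (d + 2 * s * s).+1)%N.
Proof.
move=> sq li; apply: leq_trans (size_polyMleq _ _) _.
have sP1 : size P1 = s.+1 by rewrite size_deriv; case: (size P) sP => [|[]].
have h1 : (size (P1 ^+ (2 * (s - i)))%R <= (s * (2 * (s - i))).+1)%N.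
  by have := size_poly_exp_leq P1 (2 * (s - i)); rewrite sP1.
have := leq_add h1 (size_iter_dt i sq).
have aux (t x y : nat) : (i <= t)%N ->
    (x + y <= (t * (2 * (t - i))).+1 + (d + i * t.-1).+1)%N -> ((x + y).-1 <= (d + 2 * t * t).+1)%N.
  move=> li2 h; have e : (t * (2 * (t - i)) + 2 * (t * i) = 2 * t * t)%N.
    by rewrite mulnCA -mulnDr -mulnDr subnK // mulnA.
  have : (i * t.-1 <= t * i)%N by rewrite mulnC leq_mul ?leq_pred.
  move: (t * (2 * (t - i)))%N (t * i)%N (2 * t * t)%N (i * t.-1)%N e h; clear; lia.
exact: aux.
Qed.

(** The factor [Delta] clears the denominators [P'^2]; the factor [t], that is [P], kills the
    boundary terms at [a] and [b]. *)
Let Y := 'X * Delta.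

Let Y_neq0 : Y != 0.
Proof. by rewrite mulf_neq0 // polyX_eq0. Qed.

Let Y_comp i : (Y ^+ i) \Po P = P ^+ i * E ^+ i * P1 ^+ (2 * i).
Proof.
rewrite rmorphXn /= comp_polyM comp_polyX HE mulrA !exprMn mul2n -addnn exprD //.
Qed.

(* The polynomial [b(P) P' (d/dt)^i (q / P')], for [b] vanishing to order [i]
   at the critical values. *)
Definition iter_dt_mul q i (b : {poly R}) :=
  P ^+ i * E ^+ i * ((b %/ Y ^+ i) \Po P) * iter_dt q i.

Lemma iter_dt_mulE q i c : Y ^+ i %| c ->
  P1 ^+ (2 * i) * iter_dt_mul q i c = (c \Po P) * iter_dt q i.
Proof.
move=> dc; rewrite /iter_dt_mul -[in RHS](divpK dc) comp_polyM Y_comp; ring.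
Qed.

Lemma iter_dt_mul_common q i c : (i <= s)%N -> Y ^+ i %| c ->
  P1 ^+ (2 * s) * iter_dt_mul q i c = (c \Po P) * iter_dt_common q i.
Proof.
move=> li dc; rewrite [RHS]mulrCA -(iter_dt_mulE q dc) [RHS]mulrA -exprD.
by rewrite -mulnDr subnK.
Qed.

Lemma dvdp_exp_deriv (F : fieldType) (y c : {poly F}) i : y ^+ i.+1 %| c -> y ^+ i %| c^`().
Proof.
move=> /divpK <-; rewrite derivM deriv_exp /= exprS.
rewrite dvdp_add //; first by rewrite mulrA dvdp_mull.
by rewrite -mulr_natr dvdp_mull // dvdp_mulr // dvdp_mull.
Qed.

(** Integration by parts: [c(P) iter_dt q i / P'^(2 i + 1)] is a polynomial divisible by [P], hence
    zero at both ends. *)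
Lemma mom_iter_dt_mulS q i c : Y ^+ i.+1 %| c ->
  mom a b (iter_dt_mul q i.+1 c) = - mom a b (iter_dt_mul q i c^`()).
Proof.
move=> dc; have dc' := dvdp_exp_deriv dc.
pose G := P ^+ i.+1 * E ^+ i.+1 * ((c %/ Y ^+ i.+1) \Po P) * P1 * iter_dt q i.
have HG : P1 ^+ (2 * i).+1 * G = (c \Po P) * iter_dt q i.
  rewrite -[in RHS](divpK dc) comp_polyM Y_comp /G mulnS !exprS; ring.
have : mom a b G^`() = 0.
  by rewrite mom_deriv /G !exprS !hornerM Pa0 Pb0 !mul0r subrr.
clearbody G => G0.
have G' : G^`() = iter_dt_mul q i c^`() + iter_dt_mul q i.+1 c.
  have P10 : P1 ^+ (2 * i.+1) != 0 by rewrite expf_neq0.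
  apply: (mulfI P10); rewrite mulrDr (iter_dt_mulE q dc) mulnS exprD.
  rewrite -![P1 ^+ 2 * _ * _]mulrA (iter_dt_mulE q dc').
  have := congr1 (@deriv R) HG; rewrite !derivM deriv_comp deriv_exp -pred_Sn => e.
  have -> : P1 ^+ 2 * (P1 ^+ (2 * i) * G^`()) = P1 * (P1 ^+ (2 * i).+1 * G^`()).
    by rewrite !exprS; ring.
  have -> : P1 ^+ (2 * i).+1 * G^`() = (c^`() \Po P) * P1 * iter_dt q i +
     (c \Po P) * (iter_dt q i)^`() - P2 * P1 ^+ (2 * i) *+ (2 * i).+1 * G.
    by rewrite -e addrAC subrr add0r.
  have aux (A : comNzRingType) (p1 p2 k cc c' w w' g : A) m : p1 ^+ (2 * m).+1 * g = cc * w ->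
     p1 * (c' * p1 * w + cc * w' - p2 * p1 ^+ (2 * m) *+ (2 * m).+1 * g) =
     p1 ^+ 2 * (c' * w) + cc * (w' * p1 - w * p2 *+ (2 * m).+1).
    rewrite exprS -(mulr_natr (p2 * _)) -(mulr_natr (w * p2)).
    move: (p1 ^+ (2 * m)) ((2 * m).+1%:R) => x y h.
    transitivity (p1 ^+ 2 * (c' * w) + cc * w' * p1 - p2 * y * (p1 * x * g)); first by ring.
    by rewrite h; ring.
  exact: aux HG.
by move: G0; rewrite G' raddfD /= => /eqP; rewrite addrC addr_eq0 => /eqP.
Qed.

(** A linear functional of [T], whose value at [X^j] is the moment [m_j]. *)
Definition comp_mom q (T : {poly R}) := mom a b ((T \Po P) * q).

Lemma comp_mom_is_linear q : linear_for *%R (comp_mom q).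
Proof.
move=> c f g; rewrite /comp_mom comp_polyD comp_polyZ mulrDl -scalerAl.
by rewrite linearP.
Qed.

HB.instance Definition _ q :=
  GRing.isLinear.Build R {poly R} R _ (comp_mom q) (comp_mom_is_linear q).

Lemma mom_iter_dt_mul q i c : Y ^+ i %| c ->
  mom a b (iter_dt_mul q i c) = (-1) ^+ i * comp_mom q c^`(i).
Proof.
elim: i => [|i IH] in c *.
  by rewrite /iter_dt_mul /comp_mom derivn0 divp1 !mul1r.
move=> dc; rewrite mom_iter_dt_mulS // IH ?dvdp_exp_deriv //.
by rewrite -derivSn exprS -mulrA mulN1r.
Qed.

(** Integrate [S(P)] against the relation satisfied by [q / P']. Divisibility by [Y^r] permits [r]
    integrations by parts, which move the operator onto [S]. *)
Lemma comp_mom_adjoint_dvd q r (alpha : nat -> {poly R}) S : (r <= s)%N ->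
  comp_comb P (iter_dt_common q) alpha r.+1 = 0 -> Y ^+ r %| S ->
  \sum_(i < r.+1) (-1) ^+ i * comp_mom q (alpha i * S)^`(i) = 0.
Proof.
move=> rs rel dS.
have dv (i : 'I_r.+1) : Y ^+ i %| alpha i * S.
  by rewrite dvdp_mull // (dvdp_trans _ dS) // dvdp_exp2l // -ltnS.
transitivity (mom a b (\sum_(i < r.+1) iter_dt_mul q i (alpha i * S))).
  by rewrite raddf_sum; apply: eq_bigr => i _; rewrite -mom_iter_dt_mul.
rewrite (_ : \sum_(i < r.+1) _ = 0) ?raddf0 //.
apply: (mulfI (_ : P1 ^+ (2 * s) != 0)); first by rewrite expf_neq0.
transitivity ((S \Po P) * comp_comb P (iter_dt_common q) alpha r.+1); last by rewrite rel !mulr0.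
rewrite /comp_comb !mulr_sumr; apply: eq_bigr => i _.
have li : (i <= s)%N by apply: leq_trans rs; rewrite -ltnS.
by rewrite (iter_dt_mul_common q li (dv i)) comp_polyM; ring.
Qed.

Lemma comp_mom_eq0 q k (T : {poly R}) : (forall j, (j < k)%N -> comp_mom q 'X^j = 0) ->
  (size T <= k)%N -> comp_mom q T = 0.
Proof.
move=> H sT; rewrite -[T]coefK poly_def raddf_sum big1 // => i _.
by rewrite /= linearZ /= H ?mulr0 // (leq_trans (ltn_ord i)).
Qed.

(** Reduce [S] modulo [Y^r]. The multiple of [Y^r] is covered by [comp_mom_adjoint_dvd]; the
    remainder has degree below [r n] and meets only the first [k] moments, which vanish. *)
Lemma comp_mom_adjoint q r (alpha : nat -> {poly R}) k d : (r <= s)%N ->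
  (size Delta <= n)%N ->
  comp_comb P (iter_dt_common q) alpha r.+1 = 0 ->
  (forall i, (i <= r)%N -> (size (alpha i) <= d.+1)%N) ->
  (forall j, (j < k)%N -> comp_mom q 'X^j = 0) -> (d + r * n <= k)%N ->
  forall S, \sum_(i < r.+1) (-1) ^+ i * comp_mom q (alpha i * S)^`(i) = 0.
Proof.
move=> rs sD rel sa Hk dk S.
have Yr0 : Y ^+ r != 0 by rewrite expf_neq0.
have addF S1 S2 : \sum_(i < r.+1) (-1) ^+ i * comp_mom q (alpha i * (S1 + S2))^`(i) =
    \sum_(i < r.+1) (-1) ^+ i * comp_mom q (alpha i * S1)^`(i) +
    \sum_(i < r.+1) (-1) ^+ i * comp_mom q (alpha i * S2)^`(i).
  rewrite -big_split /=; apply: eq_bigr => i _.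
  by rewrite [alpha i * _]mulrDr derivnD raddfD /= mulrDr.
rewrite [S](divp_eq _ (Y ^+ r)) addF comp_mom_adjoint_dvd ?dvdp_mull // add0r.
rewrite big1 // => i _.
rewrite (comp_mom_eq0 Hk) ?mulr0 //.
apply: leq_trans (_ : size (alpha i * (S %% Y ^+ r))%R <= _)%N.
  move: (alpha i * _) => A; elim: (nat_of_ord i) => // m IH; rewrite derivnS size_deriv.
  exact: leq_trans (leq_pred _) IH.
apply: leq_trans (size_polyMleq _ _) _.
have h1 : (size (S %% Y ^+ r)%R <= r * n)%N.
  rewrite -ltnS; apply: leq_trans (_ : size (Y ^+ r) <= _)%N; first by rewrite ltn_modp.
  apply: leq_trans (size_poly_exp_leq _ _) _; rewrite ltnS mulnC leq_mul2l.
  by rewrite /Y mulrC size_mulX //= sD orbT.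
have h2 := sa i (ltn_ord i).
have := leq_add h2 h1; set x := (size _ + size _)%N; clearbody x; clear -dk rs; lia.
Qed.

Lemma adic_top_iter_dt_common q i : adic_top P q = 0 -> (i <= s)%N ->
  adic_top P (E ^+ s * iter_dt_common q i) = 0.
Proof.
move=> q0 li.
have -> : E ^+ s * iter_dt_common q i = (Delta ^+ (s - i) \Po P) * (E ^+ i * iter_dt q i).
  rewrite rmorphXn /= HE exprMn -exprM /iter_dt_common -{1}(subnK li) exprD.
  by ring.
by rewrite adic_top_comp_mul ?(ltnW sP) // adic_top_iter_dt // mulr0.
Qed.

(** The [s + 1] polynomials [E^s iter_dt_common q i] have top coefficient zero, so they lie in a
    module of rank [n - 1 = s] over [R[P]]. *)
Lemma iter_dt_common_relation q : adic_top P q = 0 -> E != 0 ->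
  exists2 beta : nat -> {poly R}, exists i : 'I_s.+1, beta i != 0 &
    comp_comb P (iter_dt_common q) beta s.+1 = 0.
Proof.
have sP1 : (1 < size P)%N by apply: ltnW.
move=> q0 E0; pose m := s.-1.
have em : s = m.+1 by rewrite /m; clear -sP; case: (size P) sP => [|[|[]]].
pose U i := E ^+ s * iter_dt_common q i.
have topU i : (i <= s)%N -> adic_top P (U i) = 0 by apply: adic_top_iter_dt_common.
pose V i (j : 'I_m.+1) : {poly R} := (adic P (U i))`_j.
have noinj (c : nat -> 'I_m.+1) : \det (\matrix_(i < s.+1, j < s.+1) V i (c j)) = 0.
  (* Any choice of [s + 1] columns among [s] repeats one. *)
  have /injectivePn[i [j nij e]] : ~~ injectiveb (fun i : 'I_s.+1 => c i).
    by apply/negP => /injectiveP /leq_card; rewrite !card_ord {1}em ltnn.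
  rewrite -det_tr; apply: (determinant_alternate nij) => k; rewrite !mxE.
  by rewrite e.
apply: contrapT => H.
have [|c] := @independent_rows_minor {poly R} m V s.+1; last by rewrite noinj eqxx.
move=> beta Hb i; apply: contra_notP H => /eqP bi; exists beta; first by exists i.
have U0 : comp_comb P U beta s.+1 = 0.
  apply: (adic_inj monP sP1) => j; rewrite adic_comp_comb //.
  have [jm|jm] := ltnP j m.+1; first exact: (Hb (Ordinal jm)).
  have ej : nat_of_ord j = n.-1.
    have := ltn_ord j; rewrite em in jm *; move: jm; rewrite -em => h1 h2.
    by apply/eqP; rewrite eqn_leq h1 andbT -ltnS prednK // -subn1 subn_gt0.
  rewrite ej big1 // => l _; rewrite -/(adic_top P (U l)) topU ?mulr0 //.
  by rewrite -ltnS.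
apply: (mulfI (_ : E ^+ s != 0)); first by rewrite expf_neq0.
rewrite mulr0 -[RHS]U0 /comp_comb mulr_sumr; apply: eq_bigr => l _; rewrite /U; ring.
Qed.

End MomentOperator.

(** * Laurent series at infinity *)

Section Laurent.
Variable R : realFieldType.
Implicit Types (g h : {poly R}) (f : int -> R) (j e : int).

(* [f : int -> R] stands for the series [\sum_j f j t^(-j-1)]; [poly_act] is the
   multiplication by a polynomial in [t] and [dt] the derivation [d/dt]. *)
Definition poly_act g f j : R := \sum_(i < size g) g`_i * f (j + i%:Z).

Definition dt f j : R := - (j%:~R * f (j - 1)).

(** So [t^(-e-1)] carries the leading term of the series at infinity. *)
Definition has_order f e := f e != 0 /\ forall j, j < e -> f j = 0.

Lemma poly_act_wide m g f j : (size g <= m)%N ->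
  poly_act g f j = \sum_(i < m) g`_i * f (j + i%:Z).
Proof.
move=> sg; rewrite /poly_act (big_ord_widen m (fun i => g`_i * f (j + i%:Z))) //.
rewrite big_mkcond; apply: eq_bigr => i _; case: ltnP => // h.
by rewrite nth_default // mul0r.
Qed.

Lemma poly_actD g h f : poly_act (g + h) f = poly_act g f \+ poly_act h f.
Proof.
apply/funext => j /=; pose m := maxn (size g) (size h).
rewrite !(@poly_act_wide m) ?size_polyD ?leq_maxl ?leq_maxr // -big_split /=.
by apply: eq_bigr => i _; rewrite coefD mulrDl.
Qed.

Lemma poly_actDr g f1 f2 : poly_act g (f1 \+ f2) = poly_act g f1 \+ poly_act g f2.
Proof.
apply/funext => j; rewrite /poly_act /= -big_split /=.
by apply: eq_bigr => i _; rewrite mulrDr.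
Qed.

Lemma poly_act_MXaddC g c f j :
  poly_act (g * 'X + c%:P) f j = poly_act g f (j + 1) + c * f j.
Proof.
rewrite (@poly_act_wide (size g).+1); last first.
  apply: leq_trans (size_polyD _ _) _; rewrite geq_max size_polyC; apply/andP; split.
    by apply: leq_trans (size_polyMleq _ _) _; rewrite size_polyX addn2.
  by case: eqP.
rewrite big_ord_recl /= coefD coefMX coefC /= add0r addr0 addrC; congr (_ + _).
apply: eq_bigr => i _; rewrite coefD coefMX coefC /= addr0; congr (_ * f _).
by rewrite -addrA -PoszD.
Qed.

Lemma poly_act0 f : poly_act 0 f = fun=> 0.
Proof. by apply/funext => j; rewrite /poly_act size_poly0 big_ord0. Qed.

Lemma poly_actM g h f : poly_act (g * h) f = poly_act g (poly_act h f).
Proof.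
elim/poly_ind: g => [|g c IH]; first by rewrite mul0r !poly_act0.
have actC (k : {poly R}) : poly_act (c%:P * k) f = fun j => c * poly_act k f j.
  apply/funext => j; rewrite (@poly_act_wide (size k)).
    by rewrite mulr_sumr; apply: eq_bigr => i _; rewrite coefCM mulrA.
  by rewrite mul_polyC size_scale_leq.
apply/funext => j; rewrite mulrDl mulrAC poly_actD /= poly_act_MXaddC actC; congr (_ + _).
by rewrite -[_ * 'X]addr0 -polyC0 poly_act_MXaddC mul0r addr0 IH.
Qed.

Lemma poly_actC c f : poly_act c%:P f = fun j => c * f j.
Proof.
apply/funext => j; rewrite -[c%:P]add0r -(mul0r 'X) poly_act_MXaddC poly_act0.
by rewrite add0r.
Qed.

Lemma poly_actX f : poly_act 'X f = fun j => f (j + 1).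
Proof.
apply/funext => j; rewrite -['X]mul1r -[_ * _]addr0 -polyC0 poly_act_MXaddC mul0r addr0.
by rewrite -polyC1 poly_actC mul1r.
Qed.

Lemma dt_poly_act g f : dt (poly_act g f) = poly_act g^`() f \+ poly_act g (dt f).
Proof.
elim/poly_ind: g => [|g c IH].
  by rewrite deriv0 !poly_act0; apply/funext => j; rewrite /dt /= mulr0 oppr0 addr0.
apply/funext => j; have := congr1 (fun F => F (j + 1)) IH; rewrite /= {1}/dt addrK.
have -> : (g * 'X + c%:P)^`() = g^`() * 'X + 0%:P + g.
  by rewrite derivD derivM derivX derivC polyC0 !addr0 mulr1.
have -> : dt (poly_act (g * 'X + c%:P) f) j = - (j%:~R * (poly_act g f j + c * f (j - 1))).
  by rewrite /dt poly_act_MXaddC subrK.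
rewrite poly_actD /= !poly_act_MXaddC mul0r addr0.
have -> : dt f j = - (j%:~R * f (j - 1)) by [].
rewrite intrD; set x := poly_act _ _ _; set y := poly_act _ _ _.
set z := poly_act _ _ _ => e.
transitivity (- ((j%:~R + 1) * x) + x - c * (j%:~R * f (j - 1))); first by ring.
by rewrite e; ring.
Qed.

Lemma has_order_poly_act g f e : g != 0 -> has_order f e ->
  has_order (poly_act g f) (e - (size g).-1%:Z).
Proof.
move=> g0 [fe fl]; have sg : (0 < size g)%N by rewrite size_poly_gt0.
have E j : (j <= e - (size g).-1%:Z) -> poly_act g f j = lead_coef g * f (j + (size g).-1%:Z).
  move=> lj; rewrite (poly_act_wide _ _ (leqSpred (size g))).
  rewrite big_ord_recr /= big1 ?add0r // => i _; rewrite fl ?mulr0 //.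
  by rewrite -ltrBrDr (le_lt_trans lj) // ltrD2l ltrN2 ltz_nat.
split=> [|j lj]; first by rewrite E // subrK mulf_neq0 // lead_coef_eq0.
by rewrite E ?ltW // fl ?mulr0 // -ltrBrDr.
Qed.

Lemma poly_act_below g f (m : int) j : (forall i, i < m -> f i = 0) ->
  j < m - (size g).-1%:Z -> poly_act g f j = 0.
Proof.
move=> fl lj; rewrite /poly_act big1 // => i _; rewrite fl ?mulr0 //.
rewrite -ltrBrDr (lt_le_trans lj) // lerD2l lerN2 lez_nat -ltnS prednK //.
by apply: leq_trans (ltn_ord i).
Qed.

Lemma dt_below f (m : int) : (forall i, i < m -> f i = 0) ->
  forall i, i < m + 1 -> dt f i = 0.
Proof. by move=> fl i li; rewrite /dt fl ?mulr0 ?oppr0 // ltrBlDr. Qed.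

(* The Euler operator [n t d/dt - c] multiplies the leading coefficient by
   [- n (e + 1) - c]. *)
Lemma has_order_euler (n : nat) (c : int) f e : has_order f e ->
  n%:Z * (e + 1) + c != 0 ->
  has_order (fun j => n%:R * poly_act 'X (dt f) j - c%:~R * f j) e.
Proof.
move=> [fe fl] nz.
have E j : n%:R * poly_act 'X (dt f) j - c%:~R * f j = - ((n%:Z * (j + 1) + c)%:~R * f j).
  rewrite poly_actX /dt addrK !intrD intrM intrD pmulrn; ring.
split=> [|j lj]; first by rewrite E oppr_eq0 mulf_neq0 // intr_eq0.
by rewrite E fl // mulr0 oppr0.
Qed.

End Laurent.

(** * Differential operators acting on Laurent series *)

Section LaurentCombination.
Variable R : realFieldType.
Implicit Types (g : {poly R}) (f : int -> R) (a al : nat -> {poly R}).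

Lemma poly_act_sum (I : Type) (s : seq I) (F : I -> int -> R) g :
  poly_act g (fun j => \sum_(i <- s) F i j) = fun j => \sum_(i <- s) poly_act g (F i) j.
Proof.
apply/funext => j; rewrite /poly_act exchange_big /=; apply: eq_bigr => i _.
by rewrite mulr_sumr.
Qed.

Lemma poly_actN g f : poly_act (- g) f = fun j => - poly_act g f j.
Proof.
apply/funext => j; apply/eqP; rewrite -addr_eq0.
have := congr1 (fun F => F j) (poly_actD (- g) g f); rewrite /= => <-.
by rewrite addNr poly_act0.
Qed.

(** The operator [\sum_i a_i(t) (d/dt)^i] on series, the counterpart of [comp_comb]. *)
Definition act_comb f a r : int -> R := fun j => \sum_(i < r) poly_act (a i) (iter i (@dt R) f) j.

Definition prev_coef a i := if i is i'.+1 then a i' else 0.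

Lemma dt_act_comb f a r : dt (act_comb f a r.+1) =
  fun j => act_comb f (fun i => (a i)^`() + prev_coef a i) r.+1 j
           + poly_act (a r) (iter r.+1 (@dt R) f) j.
Proof.
apply/funext => j.
transitivity (\sum_(i < r.+1) dt (poly_act (a i) (iter i (@dt R) f)) j).
  by rewrite /dt /act_comb mulr_sumr -sumrN.
under eq_bigr do rewrite dt_poly_act.
rewrite big_split /= /act_comb.
under [in RHS]eq_bigr do rewrite poly_actD.
rewrite big_split /= -addrA; congr (_ + _).
rewrite [in RHS]big_ord_recl [in LHS]big_ord_recr /= poly_act0 add0r.
by congr (_ + _).
Qed.

(* The coefficients, reduced by the relation [al] of order [r.+1], of the Euler
   operator [al_r.+1 (n t d/dt - c)] applied to the operator [a]. *)
Definition euler_coef a al r (n : nat) (c : int) i : {poly R} :=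
  al r.+1 * (n%:R * 'X * ((a i)^`() + prev_coef a i) - c%:~R * a i)
  - n%:R * 'X * a r * al i.

(** Composition with [t d/dt] creates one term of order [r + 1]; the factor [al_(r+1)] lets the
    relation trade it for lower ones. *)
Lemma act_comb_euler f a al r (n : nat) (c : int) :
  (forall j, act_comb f al r.+2 j = 0) ->
  act_comb f (euler_coef a al r n c) r.+1 = poly_act (al r.+1)
    (fun j => n%:R * poly_act 'X (dt (act_comb f a r.+1)) j - c%:~R * act_comb f a r.+1 j).
Proof.
move=> rel; pose D i := iter i (@dt R) f.
have relr : poly_act (al r.+1) (D r.+1) = fun j => - act_comb f al r.+1 j.
  apply/funext => j; apply/eqP; rewrite -addr_eq0 -[X in _ == X](rel j) addrC.
  by rewrite /act_comb [in X in _ == X]big_ord_recr.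
have scal (k : {poly R}) (x : R) F : k = x%:P -> (fun j => x * F j) = poly_act k F.
  by move=> ->; rewrite poly_actC.
have en : (n%:R : {poly R}) = n%:R%:P by rewrite polyC_natr.
have ec : (c%:~R : {poly R}) = c%:~R%:P by rewrite rmorph_int.
pose b i := (a i)^`() + prev_coef a i.
have act_mul k d m : act_comb f (fun i => k * d i) m = poly_act k (act_comb f d m).
  rewrite /act_comb poly_act_sum; apply/funext => j; apply: eq_bigr => i _.
  by rewrite poly_actM.
have act_sub d d' m : act_comb f (fun i => d i - d' i) m = fun j => act_comb f d m j - act_comb f d' m j.
  rewrite /act_comb; apply/funext => j; rewrite -sumrB; apply: eq_bigr => i _.
  by rewrite poly_actD poly_actN.
have subE F G : (fun j => F j - G j) = F \+ (fun j => - G j) :> (int -> R) by [].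
rewrite /euler_coef act_sub act_mul act_sub !act_mul -/b.
rewrite (subE (fun j => n%:R * _)) (scal _ _ (poly_act 'X _) en) -poly_actM dt_act_comb -/b.
have -> : (fun j => act_comb f b r.+1 j + poly_act (a r) (iter r.+1 (@dt R) f) j) =
   act_comb f b r.+1 \+ poly_act (a r) (D r.+1) by [].
rewrite poly_actDr (subE (poly_act _ _)) !poly_actDr.
have -> : (fun j => - (c%:~R * act_comb f a r.+1 j)) = poly_act (- c%:~R) (act_comb f a r.+1).
  by rewrite poly_actN ec poly_actC.
have -> : (fun j => - poly_act c%:~R (act_comb f a r.+1) j) = poly_act (- c%:~R) (act_comb f a r.+1).
  by rewrite poly_actN.
have -> : poly_act (al r.+1) (poly_act (n%:R * 'X) (poly_act (a r) (D r.+1))) =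
   fun j => - poly_act (n%:R * 'X * a r) (act_comb f al r.+1) j.
  transitivity (poly_act (n%:R * 'X * a r) (poly_act (al r.+1) (D r.+1))).
    by rewrite -!poly_actM; congr (poly_act _ _); ring.
  rewrite relr; apply/funext => j; rewrite /poly_act -sumrN.
  by apply: eq_bigr => i _; rewrite mulrN.
apply/funext => j /=; ring.
Qed.

End LaurentCombination.

Lemma size_mul_top (F : fieldType) (p q : {poly F}) i j :
  (size p <= i.+1)%N -> (size q <= j.+1)%N -> (size (p * q)%R <= (i + j).+1)%N.
Proof.
move=> sp sq; apply: leq_trans (size_polyMleq _ _) _.
by have := leq_add sp sq; set x := (size _ + _)%N; lia.
Qed.

Lemma coef_mul_top (F : fieldType) (p q : {poly F}) i j :
  (size p <= i.+1)%N -> (size q <= j.+1)%N -> (p * q)`_(i + j) = p`_i * q`_j.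
Proof.
move=> sp sq; rewrite coefM (bigD1 (Ordinal (leq_addr j i : i < (i + j).+1)%N)) //=.
rewrite addKn big1 ?addr0 // => k nk; have [lk|lk] := ltnP k i.
  rewrite [q`__]nth_default ?mulr0 // (leq_trans sq) // ltn_subRL addnC; lia.
have ki : (i < k)%N by rewrite ltn_neqAle lk andbT; apply: contraNneq nk => e; apply/eqP/val_inj.
by rewrite [p`__]nth_default ?mul0r // (leq_trans sp).
Qed.

(** * One descent step on the polynomial side *)

Section CombinationDescent.
Variables (R : realFieldType) (P : {poly R}) (W al : nat -> {poly R}) (k r : nat).
Hypotheses (monP : P \is monic) (sP : (2 < size P)%N).
Local Notation n := (size P).-1.
Local Notation s := (size P).-2.
Local Notation P1 := P^`().
Local Notation P2 := P^`()^`().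
Hypothesis HW : forall i, (i <= r)%N -> P1 * (W i)^`() - (P2 * W i) *+ k = P1 ^+ 2 * W i.+1.
Hypotheses (al0 : al r.+1 != 0) (rel : comp_comb P W al r.+2 = 0).

(** [HW] says that [W i / P'^k] has [t]-derivative [W (i + 1) / P'^k], so this is the polynomial
    counterpart of [dt_act_comb]. *)
Lemma deriv_comp_comb a (u := comp_comb P W a r.+1) :
  P1 * u^`() - (P2 * u) *+ k = P1 ^+ 2 *
    (comp_comb P W (fun i => (a i)^`() + prev_coef a i) r.+1 + (a r \Po P) * W r.+1).
Proof.
rewrite /u /comp_comb raddf_sum /= !mulr_sumr -sumrMnl -sumrB.
transitivity (\sum_(i < r.+1) (P1 ^+ 2 * (((a i)^`() \Po P) * W i) + P1 ^+ 2 * ((a i \Po P) * W i.+1))).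
  apply: eq_bigr => i _; rewrite derivM deriv_comp [X in _ = _ + X]mulrCA -HW -1?ltnS //.
  rewrite mulrBr -!mulrnAr; ring.
rewrite big_split /= -!mulr_sumr -mulrDr; congr (_ * _).
under [in RHS]eq_bigr do rewrite comp_polyD mulrDl.
rewrite big_split /= -addrA; congr (_ + _).
rewrite [in RHS]big_ord_recl [in LHS]big_ord_recr /= comp_poly0 mul0r add0r.
by congr (_ + _).
Qed.

Lemma comp_comb_euler a c (u := comp_comb P W a r.+1) :
  P1 ^+ 2 * comp_comb P W (euler_coef a al r n c) r.+1 =
  (al r.+1 \Po P) * (n%:R * P * (P1 * u^`() - (P2 * u) *+ k) - c%:~R * P1 ^+ 2 * u).
Proof.
rewrite deriv_comp_comb -/u.
have relr : (al r.+1 \Po P) * W r.+1 = - comp_comb P W al r.+1.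
  by apply/eqP; rewrite -addr_eq0 -[X in _ == X]rel addrC /comp_comb [X in _ == X]big_ord_recr.
pose b i := (a i)^`() + prev_coef a i; rewrite -/b.
have comb_mul g d m : comp_comb P W (fun i => g * d i) m = (g \Po P) * comp_comb P W d m.
  by rewrite /comp_comb mulr_sumr; apply: eq_bigr => i _; rewrite comp_polyM mulrA.
have comb_sub d d' m : comp_comb P W (fun i => d i - d' i) m = comp_comb P W d m - comp_comb P W d' m.
  by rewrite /comp_comb -sumrB; apply: eq_bigr => i _; rewrite comp_polyB mulrBl.
rewrite /euler_coef comb_sub comb_mul comb_sub !comb_mul -/b -/u.
have -> : (c%:~R \Po P : {poly R}) = c%:~R by rewrite -[c%:~R](rmorph_int polyC) comp_polyC.
rewrite !comp_polyM comp_poly_nat comp_polyX.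
have -> : comp_comb P W al r.+1 = - ((al r.+1 \Po P) * W r.+1) by rewrite relr opprK.
ring.
Qed.

(** For large [x], [u / P'^k] grows like [t^(c/n)] with [c = deg u - k s], a power that
    [n t d/dt - c] annihilates. So the leading term cancels, and only the factor [al_(r+1)(P)] adds
    degree. *)
Lemma size_euler a (u := comp_comb P W a r.+1) : u != 0 ->
  (size (comp_comb P W (euler_coef a al r n ((size u).-1%:Z - (k * s)%:Z)) r.+1) <
   size u + n * (size (al r.+1)).-1)%N.
Proof.
move=> u0; set c := (_ - _)%R; set v := comp_comb _ _ _ _.
have [->|v0] := eqVneq v 0; first by rewrite size_poly0 ltn_addr // size_poly_gt0.
pose X1 := n%:R * P * (P1 * u^`() - (P2 * u) *+ k) - c%:~R * P1 ^+ 2 * u.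
have Ev : P1 ^+ 2 * v = (al r.+1 \Po P) * X1 by rewrite /v comp_comb_euler.
have ns : n = s.+1 by rewrite prednK // -subn1 subn_gt0 ltnW.
have sP1 : size P1 = s.+1 by rewrite size_deriv ns.
have P10 : P1 != 0 by rewrite -size_poly_gt0 sP1.
pose e := (size u).-1.
have se : size u = e.+1 by rewrite /e prednK // size_poly_gt0.
have sX (f : {poly R}) i : (size f <= i.+1)%N -> (size ('X * f^`())%R <= i.+1)%N.
  move=> sf; have [->|f0] := eqVneq f^`() 0; first by rewrite mulr0 size_poly0.
  rewrite mulrC size_mulX // size_deriv ltnS; case: (size f) sf => //.
have cX (f : {poly R}) i : ('X * f^`())`_i = f`_i *+ i.
  by rewrite coefXM coef_deriv; case: i.
have X10 : X1 != 0.
  by apply: contra_eq_neq Ev => ->; rewrite mulr0 mulf_neq0 // expf_neq0.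
(* The extra factor [X] turns [d/dx] into [x d/dx], which preserves degree bounds and multiplies the
   coefficient of index [i] by [i]. *)
have EX : 'X * X1 = n%:R%:P * (P * (P1 * ('X * u^`()) - (('X * P2) * u) *+ k)) - c%:~R%:P * ('X * P1 ^+ 2 * u).
  rewrite /X1 polyC_natr rmorph_int -(mulr_natr (P2 * u)) -(mulr_natr ('X * P2 * u)).
  ring.
have sle (f : {poly R}) i : size f = i.+1 -> (size f <= i.+1)%N by move->.
have sP' : (size P <= n.+1)%N by apply: leqSpred.
have sC (x : R) : (size x%:P <= 1)%N by rewrite size_polyC; case: eqP.
pose l := u`_e.
have h1 : (size (P1 * ('X * u^`()))%R <= (s + e).+1)%N.
  by apply: size_mul_top; [exact: sle | apply: sX; exact: sle].
have h2 : (size ('X * P2 * u *+ k)%R <= (s + e).+1)%N.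
  rewrite -scaler_nat (leq_trans (size_scale_leq _ _)) //.
  by apply: size_mul_top; [apply: sX; exact: sle | exact: sle].
have h3 : (size (P1 * ('X * u^`()) - 'X * P2 * u *+ k)%R <= (s + e).+1)%N.
  by rewrite (leq_trans (size_polyD _ _)) // size_polyN geq_max h1.
have h4 := size_mul_top sP' h3.
have h5 : (size (P1 ^+ 2)%R <= (s + s).+1)%N by apply: size_mul_top; exact: sle.
have sXX : (size ('X : {poly R}) <= 2)%N by rewrite size_polyX.
have h6 := size_mul_top sXX h5.
have h7 := size_mul_top h6 (sle u e se).
have eN : (1 + (s + s) + e = n + (s + e))%N.
  by move: ns; move: (s) => x; move: (n) => y ->; lia.
have cP : P`_n = 1 by move/monicP: monP.
have cP1 : P1`_s = n%:R by rewrite coef_deriv -ns cP.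
have sXX1 : (size ('X * X1)%R <= (n + (s + e)).+1)%N.
  rewrite EX (leq_trans (size_polyD _ _)) // size_polyN geq_max.
  apply/andP; split; rewrite mul_polyC (leq_trans (size_scale_leq _ _)) //.
  by rewrite -eN.
(* The two products contribute [n^2 l (e - k s)] and [c n^2 l], equal by the choice of [c]. *)
have topX1 : ('X * X1)`_(n + (s + e)) = 0.
  rewrite EX coefB !coefCM (coef_mul_top sP' h3) coefB coefMn.
  rewrite (coef_mul_top (sle _ _ sP1)); last by apply: sX; exact: sle.
  rewrite (coef_mul_top (sX _ _ (sle _ _ sP1)) (sle _ _ se)) !cX.
  rewrite -eN (coef_mul_top h6 (sle u e se)) (coef_mul_top sXX h5) coefX /=.
  rewrite expr2 (coef_mul_top (sle _ _ sP1) (sle _ _ sP1)) cP cP1.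
  have -> : c%:~R = e%:R - k%:R * s%:R :> R by rewrite /c rmorphB /= -natrM.
  rewrite -/l -(mulr_natr l e) -(mulr_natr n%:R s) -(mulr_natr (_ * l) k).
  by move: (k%:R) (e%:R) (s%:R) (n%:R) => x1 x2 x3 x4; ring.
have sX1 : (size X1 < n + (s + e))%N.
  have : (size ('X * X1)%R <= n + (s + e))%N.
    rewrite -ltnS ltn_neqAle sXX1 andbT; apply: contra_eq_neq topX1 => e1.
    have -> : (n + (s + e))%N = (size ('X * X1)%R).-1 by rewrite e1.
    by rewrite -lead_coefE lead_coef_eq0 mulf_neq0 // polyX_eq0.
  by rewrite mulrC size_mulX.
have aP0 : al r.+1 \Po P != 0 by rewrite comp_poly_eq0 // ltnW.
have := congr1 (fun f : {poly R} => size f) Ev.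
rewrite !size_mul ?expf_neq0 // ?mulf_neq0 // sP1.
have := size_comp_poly (al r.+1) P; rewrite -size_poly_gt0 in aP0.
rewrite se; move: ns aP0 sX1.
set x := size v; set y := size X1; set z := size (_ \Po _); set w := (size _).-1.
move: (s) => s'; move: (n) => n' -> z0 y1 z1 e1; rewrite mulnC -z1.
clearbody x y z; clear - z0 y1 e1; lia.
Qed.

End CombinationDescent.

(** * Vanishing of all moments when the trace is zero *)

Section MomentVanishing.
Variables (R : realFieldType) (a b : R) (P : {poly R}).
Hypotheses (monP : P \is monic) (sP : (2 < size P)%N).
Hypotheses (Pa0 : P.[a] = 0) (Pb0 : P.[b] = 0).
Local Notation n := (size P).-1.
Local Notation s := (size P).-2.
Local Notation P1 := P^`().
Local Notation P2 := P^`()^`().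

(** [iter_dt_common] carries the factor [P'^(2 s + 1)] for every [i], whence the exponent
    [k = 2 s + 1] in the descent. *)
Lemma iter_dt_common_deriv q i : (i < s)%N ->
  P1 * (iter_dt_common P q i)^`() - (P2 * iter_dt_common P q i) *+ (2 * s).+1
  = P1 ^+ 2 * iter_dt_common P q i.+1.
Proof.
move=> li; rewrite /iter_dt_common -(subnK li).
move: (s - i.+1)%N => m; rewrite addnK addnS -addSn addnK derivM deriv_exp.
have -> : (2 * m.+1)%N = (2 * m).+2 by lia.
have -> : (2 * (m.+1 + i)).+1 = ((2 * m).+2 + (2 * i).+1)%N by lia.
rewrite -pred_Sn mulrnDr [iter_dt P q i.+1]/=.
have aux (A : comNzRingType) (p p2 w w' : A) (x y z : nat) :
   p * (p2 * p ^+ x.+1 *+ y * w + p ^+ x.+2 * w') - (p2 * (p ^+ x.+2 * w) *+ y + p2 * (p ^+ x.+2 * w) *+ z)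
   = p ^+ 2 * (p ^+ x * (w' * p - w * p2 *+ z)).
  rewrite -(mulr_natr (p2 * p ^+ x.+1)) -(mulr_natr (p2 * _) y) -(mulr_natr (p2 * _) z) -(mulr_natr (w * p2)).
  by move: (y%:R) (z%:R) => y' z'; rewrite !exprS; ring.
exact: aux.
Qed.

Variables Delta E q : {poly R}.
Hypotheses (D0 : Delta != 0) (HE : Delta \Po P = E * P1 ^+ 2) (E0 : E != 0).
Hypotheses (sD : (size Delta <= n)%N) (q0 : adic_top P q = 0).

Local Notation lam := (comp_mom a b P q).

(** The series [I], formally [\int_a^b q / (t - P)]. *)
Definition moment_series (j : int) : R := if j is Posz m then lam 'X^m else 0.

Lemma iter_dt_moment_series i (m : nat) :
  iter i (@dt R) moment_series m = (-1) ^+ i * lam ('X^m)^`(i).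
Proof.
elim: i m => [|i IH] m; first by rewrite mul1r.
rewrite iterS /dt derivSn; case: m => [|m].
  by rewrite mul0r oppr0 expr0 -polyC1 derivC linear0 raddf0 mulr0.
rewrite -addn1 PoszD addrK IH derivXn addn1 /= exprS mulN1r mulNr.
rewrite derivnMn raddfMn /= -mulr_natl; ring.
Qed.

(** On series, [d/dt] and multiplication by [T] are, up to sign, the transposes of the same
    operations on test polynomials. So the adjoint identity tested on [X^m] reads off a coefficient
    of the operator applied to [I]. *)
Lemma poly_act_moment_series i T (m : nat) :
  poly_act T (iter i (@dt R) moment_series) m = (-1) ^+ i * lam (T * 'X^m)^`(i).
Proof.
elim/poly_ind: T m => [|T c IH] m.
  by rewrite poly_act0 mul0r linear0 raddf0 mulr0.
rewrite poly_act_MXaddC iter_dt_moment_series -PoszD addn1 IH.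
rewrite mulrDl -mulrA -exprS mul_polyC derivnD derivnZ raddfD /= linearZ /=.
ring.
Qed.

Lemma iter_dt_moment_series_below i k : (forall j, (j < k)%N -> lam 'X^j = 0) ->
  forall j, j < k%:Z -> iter i (@dt R) moment_series j = 0.
Proof.
move=> Hk; elim: i => [|i IH] j lj.
  by case: j lj => // j; rewrite ltz_nat => /Hk.
rewrite iterS; apply: (dt_below IH); apply: lt_trans lj _.
by rewrite ltrDl.
Qed.


(** In the threshold on [k], the first term bounds the degrees of the coefficients of the relation
    and [s n] pays for the remainder modulo [Y^r]. *)
Lemma comp_mom_vanish dq k : (size q <= dq.+1)%N ->
  (forall j, (j < k)%N -> lam 'X^j = 0) ->
  (s * ((dq + 2 * s * s) %/ n) + s * n <= k)%N -> forall j, lam 'X^j = 0.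
Proof.
have sP1 : (1 < size P)%N by apply: ltnW.
have ns : n = s.+1 by rewrite prednK // -subn1 subn_gt0.
have P10 : P1 != 0 by rewrite -size_poly_gt0 size_deriv ns.
move=> sq Hk sk.
have [||r [al [C [rs alr rel sal Hal]]]] :=
  @comp_comb_bounded_relation R P monP sP1 (iter_dt_common P q) s (dq + 2 * s * s)%N.
- by move=> i li; apply: (size_iter_dt_common sP sq li).
- exact: (iter_dt_common_relation monP sP HE q0 E0).
pose F g m := act_comb moment_series g m.
(* [I] satisfies the relation of [q / P']: at indices [m >= 0] by the adjoint identity with
   [S = X^m], at negative ones because the coefficients have degree at most [k] and the first [k]
   moments vanish. *)
have relF j : F al r.+1 j = 0.
  have drk : (r * ((dq + 2 * s * s) %/ n) + r * n <= k)%N.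
    by apply: leq_trans sk; rewrite leq_add // leq_mul2r rs orbT.
  case: j => m.
    rewrite /F /act_comb -[RHS](comp_mom_adjoint sP Pa0 Pb0 D0 HE rs sD rel sal Hk drk 'X^m).
    by apply: eq_bigr => i _; rewrite poly_act_moment_series.
  rewrite /F /act_comb big1 // => i _.
  apply: (poly_act_below (iter_dt_moment_series_below i Hk)).
  rewrite (@lt_le_trans _ _ 0) // subr_ge0 lez_nat.
  apply: leq_trans (leq_trans (leq_addr (r * n) _) drk).
  by have := sal i (ltn_ord i); case: (size _).
have uW g m : comp_comb P (fun i => E ^+ s * iter_dt_common P q i) g m =
    E ^+ s * comp_comb P (iter_dt_common P q) g m.
  by rewrite /comp_comb mulr_sumr; apply: eq_bigr => i _; ring.
have topW i : (i <= s)%N -> adic_top P (E ^+ s * iter_dt_common P q i) = 0.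
  exact: (adic_top_iter_dt_common monP sP HE q0).
case: r => [|r] in rs alr rel sal Hal relF *.
  have /eqP : q = 0.
    move: rel; rewrite /comp_comb big_ord1 => /eqP.
    rewrite mulf_eq0 comp_poly_eq0 // (negPf alr) /= mulf_eq0 expf_eq0 (negPf P10) andbF /=.
    by move=> /eqP.
  by move=> /eqP -> j; rewrite /comp_mom mulr0 linear0.
pose u g := comp_comb P (iter_dt_common P q) g r.+1.
(* The coefficients of [g] have degree at most [deg u / n + C] and the derivatives of [I] have no
   term of negative index, so [e] cannot be too negative. This bounds the descending quantity from
   below. *)
have lower g e : has_order (F g r.+1) e -> 0 <= (size (u g))%:Z + n%:Z * e + (n * C)%:Z.
  move=> [Fe _]; set Z := ((size (u g)).-1 %/ n + C)%N.
  have eZ : - Z%:Z <= e.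
    rewrite leNgt; apply/negP => eZ; move/eqP: Fe; apply; rewrite /F /act_comb big1 // => i _.
    apply: (@poly_act_below _ _ _ 0).
      by move=> j lj; apply: (iter_dt_moment_series_below i Hk); apply: lt_le_trans lj _.
    apply: lt_le_trans eZ _; rewrite sub0r lerN2 lez_nat.
    by apply: leq_trans (leq_pred _) _; apply: (Hal g).2.
  have : n%:Z * - Z%:Z <= n%:Z * e by rewrite ler_wpM2l.
  have : (Z * n <= size (u g) + n * C)%N.
    rewrite /Z mulnDl [(C * n)%N]mulnC leq_add2r.
    by apply: leq_trans (leq_trunc_div _ _) (leq_pred _).
  rewrite -lez_nat PoszD !PoszM mulrN [n%:Z * Z%:Z]mulrC.
  move: (Z%:Z * n%:Z) (n%:Z * C%:Z) (n%:Z * e) ((size (u g))%:Z) => x1 x2 x3 x4 h1 h2.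
  by clear -h1 h2; lia.
have descent g e : has_order (F g r.+1) e -> exists g' e', has_order (F g' r.+1) e' /\
    (size (u g'))%:Z + n%:Z * e' < (size (u g))%:Z + n%:Z * e.
  move=> oF.
  have u0 : u g != 0.
    apply: contra_eq_neq (erefl (F g r.+1 e)) => ua; case: oF => + _; apply: contra_neqT.
    by move=> _; rewrite /F /act_comb big1 // => i _; rewrite (Hal g).1 ?poly_act0.
  pose c : int := (size (u g)).-1%:Z - ((2 * s).+1 * s)%:Z.
  exists (euler_coef g al r n c), (e - (size (al r.+1)).-1%:Z); split.
    rewrite /F act_comb_euler //; apply: has_order_poly_act => //.
    apply: has_order_euler => //.
    (* Were the Euler factor [n (e + 1) + c] zero, [n] would divide [size (E^s u)], against
       [adic_top0_size]; here [deg E = n deg Delta - 2 s]. *)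
    have Eu0 : E ^+ s * u g != 0 by rewrite mulf_neq0 // expf_neq0.
    have top0 : adic_top P (E ^+ s * u g) = 0.
      rewrite -uW adic_top_sum // big1 // => i _.
      by rewrite adic_top_comp_mul // topW ?mulr0 //; apply: leq_trans rs; apply: ltnW.
    have := adic_top0_size monP sP1 Eu0 top0; apply: contra_neqN => H.
    have sE : (size E).-1%:Z = n%:Z * (size Delta).-1%:Z - (2 * s)%:Z.
      have := congr1 (fun f : {poly R} => (size f).-1) HE.
      have sP12 := size_exp P1 2; rewrite size_deriv ns in sP12.
      rewrite size_comp_poly size_mul ?expf_neq0 //; move: sP12 E0 (expf_neq0 2 P10).
      rewrite -!size_poly_gt0; move: (size Delta).-1 (size E) (size (P1 ^+ 2)) => x1 x2 x3.
      move: ns; move: (s) => x4; move: (n) => x5 _; clear=> h1 h2 h3 h4.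
      have e : (x5 * x1 = x2.-1 + 2 * x4)%N by rewrite mulnC h4; lia.
      by rewrite -PoszM e; lia.
    have sEs := size_exp E s.
    have : (n%:Z %| (size (E ^+ s * u g)%R)%:Z)%Z; last by rewrite dvdzE => /eqP.
    apply/dvdzP; exists (s%:Z * (size Delta).-1%:Z - e); rewrite size_mul ?expf_neq0 //.
    have : (0 < size (E ^+ s))%N by rewrite size_poly_gt0 expf_neq0.
    have : (0 < size (u g))%N by rewrite size_poly_gt0.
    move: H sE sEs; rewrite /c; move: ns; move: (size E).-1 (size Delta).-1 (size (E ^+ s)) (size (u g)).
    move: (s) => x4; move: (n) => x5 x1 x2 x3 x6 ->; clear => H sE sEs h1 h2.
    have e1 : (x3 + x6).-1 = (x3.-1 + x6.-1 + 1)%N by lia.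
    have e2 : Posz x6.-1 = Posz ((2 * x4).+1 * x4) - Posz x4.+1 * (e + 1).
      by move: H; move: (_ * _)%:Z (_ * (e + 1)) => X1 X2; lia.
    by rewrite e1 !PoszD e2 sEs PoszM sE -[(2 * x4).+1]addn1 -[x4.+1]addn1 !(PoszM, PoszD); ring.
  have HW i : (i <= r)%N -> P1 * (iter_dt_common P q i)^`() - (P2 * iter_dt_common P q i) *+ (2 * s).+1
     = P1 ^+ 2 * iter_dt_common P q i.+1.
    by move=> li; apply: iter_dt_common_deriv; apply: leq_ltn_trans li rs.
  (* [size u] grows by less than [n deg al_(r+1)], while [e] drops by exactly [deg al_(r+1)]. *)
  have := size_euler monP sP HW alr rel u0; rewrite -/c -/(u _) -ltz_nat PoszD PoszM.
  rewrite mulrBr; move: (n%:Z * e) (n%:Z * _) (size (u g))%:Z (size _)%:Z => x1 x2 x3 x4.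
  by clear; lia.
have noF g e : ~ has_order (F g r.+1) e.
  suff H (m : nat) : forall g e, (size (u g))%:Z + n%:Z * e + (n * C)%:Z <= m%:Z -> ~ has_order (F g r.+1) e.
    by apply: (H (absz ((size (u g))%:Z + n%:Z * e + (n * C)%:Z))); rewrite abszE ler_norm.
  elim: m => [|m IH] {}g {}e le oF; have [g' [e' [oF' lt']]] := descent _ _ oF.
    by have := lower _ _ oF'; rewrite leNgt => /negP; apply; apply: lt_le_trans le; rewrite ltrD2r.
  apply: (IH g' e') oF'; move: lt' le.
  move: (n%:Z * e) (n%:Z * e') (n * C)%:Z (size (u g))%:Z (size (u g'))%:Z => x1 x2 x3 x4 x5.
  by clear; lia.
(* [one] is the identity operator, so a first nonzero moment would give [F one] an order. *)
pose one i : {poly R} := if i == 0%N then 1 else 0.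
have Fone : F one r.+1 = moment_series.
  apply/funext => j; rewrite /F /act_comb big_ord_recl big1 ?addr0.
    by rewrite /one /= -polyC1 poly_actC mul1r.
  by move=> i _; rewrite /one /= poly_act0.
move=> j; elim/ltn_ind: j => j IH; apply: contrapT => /eqP nj.
apply: (noF one j%:Z); rewrite Fone; split=> // -[m|m] //.
by rewrite ltz_nat => /IH.
Qed.

End MomentVanishing.

(** * Normalisation of [q] and [P], and the number of moments *)

Section MomentBautinIndex.
Variables (R : realFieldType) (a b : R).
Implicit Types P q : {poly R}.

Lemma mom_comp_deriv P g : P.[a] = P.[b] -> mom a b ((g \Po P) * P^`()) = 0.
Proof.
move=> Pab; rewrite -[g in g \Po P]deriv_prim -deriv_comp mom_deriv !horner_comp Pab.
by rewrite subrr.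
Qed.

Lemma adic_top_deriv_monic P : P \is monic -> (1 < size P)%N ->
  adic_top P P^`() = (size P).-1%:R.
Proof.
move=> monP sP; rewrite adic_top_small // ?size_deriv // coef_deriv prednK; last first.
  by rewrite -subn1 subn_gt0.
by rewrite -lead_coefE (monicP monP) polyC_natr.
Qed.

(** Since [P'] has top coefficient [n], subtracting [(adic_top q / n)(P) P'] makes that of [q] zero.
    Every [g(P) P'] has zero integral because [P(a) = P(b)], so no moment changes. *)
Lemma adic_top_normalize P q : P \is monic -> (1 < size P)%N -> P.[a] = P.[b] ->
  exists q', [/\ (size q' <= size q)%N, adic_top P q' = 0 &
                 forall T, comp_mom a b P q' T = comp_mom a b P q T].
Proof.
move=> monP sP Pab; have nz : (size P).-1%:R != 0 :> R by rewrite pnatr_eq0 -lt0n -subn1 subn_gt0.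
have sP0 : (0 < size P)%N by apply: ltnW.
have n0 : (0 < (size P).-1)%N by rewrite -subn1 subn_gt0.
pose c := (size P).-1%:R^-1 *: adic_top P q.
exists (q - (c \Po P) * P^`()); split.
- have [c0|c0] := eqVneq c 0; first by rewrite c0 comp_poly0 mul0r subr0.
  have t0 : adic_top P q != 0 by apply: contra_neq c0; rewrite /c => ->; rewrite scaler0.
  have q0 : q != 0 by apply: contra_neq t0 => ->; rewrite /adic_top adic0 coef0.
  rewrite (leq_trans (size_polyD _ _)) // size_polyN geq_max leqnn /=.
  have [j _ [_ H]] := adic_size monP sP q0.
  have ln : ((size P).-2 < (size P).-1)%N by rewrite prednK.
  have /= := H (Ordinal ln) t0; apply: leq_trans.
  have cP : c \Po P != 0 by rewrite comp_poly_eq0.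
  have P10 : P^`() != 0 by rewrite -size_poly_gt0 size_deriv.
  have e : (size (c \Po P)).-1 = ((size (adic_top P q)).-1 * (size P).-1)%N.
    by rewrite size_comp_poly /c size_scale ?invr_eq0.
  rewrite size_mul // size_deriv -/(adic_top P q) -e -addnS prednK //.
  by rewrite -subn1 leq_subLR addnA add1n prednK // size_poly_gt0.
- rewrite adic_topB // adic_top_comp_mul // adic_top_deriv_monic // /c.
  have -> : ((size P).-1%:R : {poly R}) = ((size P).-1%:R)%:P by rewrite polyC_natr.
  by rewrite -scalerAl mulrC mul_polyC scalerA mulVf // scale1r subrr.
move=> T; rewrite /comp_mom mulrBr raddfB /= mulrA -comp_polyM mom_comp_deriv // subr0 //.
Qed.

Lemma comp_mom_vanish_monic P q dq k : P \is monic -> (2 < size P)%N ->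
  P.[a] = 0 -> P.[b] = 0 -> (size q <= dq.+1)%N ->
  (5 + dq + 3 * (size P).-2 ^ 2 <= k)%N ->
  (forall j, (j < k)%N -> comp_mom a b P q 'X^j = 0) ->
  forall j, comp_mom a b P q 'X^j = 0.
Proof.
move=> monP sP Pa0 Pb0 sq lk Hk; have sP1 : (1 < size P)%N by apply: ltnW.
have [|q' [sq' top0 Hq']] := @adic_top_normalize P q monP sP1; first by rewrite Pa0.
have P10 : P^`() != 0 by rewrite -size_poly_gt0 size_deriv -subn1 subn_gt0.
have [Delta [D0 sD /divpK /esym HE]] := dvdp_sqr_comp_exists P10 (dvdpp _).
set E := _ %/ _ in HE.
have E0 : E != 0.
  apply: contra_eq_neq HE => ->; rewrite mul0r comp_poly_eq0 //.
rewrite size_deriv in sD.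
move=> j; rewrite -Hq'.
apply: (comp_mom_vanish monP sP Pa0 Pb0 D0 HE E0 sD top0 (leq_trans sq' sq) (k := k)).
  by move=> i li; rewrite Hq'; apply: Hk.
apply: leq_trans lk; have ns : (size P).-1 = (size P).-2.+1 by rewrite prednK // -subn1 subn_gt0.
rewrite ns; move: (size P).-2 => s; clear.
(* Multiplying by [s + 1] removes the integer quotient. *)
rewrite -(leq_pmul2r (ltn0Sn s)) mulnDl -mulnA [(_ %/ _ * _)%N]mulnC.
have : (s.+1 * ((dq + 2 * s * s) %/ s.+1) <= dq + 2 * s * s)%N.
  by rewrite mulnC leq_trunc_div.
nia.
Qed.

Lemma mom_vanish P q dq : a < b -> P.[a] = 0 -> P.[b] = 0 -> (size q <= dq.+1)%N ->
  (forall j, (j < 5 + dq + 3 * (size P^`()).-1 ^ 2)%N -> mom a b (P ^+ j * q) = 0) ->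
  forall j, mom a b (P ^+ j * q) = 0.
Proof.
move=> ab Pa0 Pb0 sq Hk; rewrite size_deriv in Hk.
have [s2|s2] := leqP (size P) 2.
  (* The degree is at most 1 and there are two roots, [a] and [b]. All moments but [m_0] are then
     trivially zero, and [m_0] is among the hypotheses. *)
  have P0 : P = 0.
    apply: contraTeq s2 => P0; rewrite -ltnNge.
    apply: (@max_poly_roots _ P [:: a; b]) => //=; first by rewrite /root Pa0 Pb0 !eqxx.
    by rewrite inE andbT lt_eqF.
  by case=> [|j]; [apply: Hk | rewrite P0 expr0n mul0r linear0].
pose c := (lead_coef P)^-1; have P0 : P != 0 by rewrite -size_poly_gt0 ltnW // ltnW.
have lc0 : lead_coef P != 0 by rewrite lead_coef_eq0.
have c0 : c != 0 by rewrite invr_eq0.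
have E j : comp_mom a b (c *: P) q 'X^j = c ^+ j * mom a b (P ^+ j * q).
  by rewrite /comp_mom rmorphXn /= comp_polyX exprZn -scalerAl linearZ.
have H := @comp_mom_vanish_monic (c *: P) q dq _ _ _ _ _ sq (leqnn _).
move=> j; apply: (mulfI (expf_neq0 j c0)); rewrite mulr0 -E; apply: H.
- by rewrite monicE lead_coefZ mulVf.
- by rewrite size_scale.
- by rewrite hornerZ Pa0 mulr0.
- by rewrite hornerZ Pb0 mulr0.
- by move=> i; rewrite size_scale // => li; rewrite E Hk ?mulr0.
Qed.

End MomentBautinIndex.

(** * The return map *)

Section WeightedNorm.
Variable R : realFieldType.

(** These laws pass from [A] to [wnorm] on [{poly A}], so the construction can be iterated, first in
    [x] and then in [y0]. *)
Definition ring_seminorm (A : comNzRingType) (nu : A -> R) :=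
  [/\ nu 0 = 0, forall x, nu (- x) = nu x, forall x y, nu (x + y) <= nu x + nu y
    & forall x y, nu (x * y) <= nu x * nu y].

(** A weighted [l^1] norm: submultiplicative, and an upper bound for the values on the disc of
    radius [rho]. *)
Definition wnorm (A : comNzRingType) (nu : A -> R) (rho : R) (p : {poly A}) :=
  \sum_(i < size p) nu p`_i * rho ^+ i.

Section Generic.
Variables (A : comNzRingType) (nu : A -> R) (rho : R).
Hypotheses (nuP : ring_seminorm nu) (rho0 : 0 <= rho).
Implicit Types p q : {poly A}.
Local Notation N := (wnorm nu rho).

Lemma seminorm_ge0 (x : A) : 0 <= nu x.
Proof.
have [nu0 nuN nuD _] := nuP.
by have := nuD x (- x); rewrite subrr nu0 nuN -mulr2n pmulrn_lge0.
Qed.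

Lemma seminormB (x y : A) : nu (x - y) <= nu x + nu y.
Proof. by have [_ nuN nuD _] := nuP; rewrite -(nuN y) nuD. Qed.

Lemma wnorm_wide m p : (size p <= m)%N -> N p = \sum_(i < m) nu p`_i * rho ^+ i.
Proof.
have [nu0 _ _ _] := nuP.
move=> sp; rewrite /wnorm (big_ord_widen m (fun i => nu p`_i * rho ^+ i)) //.
rewrite big_mkcond; apply: eq_bigr => i _; case: ltnP => // h.
by rewrite nth_default // nu0 mul0r.
Qed.

Lemma wnorm0 : N 0 = 0.
Proof. by rewrite /wnorm size_poly0 big_ord0. Qed.

Lemma wnorm_ge0 p : 0 <= N p.
Proof. by apply: sumr_ge0 => i _; rewrite mulr_ge0 ?seminorm_ge0 ?exprn_ge0. Qed.

Lemma wnormD p q : N (p + q) <= N p + N q.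
Proof.
have [_ _ nuD _] := nuP; pose m := maxn (size p) (size q).
rewrite !(@wnorm_wide m) ?size_polyD ?leq_maxl ?leq_maxr // -big_split /=.
by apply: ler_sum => i _; rewrite coefD -mulrDl ler_wpM2r ?exprn_ge0.
Qed.

Lemma wnormN p : N (- p) = N p.
Proof.
have [_ nuN _ _] := nuP; rewrite /wnorm size_polyN; apply: eq_bigr => i _.
by rewrite coefN nuN.
Qed.

Lemma wnorm_MXaddC p c : N (p * 'X + c%:P) = rho * N p + nu c.
Proof.
rewrite (@wnorm_wide (size p).+1); last first.
  apply: leq_trans (size_polyD _ _) _; rewrite geq_max size_polyC; apply/andP; split.
    by apply: leq_trans (size_polyMleq _ _) _; rewrite size_polyX addn2.
  by case: eqP.
rewrite big_ord_recl /= coefD coefMX coefC /= add0r mulr1 addrC; congr (_ + _).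
rewrite mulr_sumr; apply: eq_bigr => i _; rewrite coefD coefMX coefC /= addr0 exprS.
by rewrite mulrCA.
Qed.

Lemma wnormC c : N c%:P = nu c.
Proof. by rewrite -[c%:P]add0r -(mul0r 'X) wnorm_MXaddC wnorm0 mulr0 add0r. Qed.

Lemma wnormMX p : N (p * 'X) = rho * N p.
Proof. by have [nu0 _ _ _] := nuP; rewrite -[_ * _]addr0 -polyC0 wnorm_MXaddC nu0 addr0. Qed.

Lemma wnormXM p : N ('X * p) = rho * N p.
Proof. by rewrite mulrC wnormMX. Qed.

Lemma wnormXnM i p : N ('X^i * p) = rho ^+ i * N p.
Proof. by elim: i => [|i IH]; rewrite ?mul1r // !exprS -!mulrA wnormXM IH. Qed.

Lemma wnormCM c p : N (c%:P * p) <= nu c * N p.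
Proof.
have [_ _ _ nuM] := nuP; rewrite (@wnorm_wide (size p)); last first.
  by rewrite mul_polyC size_scale_leq.
rewrite mulr_sumr; apply: ler_sum => i _; rewrite coefCM mulrA.
by rewrite ler_wpM2r ?exprn_ge0.
Qed.

Lemma wnormM p q : N (p * q) <= N p * N q.
Proof.
elim/poly_ind: p => [|p c IH]; first by rewrite mul0r wnorm0 mul0r.
rewrite mulrDl mulrAC wnorm_MXaddC (le_trans (wnormD _ _)) // mulrDl.
by rewrite wnormMX -mulrA lerD ?wnormCM // ler_wpM2l.
Qed.

Lemma wnorm_seminorm : ring_seminorm N.
Proof. by split; [exact: wnorm0 | exact: wnormN | exact: wnormD | exact: wnormM]. Qed.

Lemma wnorm_coef p i : nu p`_i * rho ^+ i <= N p.
Proof.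
have [nu0 _ _ _] := nuP; have [h|h] := leqP (size p) i.
  by rewrite nth_default // nu0 mul0r wnorm_ge0.
rewrite /wnorm (bigD1 (Ordinal h)) //= lerDl sumr_ge0 // => j _.
by rewrite mulr_ge0 ?seminorm_ge0 ?exprn_ge0.
Qed.

Lemma wnorm_horner p y : nu y <= rho -> nu p.[y] <= N p.
Proof.
have [nu0 _ nuD nuM] := nuP; move=> ly; elim/poly_ind: p => [|p c IH].
  by rewrite horner0 nu0 wnorm0.
rewrite hornerMXaddC wnorm_MXaddC (le_trans (nuD _ _)) // lerD2r.
by rewrite (le_trans (nuM _ _)) // mulrC ler_pM ?seminorm_ge0.
Qed.

End Generic.

Lemma wnorm_map (A B : comNzRingType) (nu : A -> R) (mu : B -> R) rho
    (f : {additive A -> B}) (k : R) (p : {poly A}) :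
  ring_seminorm nu -> ring_seminorm mu -> 0 <= rho ->
  (forall x, mu (f x) <= k * nu x) ->
  wnorm mu rho (map_poly f p) <= k * wnorm nu rho p.
Proof.
move=> nuP muP rho0 H; rewrite (@wnorm_wide _ _ _ muP (size p)) ?size_poly //.
rewrite mulr_sumr; apply: ler_sum => i _; rewrite coef_map mulrA.
by rewrite ler_wpM2r ?exprn_ge0.
Qed.

Lemma normr_seminorm : ring_seminorm (fun x : R => `|x|).
Proof.
by split; [exact: normr0 | exact: normrN | exact: ler_normD |
  move=> x y; rewrite normrM].
Qed.

End WeightedNorm.

Section PolyNorms.
Variable R : realFieldType.
Variable X : R.
Hypothesis X0 : 0 <= X.

Definition pnorm (p : {poly R}) := wnorm (fun x : R => `|x|) X p.

Lemma pnorm_seminorm : ring_seminorm pnorm.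
Proof. by apply: wnorm_seminorm X0; exact: normr_seminorm. Qed.

Lemma pnorm_horner p x : `|x| <= X -> `|p.[x]| <= pnorm p.
Proof. by apply: wnorm_horner => //; exact: normr_seminorm. Qed.

Lemma pnormC c : pnorm c%:P = `|c|.
Proof. by apply: wnormC; exact: normr_seminorm. Qed.

Lemma pnorm_prim p : pnorm (prim p) <= X * pnorm p.
Proof.
rewrite /pnorm (@wnorm_wide _ _ _ _ (normr_seminorm R) (size p).+1) ?size_poly //.
rewrite big_ord_recl coef_prim /= invr0 mulr0 normr0 mul0r add0r mulr_sumr.
apply: ler_sum => i _; rewrite coef_prim /= exprS mulrCA ler_wpM2l //.
rewrite ler_wpM2r ?exprn_ge0 // normrM ler_piMr // normfV invf_le1 ?normr_gt0 ?pnatr_eq0 //.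
by rewrite normr_nat ler1n.
Qed.

Variables a b : R.
Hypotheses (aX : `|a| <= X) (bX : `|b| <= X).

Definition prim_from (p : {poly R}) : {poly R} := prim p - (prim p).[a]%:P.

Lemma prim_from_is_zmod_morphism : zmod_morphism prim_from.
Proof.
move=> p q; rewrite /prim_from raddfB hornerD hornerN polyCB; ring.
Qed.

HB.instance Definition _ :=
  GRing.isZmodMorphism.Build {poly R} {poly R} prim_from prim_from_is_zmod_morphism.

Lemma pnorm_prim_from p : pnorm (prim_from p) <= (2 * X) * pnorm p.
Proof.
apply: le_trans (seminormB pnorm_seminorm _ _) _; rewrite pnormC.
have := pnorm_horner (prim p) aX; have := pnorm_prim p; lra.
Qed.

Lemma norm_mom p : `|mom a b p| <= (2 * X) * pnorm p.
Proof.
apply: le_trans (ler_normB _ _) _.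
have := pnorm_horner (prim p) aX; have := pnorm_horner (prim p) bX.
have := pnorm_prim p; lra.
Qed.

Lemma deriv_prim_from p : (prim_from p)^`() = p.
Proof. by rewrite derivB derivC subr0 deriv_prim. Qed.

Lemma prim_from_a p : (prim_from p).[a] = 0.
Proof. by rewrite hornerD hornerN hornerC subrr. Qed.

Lemma prim_from_b p : (prim_from p).[b] = mom a b p.
Proof. by rewrite hornerD hornerN hornerC. Qed.

End PolyNorms.

(** * Small coefficients from many zeros *)

Section ZeroCounting.
Variables (R : realFieldType) (rho : R).
Hypotheses (rho0 : 0 < rho) (rho1 : rho <= 1).
Local Notation N := (pnorm rho).

Let N_seminorm := pnorm_seminorm (ltW rho0).

Lemma pnorm_coef_le (p : {poly R}) i k : (i <= k)%N -> `|p`_i| <= N p * rho ^- k.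
Proof.
move=> ik; have := wnorm_coef (normr_seminorm R) (ltW rho0) p i.
have ri : 0 < rho ^+ i by rewrite exprn_gt0.
rewrite -ler_pdivlMr // => /le_trans; apply.
rewrite ler_wpM2l ?(seminorm_ge0 N_seminorm) // lef_pV2 ?posrE ?exprn_gt0 //.
by rewrite ler_wiXn2l // ltW.
Qed.

(* Divide by [X - y] for each approximate zero [y]: if [H] nearly vanishes at
   [k] points of modulus at most [r], its first [k] coefficients are [O(r)]. *)
Lemma coef_small_of_zeros k : exists2 M : R, 0 <= M & forall ys : seq R,
  uniq ys -> size ys = k -> exists2 A : R, 0 <= A & forall (r : R) (H : {poly R}) (e : R),
    0 <= r -> r <= rho / 2 -> 0 <= e ->
    {in ys, forall y, `|y| <= r} -> {in ys, forall y, `|H.[y]| <= e} ->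
    forall j, (j < k)%N -> `|H`_j| <= M * r * N H + A * e.
Proof.
elim: k => [|k [M M0 IH]]; first by exists 0 => // ys _ _; exists 0.
(* [4 / rho] is the cost of dividing by [X - y1], and [rho^-k] bounds the coefficients of the
   quotient by its norm. *)
exists (4 / rho * (M + rho ^- k)) => [|ys].
  by rewrite mulr_ge0 ?addr_ge0 ?divr_ge0 ?invr_ge0 ?exprn_ge0 // ltW.
case: ys => // y1 ys /= /andP[ny1 uys] [sys].
have [A A0 {}IH] := IH _ uys sys.
(* [A1] records the loss in dividing values by [y - y1]. It depends on [ys], which is why [A] is
   chosen after [ys] but [M] before. *)
pose A1 := \sum_(y <- ys) 2 / `|y - y1|.
have A10 : 0 <= A1 by apply: sumr_ge0 => y _; rewrite divr_ge0.
exists (A * A1 + 1); first by rewrite addr_ge0 // mulr_ge0.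
move=> r H e r0 r2 e0 ysr Hys j jk.
have y1r : `|y1| <= r by apply: ysr; rewrite inE eqxx.
have Hy1 : `|H.[y1]| <= e by apply: Hys; rewrite inE eqxx.
have [G HG] : exists G, H - H.[y1]%:P = G * ('X - y1%:P).
  by apply/factor_theorem; rewrite /root !hornerE subrr.
have N0 p : 0 <= N p by apply: (seminorm_ge0 N_seminorm).
have NG : N G <= 4 / rho * N H.
  (* As [|y1| <= rho / 2], the term [y1 G] is absorbed into the left-hand side. *)
  have e1 : G * 'X = (H - H.[y1]%:P) + y1%:P * G by rewrite HG; ring.
  have h1 : rho * N G <= N H + `|H.[y1]| + `|y1| * N G.
    rewrite -(wnormMX rho (normr_seminorm R)) -/(N _) e1.
    have [_ _ ND NM] := N_seminorm; apply: le_trans (ND _ _) _.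
    apply: lerD; last by apply: le_trans (NM _ _) _; rewrite pnormC.
    by apply: le_trans (seminormB N_seminorm _ _) _; rewrite pnormC.
  have h2 : `|H.[y1]| <= N H.
    by apply: pnorm_horner; apply: le_trans y1r _; lra.
  have h3 : `|y1| * N G <= rho / 2 * N G by rewrite ler_wpM2r // (le_trans y1r).
  by rewrite mulrAC ler_pdivlMr //; lra.
have eps_y y : y \in ys -> 0 < `|y - y1|.
  by move=> yin; rewrite normr_gt0 subr_eq0; apply: contraNneq ny1 => <-.
have HGy y : y \in ys -> `|G.[y]| <= A1 * e.
  move=> yin; have yd := eps_y y yin.
  have e1 : G.[y] * (y - y1) = H.[y] - H.[y1].
    by have := congr1 (horner^~ y) HG; rewrite !hornerE => ->.
  have h1 : `|G.[y]| * `|y - y1| <= 2 * e.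
    rewrite -normrM e1; apply: le_trans (ler_normB _ _) _.
    have : `|H.[y]| <= e by apply: Hys; rewrite inE yin orbT.
    lra.
  rewrite -ler_pdivlMr // in h1; apply: le_trans h1 _; rewrite mulrAC ler_wpM2r //.
  rewrite /A1 (big_rem y) //= lerDl sumr_ge0 // => z _; by rewrite divr_ge0.
have {}IH := IH r G (A1 * e) r0 r2 (mulr_ge0 A10 e0).
have {}IH i : (i < k)%N -> `|G`_i| <= M * r * N G + A * (A1 * e).
  apply: IH => //; by move=> y yin; apply: ysr; rewrite inE yin orbT.
have cG : H = (G * 'X - y1%:P * G) + H.[y1]%:P.
  by rewrite -[LHS](subrK H.[y1]%:P) HG; ring.
have bG : `|y1 * G`_j| <= r * (N G * rho ^- k).
  by rewrite normrM ler_pM // pnorm_coef_le.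
have final : M * r * N G + r * (N G * rho ^- k) <= 4 / rho * (M + rho ^- k) * r * N H.
  have -> : M * r * N G + r * (N G * rho ^- k) = (M + rho ^- k) * r * N G by ring.
  have -> : 4 / rho * (M + rho ^- k) * r * N H = (M + rho ^- k) * r * (4 / rho * N H) by ring.
  by rewrite ler_wpM2l // mulr_ge0 // addr_ge0 // invr_ge0 exprn_ge0 // ltW.
have AA1e : 0 <= A * (A1 * e) by rewrite mulr_ge0 // mulr_ge0.
have MrG : 0 <= M * r * N G by rewrite mulr_ge0 // mulr_ge0.
have := congr1 (fun p : {poly R} => p`_j) cG; rewrite coefD coefB coefMX coefCM coefC => ->.
case: j jk bG => [|j] jk bG /=.
  rewrite sub0r (le_trans (ler_normD _ _)) // normrN. lra.
rewrite addr0 (le_trans (ler_normB _ _)) //; have := IH j jk; lra.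
Qed.

End ZeroCounting.

(** * Picard iteration with the initial value as a parameter *)

Lemma lipschitz_step (R : realFieldType) (K x y x' y' : R) :
  0 <= K -> x' <= 16 * K + 1 / 4 * x + 1 / 16 * y -> y' <= 3 / 2 * x' + 1 / 4 * y ->
  x <= 32 * K -> y <= 80 * K -> x' <= 32 * K /\ y' <= 80 * K.
Proof. by move=> h0 h1 h2 h3 h4; split; lra. Qed.

(** With weight 4 on the second component, one step halves the bound. *)
Lemma contraction_step (R : realFieldType) (K x y x' y' : R) :
  0 <= K -> x' <= 1 / 4 * x + 1 / 16 * y -> y' <= 3 / 2 * x' + 1 / 4 * y ->
  x <= K -> y <= 4 * K -> x' <= 2^-1 * K /\ y' <= 4 * (2^-1 * K).
Proof. by move=> h0 h1 h2 h3 h4; split; lra. Qed.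

Section Picard.
Variables (R : realFieldType) (a b : R) (P : {poly R}).
Implicit Types (q z : {poly R}) (A B : {poly {poly R}}).

(* Power series in the initial value [y0] (the outer variable) with coefficients
   polynomial in [x]: the solution with [y(a) = y0] is [y = y0 B] where, if
   [P(a) = 0], [A = 1 + y0^2 \int_a^x q A^2 B] and [B = A + P y0 A B]. *)
Definition picard_step q (AB : {poly {poly R}} * {poly {poly R}}) :=
  let A := 1 + 'X^2 * map_poly (prim_from a) (q%:P * (AB.1 ^+ 2 * AB.2)) in
  (A, A + 'X * (P%:P * (A * AB.2))).

Definition picard q k := iter k (picard_step q) (1, 1).

(** The [k]-th approximation of [H_q], as a polynomial in [y0]. *)
Definition picard_moment q k : {poly R} :=
  map_poly (mom a b) (q%:P * ((picard q k).1 ^+ 2 * (picard q k).2)).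

Lemma picardS q k : picard q k.+1 = picard_step q (picard q k).
Proof. by []. Qed.

Section Estimates.
Variables (X rho : R).
Hypotheses (X0 : 0 <= X) (aX : `|a| <= X) (bX : `|b| <= X) (rho0 : 0 <= rho).
Hypothesis rhoP : rho * pnorm X P <= 1 / 8.
Local Notation N1 := (pnorm X).
Local Notation N := (wnorm (pnorm X) rho).
Local Notation kap := (rho ^+ 2 * (2 * X)).

Let N1P := pnorm_seminorm X0.
Let NP : ring_seminorm N := wnorm_seminorm N1P rho0.
Let ND F G : N (F + G) <= N F + N G. Proof. by have [] := NP. Qed.
Let NM F G : N (F * G) <= N F * N G. Proof. by have [] := NP. Qed.
Let N0 F : 0 <= N F. Proof. exact: (seminorm_ge0 NP). Qed.
Let N10 q : 0 <= N1 q. Proof. exact: (seminorm_ge0 N1P). Qed.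

Lemma wnorm1 : N 1 = 1.
Proof. by rewrite -polyC1 wnormC // /pnorm -polyC1 wnormC ?normr1 //; apply: normr_seminorm. Qed.

Lemma wnorm_map_prim_from F : N (map_poly (prim_from a) F) <= (2 * X) * N F.
Proof. by apply: wnorm_map => // p; apply: pnorm_prim_from. Qed.

Lemma wnorm_mapX2 F : N ('X^2 * map_poly (prim_from a) F) <= kap * N F.
Proof.
rewrite wnormXnM // -mulrA ler_wpM2l ?exprn_ge0 //.
exact: wnorm_map_prim_from.
Qed.

Lemma wnorm_sqr_mul A B c d : N A <= c -> N B <= d -> N (A ^+ 2 * B) <= c ^+ 2 * d.
Proof.
move=> hA hB; apply: le_trans (NM _ _) _; rewrite ler_pM // expr2.
by apply: le_trans (NM _ _) _; rewrite expr2 ler_pM.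
Qed.

(** [kap] bounds the norm of [F -> y0^2 \int_a^x F]. On the ball of [picard_ball] the integrand has
    norm at most [16 |q|], so the first component stays within [1/4] of [1]. *)
Definition picard_small q := kap * N1 q <= 1 / 64.

Lemma picard_ball q k : picard_small q ->
  N (picard q k).1 <= 2 /\ N (picard q k).2 <= 4.
Proof.
move=> sq; elim: k => [|k [hA hB]]; first by rewrite /= wnorm1; split; lra.
have NA : N (picard q k.+1).1 <= 2.
  rewrite picardS /=; apply: le_trans (ND _ _) _; rewrite wnorm1.
  have : N ('X^2 * map_poly (prim_from a) (q%:P * ((picard q k).1 ^+ 2 * (picard q k).2)))
     <= kap * (N1 q * 16).
    apply: le_trans (wnorm_mapX2 _) _; rewrite ler_wpM2l ?mulr_ge0 ?exprn_ge0 //.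
    apply: le_trans (wnormCM N1P rho0 _ _) _; rewrite ler_wpM2l //.
    by have := wnorm_sqr_mul hA hB; lra.
  by move: sq; rewrite /picard_small mulrA; lra.
split=> //; rewrite picardS /=; move: NA; rewrite picardS /=; set A := 1 + _ => NA.
apply: le_trans (ND _ _) _; rewrite wnormXM //.
have h1 : N (P%:P * (A * (picard q k).2)) <= N1 P * 8.
  apply: le_trans (wnormCM N1P rho0 _ _) _; rewrite ler_wpM2l //.
  apply: le_trans (NM _ _) _; have : N A * N (picard q k).2 <= 2 * 4 by rewrite ler_pM.
  lra.
have : rho * N (P%:P * (A * (picard q k).2)) <= rho * (N1 P * 8) by rewrite ler_wpM2l.
move: rhoP; rewrite mulrA; lra.
Qed.

Lemma wnorm_sqr_mulB A B A' B' : N A <= 2 -> N A' <= 2 -> N B <= 4 -> N B' <= 4 ->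
  N (A ^+ 2 * B - A' ^+ 2 * B') <= 16 * N (A - A') + 4 * N (B - B').
Proof.
move=> hA hA' hB hB'.
have -> : A ^+ 2 * B - A' ^+ 2 * B' = (A - A') * ((A + A') * B) + A' ^+ 2 * (B - B') by ring.
apply: le_trans (ND _ _) _; apply: lerD.
  apply: le_trans (NM _ _) _; rewrite mulrC ler_wpM2r //.
  apply: le_trans (NM _ _) _.
  have : N (A + A') * N B <= 4 * 4.
    by rewrite ler_pM //; apply: le_trans (ND _ _) _; lra.
  lra.
by apply: le_trans (wnorm_sqr_mul hA' (lexx _)) _; lra.
Qed.

Lemma picard_integrandB q z A B A' B' : N A <= 2 -> N A' <= 2 -> N B <= 4 -> N B' <= 4 ->
  N (q%:P * (A ^+ 2 * B) - z%:P * (A' ^+ 2 * B')) <=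
  16 * N1 (q - z) + N1 z * (16 * N (A - A') + 4 * N (B - B')).
Proof.
move=> hA hA' hB hB'.
have -> : q%:P * (A ^+ 2 * B) - z%:P * (A' ^+ 2 * B') =
   (q - z)%:P * (A ^+ 2 * B) + z%:P * (A ^+ 2 * B - A' ^+ 2 * B').
  by rewrite polyCB; ring.
apply: le_trans (ND _ _) _; apply: lerD.
  apply: le_trans (wnormCM N1P rho0 _ _) _; rewrite mulrC ler_wpM2r //.
  by have := wnorm_sqr_mul hA hB; lra.
apply: le_trans (wnormCM N1P rho0 _ _) _; rewrite ler_wpM2l //.
exact: wnorm_sqr_mulB.
Qed.

(** For [q = z] this is a contraction estimate; for iterates of equal index it gives Lipschitz
    dependence on [q]. *)
Lemma picard_stepB q z s t (S := picard_step q s) (T := picard_step z t) :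
  picard_small z -> N s.1 <= 2 -> N t.1 <= 2 -> N s.2 <= 4 -> N t.2 <= 4 ->
  N S.1 <= 2 -> N T.1 <= 2 ->
  N (S.1 - T.1) <= 16 * (kap * N1 (q - z)) + 1 / 4 * N (s.1 - t.1) + 1 / 16 * N (s.2 - t.2) /\
  N (S.2 - T.2) <= 3 / 2 * N (S.1 - T.1) + 1 / 4 * N (s.2 - t.2).
Proof.
rewrite {}/S {}/T; case: s t => [A B] [A' B'] /=.
set S := (picard_step q (A, B)); set T := picard_step z (A', B').
rewrite -/(S.1) -/(T.1) -/(S.2) -/(T.2).
move=> sz hA hA' hB hB' hS hT; split.
  have -> : S.1 - T.1 = 'X^2 * map_poly (prim_from a) (q%:P * (A ^+ 2 * B) - z%:P * (A' ^+ 2 * B')).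
    by rewrite /S /T /= raddfB /=; ring.
  apply: le_trans (wnorm_mapX2 _) _.
  have := picard_integrandB q z hA hA' hB hB'.
  move/(ler_wpM2l (_ : 0 <= kap)); rewrite ?mulr_ge0 ?exprn_ge0 // => /(_ isT).
  move/le_trans; apply; rewrite mulrDr !mulrA.
  have : kap * N1 z * (16 * N (A - A') + 4 * N (B - B')) <= 1 / 64 * (16 * N (A - A') + 4 * N (B - B')).
    by rewrite ler_wpM2r // addr_ge0 // mulr_ge0.
  lra.
have -> : S.2 - T.2 = (S.1 - T.1) + 'X * (P%:P * ((S.1 - T.1) * B + T.1 * (B - B'))).
  by rewrite /S /T /=; ring.
apply: le_trans (ND _ _) _; rewrite wnormXM //.
have h1 : N ((S.1 - T.1) * B + T.1 * (B - B')) <= 4 * N (S.1 - T.1) + 2 * N (B - B').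
  apply: le_trans (ND _ _) _; apply: lerD.
    by apply: le_trans (NM _ _) _; rewrite mulrC ler_wpM2r.
  by apply: le_trans (NM _ _) _; rewrite ler_wpM2r.
have h2 := wnormCM N1P rho0 P ((S.1 - T.1) * B + T.1 * (B - B')).
have h3 := le_trans h2 (ler_wpM2l (N10 P) h1).
have := ler_wpM2l rho0 h3; rewrite mulrA => h4.
have h5 : rho * N1 P * (4 * N (S.1 - T.1) + 2 * N (B - B')) <=
   1 / 8 * (4 * N (S.1 - T.1) + 2 * N (B - B')).
  by rewrite ler_wpM2r // addr_ge0 // mulr_ge0.
lra.
Qed.

Lemma picardB q z k : picard_small q -> picard_small z ->
  N ((picard q k).1 - (picard z k).1) <= 32 * (kap * N1 (q - z)) /\
  N ((picard q k).2 - (picard z k).2) <= 80 * (kap * N1 (q - z)).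
Proof.
move=> sq sz; elim: k => [|k [hA hB]].
  by rewrite /= subrr wnorm0 // !(mulr_ge0, exprn_ge0).
have [bA bB] := picard_ball k sq; have [bA' bB'] := picard_ball k sz.
have [bA1 _] := picard_ball k.+1 sq; have [bA1' _] := picard_ball k.+1 sz.
have [h1 h2] := picard_stepB sz bA bA' bB bB' bA1 bA1'.
have h0 : 0 <= kap * N1 (q - z) by rewrite !mulr_ge0 ?exprn_ge0.
exact: lipschitz_step h0 h1 h2 hA hB.
Qed.

Lemma picard_cauchy q k : picard_small q ->
  N ((picard q k.+1).1 - (picard q k).1) <= (2 ^+ k)^-1 /\
  N ((picard q k.+1).2 - (picard q k).2) <= 4 * (2 ^+ k)^-1.
Proof.
move=> sq; elim: k => [|k [hA hB]].
  rewrite expr0 invr1; have := picard_ball 1 sq; rewrite picardS /=.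
  set A1 := 1 + _ => -[bA bB].
  have h0 : N (A1 - 1) <= 1 / 64.
    rewrite /A1 addrC addKr (le_trans (wnorm_mapX2 _)) // expr1n !mulr1.
    apply: le_trans sq; rewrite ler_wpM2l ?mulr_ge0 ?exprn_ge0 //.
    by rewrite wnormC.
  have h1 : N (A1 + 'X * (P%:P * (A1 * 1)) - 1) <= 1.
    rewrite mulr1 addrAC (le_trans (ND _ _)) // wnormXM //.
    have : N (P%:P * A1) <= N1 P * 2.
      by rewrite (le_trans (wnormCM N1P rho0 _ _)) // ler_wpM2l.
    move/(ler_wpM2l rho0); rewrite mulrA; move: rhoP; lra.
  by split; lra.
have [bA bB] := picard_ball k.+1 sq; have [bA' bB'] := picard_ball k sq.
have [bA1 _] := picard_ball k.+2 sq.
have [h1 h2] := picard_stepB sq bA bA' bB bB' bA1 bA; move: h1 h2 hA hB.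
have -> : N1 (q - q) = 0 by rewrite subrr; case: N1P.
rewrite !mulr0 add0r exprS invfM => h1 h2 hA hB.
by apply: contraction_step h1 h2 hA hB; rewrite invr_ge0 exprn_ge0.
Qed.


Lemma picard0 k : (picard 0 k).1 = 1.
Proof. by case: k => // k; rewrite picardS /= mul0r raddf0 mulr0 addr0. Qed.

(** For [q = 0] the second component agrees, up to order [k], with the geometric series of
    [1 / (1 - y0 P)]. This is where the moments enter. *)
Lemma picard0_coef k j : (j <= k)%N -> ((picard 0 k).2)`_j = P ^+ j.
Proof.
elim: k j => [|k IH] j; first by rewrite leqn0 => /eqP ->; rewrite /= coef1 expr0.
have -> : (picard 0 k.+1).2 = 1 + 'X * (P%:P * (picard 0 k).2).
  by rewrite -{1}(picard0 k.+1) picardS /= mul0r raddf0 mulr0 addr0 mul1r.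
rewrite coefD coef1 coefXM; case: j => [|j] lj; first by rewrite expr0 addr0.
by rewrite coefCM IH // exprS add0r.
Qed.

Lemma picard_small0 : picard_small 0.
Proof. by rewrite /picard_small; have [-> _ _ _] := N1P; rewrite mulr0; lra. Qed.

Lemma wnorm_map_mom F : pnorm rho (map_poly (mom a b) F) <= 2 * X * N F.
Proof.
apply: wnorm_map => //; first exact: normr_seminorm.
by move=> p; apply: norm_mom.
Qed.

(** [832 = 16 * 32 + 4 * 80]: the weights of [wnorm_sqr_mulB] times the constants of [picardB]. *)
Lemma picard_integrand_lip q z k : picard_small q -> picard_small z ->
  16 * N ((picard q k).1 - (picard z k).1) + 4 * N ((picard q k).2 - (picard z k).2)
  <= 832 * (kap * N1 (q - z)).
Proof.
move=> sq sz; have [] := picardB k sq sz.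
by move: (N _) (N _) (kap * _) => x y K; lra.
Qed.

(** [29 = 16 + 832 / 64], by the smallness of [z]. *)
Lemma picard_momentB q z k : picard_small q -> picard_small z ->
  pnorm rho (picard_moment q k - picard_moment z k) <= 2 * X * (29 * N1 (q - z)).
Proof.
move=> sq sz; rewrite /picard_moment -raddfB /=.
apply: le_trans (wnorm_map_mom _) _; rewrite ler_wpM2l ?mulr_ge0 //.
have [bA bB] := picard_ball k sq; have [bA' bB'] := picard_ball k sz.
apply: le_trans (picard_integrandB q z bA bA' bB bB') _.
have h1 := ler_wpM2l (N10 z) (picard_integrand_lip k sq sz).
have h2 : kap * N1 z * (832 * N1 (q - z)) <= 1 / 64 * (832 * N1 (q - z)).
  by apply: ler_wpM2r sz; exact: mulr_ge0 (ler0n R 832) (N10 _).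
have h3 : N1 z * (832 * (kap * N1 (q - z))) = kap * N1 z * (832 * N1 (q - z)) by ring.
rewrite h3 in h1; apply: le_trans (lerD (lexx _) (le_trans h1 h2)) _.
by rewrite le_eqVlt; apply/orP; left; apply/eqP; field.
Qed.

(** The integrands are compared with the one for [q = 0], so the linear term consists of moments and
    the error gains the small factor [|q| + |z|]. *)
Lemma picard_moment_linear q z k : picard_small q -> picard_small z ->
  pnorm rho (picard_moment q k - picard_moment z k -
             map_poly (mom a b) ((q - z)%:P * (picard 0 k).2))
  <= 2 * X * (832 * kap) * (N1 (q - z) * (N1 q + N1 z)).
Proof.
move=> sq sz; rewrite /picard_moment -!raddfB /=.
apply: le_trans (wnorm_map_mom _) _; rewrite -[X in _ <= X]mulrA ler_wpM2l ?mulr_ge0 //.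
have [bA bB] := picard_ball k sq; have [bA' bB'] := picard_ball k sz.
have [bA0 bB0] := picard_ball k picard_small0.
have ident A B A' B' B0 : q%:P * (A ^+ 2 * B) - z%:P * (A' ^+ 2 * B') - (q - z)%:P * B0 =
  (q - z)%:P * (A ^+ 2 * B - 1 ^+ 2 * B0) + z%:P * (A ^+ 2 * B - A' ^+ 2 * B').
  by rewrite polyCB; ring.
rewrite ident -{1}(picard0 k).
apply: le_trans (ND _ _) _.
have h1 := le_trans (wnorm_sqr_mulB bA bA0 bB bB0) (picard_integrand_lip k sq picard_small0).
have h2 := le_trans (wnorm_sqr_mulB bA bA' bB bB') (picard_integrand_lip k sq sz).
rewrite subr0 in h1.
have h3 := le_trans (wnormCM N1P rho0 (q - z) _) (ler_wpM2l (N10 _) h1).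
have h4 := le_trans (wnormCM N1P rho0 z _) (ler_wpM2l (N10 _) h2).
apply: le_trans (lerD h3 h4) _.
by rewrite le_eqVlt; apply/orP; left; apply/eqP; ring.
Qed.

End Estimates.

Lemma coef_picard_moment0 w k j : (j <= k)%N ->
  (map_poly (mom a b) (w%:P * (picard 0 k).2))`_j = mom a b (P ^+ j * w).
Proof. by move=> jk; rewrite coef_map coefCM picard0_coef // mulrC. Qed.

(* If [P] and a primitive of [z] are polynomials in [W] with [W(a) = W(b)], so are
   all the iterates, and every small solution is periodic. *)
Lemma picard_moment_comp (W P1 Z1 : {poly R}) k : W.[a] = W.[b] -> P = P1 \Po W ->
  picard_moment (Z1 \Po W)^`() k = 0.
Proof.
move=> Wab eP; pose phi := map_poly (comp_poly W); set z := (_)^`().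
(* Each integrand [z g(W)] is the derivative of a polynomial in [W], so integration from [a] in [x]
   becomes integration from [W(a)] in [W]. *)
have zg g : z * (g \Po W) = (prim (Z1^`() * g) \Po W)^`().
  by rewrite deriv_comp deriv_prim /z deriv_comp comp_polyM; ring.
have primE g : prim_from a (z * (g \Po W)) = (prim_from W.[a] (Z1^`() * g)) \Po W.
  rewrite zg /prim_from comp_polyB comp_polyC.
  have e := @mom_deriv R; set F := _ \Po W.
  have /deriv_eq0 e1 : (prim F^`() - F)^`() = 0 by rewrite derivB deriv_prim subrr.
  have -> : prim F^`() = F + ((prim F^`() - F)`_0)%:P by rewrite -e1 addrC subrK.
  rewrite hornerD hornerC polyCD opprD addrACA subrr addr0.
  by rewrite /F horner_comp.
have mapE G : map_poly (prim_from a) (z%:P * phi G) = phi (map_poly (prim_from W.[a]) (Z1^`()%:P * G)).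
  by apply/polyP => i; rewrite !(coef_map, coefCM) /= primE.
have momE G : map_poly (mom a b) (z%:P * phi G) = 0.
  apply/polyP => i; rewrite !(coef_map, coefCM) /= zg mom_deriv !horner_comp Wab.
  by rewrite subrr coef0.
have [A [B [eA eB]]] : exists A B, (picard z k).1 = phi A /\ (picard z k).2 = phi B.
  elim: k => [|k [A [B [eA eB]]]]; first by exists 1, 1; split; rewrite /phi; exact/esym/rmorph1.
  rewrite picardS /= eA eB -!rmorphXn -!rmorphM /= mapE.
  pose A1 := 1 + 'X^2 * map_poly (prim_from W.[a]) (Z1^`()%:P * (A ^+ 2 * B)).
  have eA1 : 1 + 'X^2 * phi (map_poly (prim_from W.[a]) (Z1^`()%:P * (A ^+ 2 * B))) = phi A1.
    by rewrite /A1 /phi rmorphD rmorphM /= rmorph1 map_polyXn.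
  exists A1, (A1 + 'X * (P1%:P * (A1 * B))); rewrite eA1; split=> //.
  by rewrite /phi [RHS]rmorphD !rmorphM /= map_polyX map_polyC /= -eP.
by rewrite /picard_moment eA eB -rmorphXn -rmorphM momE.
Qed.

End Picard.

(** * Limits at a geometric rate *)

Section GeometricLimit.
Variable R : realType.

Lemma geometric_small (x C : R) : (forall k, `|x| <= C * (2 ^+ k)^-1) -> x = 0.
Proof.
move=> H; apply/eqP; rewrite -normr_le0 leNgt; apply/negP => x0.
have C0 : 0 < C by have := H 0%N; rewrite expr0 invr1 mulr1; apply: lt_le_trans.
have := H (Num.truncn (C / `|x|)).+1; apply/negP; rewrite -ltNge ltr_pdivrMr ?exprn_gt0 //.
rewrite mulrC -ltr_pdivrMr //; apply: lt_trans (truncnS_gt _) _.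
by rewrite -natrX ltr_nat ltn_expl.
Qed.

Lemma geometric_le (x c C : R) : (forall k, x <= c + C * (2 ^+ k)^-1) -> x <= c.
Proof.
move=> H; rewrite leNgt; apply/negP => cx.
suff : x - c = 0 by lra.
apply: (@geometric_small _ C) => k; rewrite ger0_norm; first by have := H k; lra.
lra.
Qed.

(** Nested intervals: with [e_k = C / 2^k], those of centre [u_k] and radius [2 e_k] decrease, and
    the limit is the supremum of the left ends. *)
Lemma geometric_cauchy (u : nat -> R) (C : R) : 0 <= C ->
  (forall k, `|u k.+1 - u k| <= C * (2 ^+ k)^-1) ->
  exists l, forall k, `|l - u k| <= 2 * C * (2 ^+ k)^-1.
Proof.
move=> C0 H; pose e k : R := C * (2 ^+ k)^-1.
have eS k : e k = 2 * e k.+1 by rewrite /e exprS invfM; lra.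
have step k : u k - 2 * e k <= u k.+1 - 2 * e k.+1 /\ u k.+1 + 2 * e k.+1 <= u k + 2 * e k.
  by have := H k; rewrite -/(e k) ler_norml => /andP[]; rewrite eS => h1 h2; split; lra.
have mono k m : u k - 2 * e k <= u (m + k)%N - 2 * e (m + k)%N /\
    u (m + k)%N + 2 * e (m + k)%N <= u k + 2 * e k.
  elim: m => [|m [h1 h2]] //; rewrite addSn; have [h3 h4] := step (m + k)%N.
  by split; [exact: le_trans h3 | exact: le_trans h2].
have e0 k : 0 <= e k by rewrite mulr_ge0 // invr_ge0 exprn_ge0.
have cross k m : u m - 2 * e m <= u k + 2 * e k.
  have [h1 _] := mono m k; have [_ h2] := mono k m; rewrite addnC in h2.
  by have := e0 (k + m)%N; lra.
pose S := [set x | exists m, x = u m - 2 * e m]%classic.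
have S0 : has_sup S.
  split; first by exists (u 0%N - 2 * e 0%N), 0%N.
  by exists (u 0%N + 2 * e 0%N) => x [m ->].
exists (sup S) => k; rewrite -mulrA -/(e k) ler_norml; apply/andP; split.
  have : u k - 2 * e k <= sup S by apply: sup_upper_bound => //; exists k.
  lra.
have : sup S <= u k + 2 * e k by apply: ge_sup; [case: S0 | move=> x [m ->]].
lra.
Qed.

End GeometricLimit.

(** * First-order expansions with quadratic remainder *)

Section SecondOrder.
Variables (R : realType) (X : R).
Implicit Types (f g : R -> R).

Definition lipschitz_on f := exists2 K : R, 0 <= K & forall x t, `|x| <= X -> `|t| <= X ->
  `|f x| <= K /\ `|f t - f x| <= K * `|t - x|.

(** A uniform, quantitative form of differentiability on [[-X, X]] with Lipschitz derivative. It is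
    stable under sums, products and inverses of functions bounded below, and is obtained for limits
    from plain inequalities. *)
Definition second_order f f' := [/\ lipschitz_on f, lipschitz_on f' &
  exists2 K : R, 0 <= K & forall x t, `|x| <= X -> `|t| <= X ->
  `|f t - f x - (t - x) * f' x| <= K * `|t - x| ^+ 2].

Lemma lipschitz_onD f g : lipschitz_on f -> lipschitz_on g ->
  lipschitz_on (fun x => f x + g x).
Proof.
move=> [K K0 Hf] [L L0 Hg]; exists (K + L); first exact: addr_ge0.
move=> x t hx ht; have [f1 f2] := Hf x t hx ht; have [g1 g2] := Hg x t hx ht; split.
  by rewrite (le_trans (ler_normD _ _)) // lerD.
have -> : f t + g t - (f x + g x) = (f t - f x) + (g t - g x) by ring.
by rewrite (le_trans (ler_normD _ _)) // mulrDl lerD.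
Qed.

Lemma lipschitz_onM f g : lipschitz_on f -> lipschitz_on g ->
  lipschitz_on (fun x => f x * g x).
Proof.
move=> [K K0 Hf] [L L0 Hg]; exists (2 * (K * L)); first by rewrite !mulr_ge0.
move=> x t hx ht; have [f1 f2] := Hf x t hx ht; have [g1 g2] := Hg x t hx ht.
have [g3 _] := Hg t x ht hx; have KL0 : 0 <= K * L by rewrite mulr_ge0.
split.
  by rewrite normrM (le_trans (ler_pM _ _ f1 g1)) //; lra.
have -> : f t * g t - f x * g x = (f t - f x) * g t + f x * (g t - g x) by ring.
rewrite (le_trans (ler_normD _ _)) // !normrM.
have h1 : `|f t - f x| * `|g t| <= K * `|t - x| * L by rewrite ler_pM.
have h2 : `|f x| * `|g t - g x| <= K * (L * `|t - x|) by rewrite ler_pM.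
lra.
Qed.

Lemma lipschitz_onC c : lipschitz_on (fun=> c).
Proof. by exists `|c| => // x t _ _; rewrite subrr normr0; split=> //; rewrite mulr_ge0. Qed.

Lemma lipschitz_on_horner (p : {poly R}) : lipschitz_on (horner p).
Proof.
have LX : lipschitz_on id.
  exists (`|X| + 1) => [|x t hx ht]; first by rewrite addr_ge0.
  have := ler_norm X; split; first lra.
  by rewrite ler_peMl // lerDr.
elim/poly_ind: p => [|p c IH].
  have -> : horner (0 : {poly R}) = fun=> 0 by apply/funext => x; rewrite horner0.
  exact: lipschitz_onC.
have -> : horner (p * 'X + c%:P) = fun x => p.[x] * x + c.
  by apply/funext => x; rewrite hornerMXaddC.
by apply: lipschitz_onD (lipschitz_onC c); apply: lipschitz_onM.
Qed.

Lemma lipschitz_onV f : (forall x, `|x| <= X -> 1 / 2 <= f x) -> lipschitz_on f ->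
  lipschitz_on (fun x => (f x)^-1).
Proof.
move=> fpos [K K0 Hf]; exists (4 * K + 2); first by lra.
move=> x t hx ht; have [f1 f2] := Hf x t hx ht.
have px := fpos x hx; have pt := fpos t ht.
have fx0 : 0 < f x by lra. have ft0 : 0 < f t by lra.
have ix : (f x)^-1 <= 2 by rewrite invf_ple ?posrE //; lra.
have it : (f t)^-1 <= 2 by rewrite invf_ple ?posrE //; lra.
have ix0 : 0 < (f x)^-1 by rewrite invr_gt0.
split; first by rewrite gtr0_norm //; apply: le_trans ix _; clear -K0; lra.
have -> : (f t)^-1 - (f x)^-1 = - ((f t - f x) * ((f t)^-1 * (f x)^-1)).
  by field; rewrite !gt_eqF.
have v0 : 0 <= (f t)^-1 * (f x)^-1 by rewrite mulr_ge0 // ltW // invr_gt0.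
rewrite normrN normrM (ger0_norm v0).
have h1 : (f t)^-1 * (f x)^-1 <= 2 * 2 by apply: ler_pM => //; rewrite ltW // invr_gt0.
have h2 : `|f t - f x| * ((f t)^-1 * (f x)^-1) <= K * `|t - x| * (2 * 2).
  by apply: ler_pM => //; rewrite mulr_ge0 // ltW // invr_gt0.
apply: le_trans h2 _; move: `|t - x| (normr_ge0 (t - x)) => d d0; lra.
Qed.

Lemma second_orderM f f' g g' : second_order f f' -> second_order g g' ->
  second_order (fun x => f x * g x) (fun x => f' x * g x + f x * g' x).
Proof.
move=> [Lf Lf' [K K0 Hf]] [Lg Lg' [L L0 Hg]]; split.
- exact: lipschitz_onM.
- by apply: lipschitz_onD; apply: lipschitz_onM.
have [M M0 Bf] := Lf; have [M' M'0 Bg] := Lg.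
exists (K * M' + M * L + M * M'); first by rewrite !addr_ge0 // mulr_ge0.
move=> x t hx ht; have {}Hf := Hf x t hx ht; have {}Hg := Hg x t hx ht.
have [f1 f2] := Bf x t hx ht; have [g1 g2] := Bg x t hx ht.
have -> : f t * g t - f x * g x - (t - x) * (f' x * g x + f x * g' x) =
  (f t - f x - (t - x) * f' x) * g x + f x * (g t - g x - (t - x) * g' x)
  + (f t - f x) * (g t - g x) by ring.
rewrite (le_trans (ler_normD _ _)) // [X in _ <= X]mulrDl [X in _ <= X + _]mulrDl; apply: lerD.
  rewrite (le_trans (ler_normD _ _)) // !normrM; apply: lerD.
    by rewrite mulrAC ler_pM.
  by rewrite -mulrA ler_pM.
rewrite normrM; have -> : M * M' * `|t - x| ^+ 2 = (M * `|t - x|) * (M' * `|t - x|) by ring.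
by rewrite ler_pM.
Qed.

Lemma second_orderD f f' g g' : second_order f f' -> second_order g g' ->
  second_order (fun x => f x + g x) (fun x => f' x + g' x).
Proof.
move=> [Lf Lf' [K K0 Hf]] [Lg Lg' [L L0 Hg]]; split; try exact: lipschitz_onD.
exists (K + L); first exact: addr_ge0.
move=> x t hx ht; have {}Hf := Hf x t hx ht; have {}Hg := Hg x t hx ht.
have -> : f t + g t - (f x + g x) - (t - x) * (f' x + g' x) =
  (f t - f x - (t - x) * f' x) + (g t - g x - (t - x) * g' x) by ring.
by rewrite (le_trans (ler_normD _ _)) // [X in _ <= X]mulrDl lerD.
Qed.

Lemma second_orderC c : second_order (fun=> c) (fun=> 0).
Proof.
split; try exact: lipschitz_onC; exists 0 => // x t _ _.
by rewrite subrr mulr0 subrr normr0 mul0r.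
Qed.

Lemma second_order_horner (p : {poly R}) : second_order (horner p) (horner p^`()).
Proof.
have DX : second_order id (fun=> 1).
  split; [|exact: lipschitz_onC|].
    have -> : id = horner ('X : {poly R}) by apply/funext => x; rewrite hornerX.
    exact: lipschitz_on_horner.
  by exists 0 => // x t _ _; rewrite mulr1 subrr normr0 mul0r.
elim/poly_ind: p => [|p c IH].
  have -> : horner (0 : {poly R}) = fun=> 0 by apply/funext => x; rewrite horner0.
  have -> : horner (0^`() : {poly R}) = fun=> 0 by apply/funext => x; rewrite deriv0 horner0.
  exact: second_orderC.
have -> : horner (p * 'X + c%:P) = fun x => p.[x] * x + c.
  by apply/funext => x; rewrite hornerMXaddC.
have -> : horner (p * 'X + c%:P)^`() = fun x => p^`().[x] * x + p.[x] * 1 + 0.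
  by apply/funext => x; rewrite derivMXaddC !hornerE; ring.
by apply: second_orderD (second_orderC c); apply: second_orderM.
Qed.

Lemma eq_second_order f f' g g' : (forall x, `|x| <= X -> f x = g x) ->
  (forall x, `|x| <= X -> f' x = g' x) -> second_order f f' -> second_order g g'.
Proof.
move=> fg fg' [[K1 K10 H1] [K2 K20 H2] [K3 K30 H3]]; split.
- by exists K1 => // x t hx ht; rewrite -!fg //; apply: H1.
- by exists K2 => // x t hx ht; rewrite -!fg' //; apply: H2.
- by exists K3 => // x t hx ht; rewrite -!fg // -!fg' //; apply: H3.
Qed.

Lemma second_orderV f f' : (forall x, `|x| <= X -> 1 / 2 <= f x) -> second_order f f' ->
  second_order (fun x => (f x)^-1) (fun x => - f' x * ((f x)^-1 * (f x)^-1)).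
Proof.
move=> fpos [Lf Lf' [K K0 Hf]]; have LV := lipschitz_onV fpos Lf; split=> //.
  apply: lipschitz_onM; last exact: lipschitz_onM.
  have -> : (fun x => - f' x) = fun x => -1 * f' x by apply/funext => x; rewrite mulN1r.
  exact: lipschitz_onM (lipschitz_onC _) Lf'.
have [M M0 Bf] := Lf; have [M' M'0 Bf'] := Lf'; have [L L0 BV] := LV.
exists (K * L ^+ 2 + M' * M * L ^+ 3); first by rewrite addr_ge0 // !mulr_ge0 // exprn_ge0.
move=> x t hx ht; have {}Hf := Hf x t hx ht.
have [_ f2] := Bf x t hx ht; have [f'1 _] := Bf' x t hx ht.
have [v1 _] := BV x t hx ht; have [v2 _] := BV t x ht hx.
have px := fpos x hx; have pt := fpos t ht.
have fx0 : f x != 0 by rewrite gt_eqF //; lra.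
have ft0 : f t != 0 by rewrite gt_eqF //; lra.
have -> : (f t)^-1 - (f x)^-1 - (t - x) * (- f' x * ((f x)^-1 * (f x)^-1)) =
  - ((f t - f x - (t - x) * f' x) * ((f t)^-1 * (f x)^-1))
  + f' x * (f t - f x) * (t - x) * ((f t)^-1 * (f x)^-1 * (f x)^-1).
  by field; rewrite fx0 ft0.
rewrite (le_trans (ler_normD _ _)) // normrN !normrM [X in _ <= X]mulrDl; apply: lerD.
  have -> : K * L ^+ 2 * `|t - x| ^+ 2 = K * `|t - x| ^+ 2 * (L * L) by ring.
  by rewrite ler_pM ?mulr_ge0 // ler_pM.
have -> : M' * M * L ^+ 3 * `|t - x| ^+ 2 = M' * (M * `|t - x|) * `|t - x| * (L * L * L) by ring.
rewrite ler_pM ?mulr_ge0 //; last by rewrite ler_pM ?mulr_ge0 // ler_pM.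
by rewrite ler_wpM2r // ler_pM.
Qed.

End SecondOrder.

(** * The solution as a limit of Picard iterates *)

Lemma horner_map_prim_from (R : realFieldType) (a y : R) (F : {poly {poly R}}) :
  (map_poly (prim_from a) F).[y%:P] = prim_from a F.[y%:P].
Proof.
have lin c p : prim_from a (c *: p) = c *: prim_from a p.
  by rewrite /prim_from linearZ /= hornerZ polyCM scalerBr mul_polyC.
rewrite (@horner_coef_wide _ (size F)) ?size_poly // horner_coef raddf_sum.
apply: eq_bigr => i _ /=; rewrite coef_map -polyC_exp mulrC mul_polyC.
by rewrite [F`_i * _]mulrC mul_polyC lin.
Qed.

Lemma horner_map_mom (R : realFieldType) (a b y : R) (F : {poly {poly R}}) :
  (map_poly (mom a b) F).[y] = mom a b F.[y%:P].
Proof.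
rewrite (@horner_coef_wide _ (size F)) ?size_poly // horner_coef raddf_sum.
apply: eq_bigr => i _ /=; rewrite coef_map -polyC_exp mulrC.
by rewrite [F`_i * _]mulrC mul_polyC linearZ.
Qed.

Lemma poly_mean_value (R : rcfType) (p : {poly R}) (X x t : R) : `|x| <= X -> `|t| <= X ->
  exists xi, [/\ `|xi| <= X, `|xi - x| <= `|t - x| & p.[t] - p.[x] = (t - x) * p^`().[xi]].
Proof.
move=> hx ht; have [lt_xt|lt_tx|<-] := ltgtP x t; last first.
- by exists x; rewrite !subrr mul0r.
- have [c] := poly_mvt p lt_tx; rewrite in_itv /= => /andP[h1 h2] e; exists c.
  move: hx ht; rewrite !ler_norml => /andP[a1 a2] /andP[a3 a4]; split.
  + by apply/andP; split; lra.
  + by rewrite !ler0_norm; lra.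
  + by rewrite -opprB e; ring.
have [c] := poly_mvt p lt_xt; rewrite in_itv /= => /andP[h1 h2] e; exists c.
move: hx ht; rewrite !ler_norml => /andP[a1 a2] /andP[a3 a4]; split.
+ by apply/andP; split; lra.
+ by rewrite !ger0_norm; lra.
+ by rewrite e; ring.
Qed.

Section SeriesSolution.
Variables (R : realType) (a b X rho y0 : R) (P q : {poly R}).
Hypotheses (X0 : 0 <= X) (aX : `|a| <= X) (bX : `|b| <= X) (rho0 : 0 <= rho).
Hypotheses (rhoP : rho * pnorm X P <= 1 / 8) (sq : picard_small X rho q) (y0r : `|y0| <= rho).

Let al k : {poly R} := (picard a P q k).1.[y0%:P].
Let be k : {poly R} := (picard a P q k).2.[y0%:P].

Let eval2 F x : `|x| <= X -> `|(F : {poly {poly R}}).[y0%:P].[x]| <= wnorm (pnorm X) rho F.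
Proof.
move=> hx; apply: le_trans (pnorm_horner _ hx) _.
by apply: (wnorm_horner (pnorm_seminorm X0)); rewrite pnormC.
Qed.

Let al_bound k x : `|x| <= X -> `|(al k).[x]| <= 2.
Proof.
move=> hx; apply: le_trans (eval2 _ hx) _.
by have [] := picard_ball X0 aX rho0 rhoP k sq.
Qed.

Let be_bound k x : `|x| <= X -> `|(be k).[x]| <= 4.
Proof.
move=> hx; apply: le_trans (eval2 _ hx) _.
by have [] := picard_ball X0 aX rho0 rhoP k sq.
Qed.

Let alS k : al k.+1 = 1 + (y0 ^+ 2)%:P * prim_from a (q * (al k ^+ 2 * be k)).
Proof.
rewrite /al picardS /= hornerD hornerM horner_map_prim_from !hornerE.
by rewrite -polyC_exp.
Qed.

Let beS k : be k.+1 = al k.+1 + y0%:P * (P * (al k.+1 * be k)).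
Proof. by rewrite {1}/be picardS /= /al picardS /= !hornerE. Qed.

Let deriv_al k : (al k.+1)^`() = (y0 ^+ 2)%:P * (q * (al k ^+ 2 * be k)).
Proof. by rewrite alS derivD -polyC1 derivC add0r derivM derivC mul0r add0r deriv_prim_from. Qed.

Let al_cauchy k x : `|x| <= X -> `|(al k.+1).[x] - (al k).[x]| <= 1 * (2 ^+ k)^-1.
Proof.
move=> hx; rewrite -hornerN -hornerD -hornerN -hornerD; apply: le_trans (eval2 _ hx) _.
by rewrite mul1r; have [] := picard_cauchy X0 aX rho0 rhoP k sq.
Qed.

Let be_cauchy k x : `|x| <= X -> `|(be k.+1).[x] - (be k).[x]| <= 4 * (2 ^+ k)^-1.
Proof.
move=> hx; rewrite -hornerN -hornerD -hornerN -hornerD; apply: le_trans (eval2 _ hx) _.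
by have [] := picard_cauchy X0 aX rho0 rhoP k sq.
Qed.

Lemma picard_limits : exists alpha beta : R -> R, forall x, `|x| <= X -> forall k,
  `|alpha x - (al k).[x]| <= 2 * (2 ^+ k)^-1 /\ `|beta x - (be k).[x]| <= 8 * (2 ^+ k)^-1.
Proof.
have /choice[alpha Ha] : forall x, exists l, `|x| <= X -> forall k, `|l - (al k).[x]| <= 2 * (2 ^+ k)^-1.
  move=> x; have [hx|hx] := EM (`|x| <= X); last by exists 0.
  have [l Hl] := geometric_cauchy ler01 (fun k => al_cauchy k hx); exists l => _ k.
  by have := Hl k; rewrite mulr1.
have /choice[beta Hb] : forall x, exists l, `|x| <= X -> forall k, `|l - (be k).[x]| <= 8 * (2 ^+ k)^-1.
  move=> x; have [hx|hx] := EM (`|x| <= X); last by exists 0.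
  have [l Hl] := geometric_cauchy (ler0n R 4) (fun k => be_cauchy k hx); exists l => _ k.
  by have := Hl k; rewrite (_ : 2 * 4%:R = 8) //; ring.
by exists alpha, beta => x hx k; split; [exact: Ha | exact: Hb].
Qed.


(** Eliminating [B] from [B = A + y0 P A B] gives [y = y0 A / (1 - y0 P A)]. The relation at [b] is
    left undivided, ready for comparing [y(b)] with [y0]. *)
Lemma series_solution : P.[a] = 0 -> exists y : R -> R, [/\ y a = y0,
  second_order X y (fun x => P^`().[x] * y x ^+ 2 + q.[x] * y x ^+ 3) &
  exists2 alpha_b, y b * (1 - y0 * P.[b] * alpha_b) = y0 * alpha_b &
    forall k, `|alpha_b - (1 + y0 ^+ 2 * (picard_moment a b P q k).[y0])| <= 2 * (2 ^+ k)^-1].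
Proof.
move=> Pa0; have [alpha [beta Hab]] := picard_limits.
have Ha k x : `|x| <= X -> `|alpha x - (al k).[x]| <= 2 * (2 ^+ k)^-1 by move=> /Hab/(_ k)[].
have Hb k x : `|x| <= X -> `|beta x - (be k).[x]| <= 8 * (2 ^+ k)^-1 by move=> /Hab/(_ k)[].
have e0 k : 0 < (2 ^+ k : R)^-1 by rewrite invr_gt0 exprn_gt0.
have eS k : (2 ^+ k.+1 : R)^-1 <= (2 ^+ k)^-1 by have := e0 k; rewrite exprS invfM; lra.
have alpha4 x : `|x| <= X -> `|alpha x| <= 4.
  move=> hx; have := Ha 0%N x hx; have := al_bound 0 hx; rewrite expr0 invr1 => h1 h2.
  rewrite -(subrK (al 0).[x] (alpha x)) (le_trans (ler_normD _ _)) //; lra.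
have beta12 x : `|x| <= X -> `|beta x| <= 12.
  move=> hx; have := Hb 0%N x hx; have := be_bound 0 hx; rewrite expr0 invr1 => h1 h2.
  rewrite -(subrK (be 0).[x] (beta x)) (le_trans (ler_normD _ _)) //; lra.
have yP x : `|x| <= X -> `|y0 * P.[x]| <= 1 / 8.
  by move=> hx; apply: le_trans rhoP; rewrite normrM ler_pM // pnorm_horner.
pose u x := y0 * P.[x] * alpha x.
have v12 x : `|x| <= X -> 1 / 2 <= 1 - u x.
  move=> hx; have : `|u x| <= 1 / 8 * 4 by rewrite normrM ler_pM ?yP ?alpha4.
  by rewrite ler_norml => /andP[]; lra.
have beta_eq x : `|x| <= X -> beta x = alpha x * (1 - u x)^-1.
  move=> hx; have v0 : 1 - u x != 0 by rewrite gt_eqF //; have := v12 x hx; lra.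
  apply: (mulIf v0); rewrite mulfVK //; apply/eqP; rewrite -subr_eq0; apply/eqP.
  (* The constant adds [8 + 2] for the two limits and [(24 + 16) / 8] for the product term. *)
  apply: (@geometric_small _ _ 15) => k.
  have -> : beta x * (1 - u x) - alpha x = (beta x - (be k.+1).[x]) - (alpha x - (al k.+1).[x])
     - y0 * P.[x] * ((alpha x - (al k.+1).[x]) * beta x + (al k.+1).[x] * (beta x - (be k).[x])).
    by rewrite beS hornerD !hornerM hornerC /u; ring.
  have h1 := Hb k.+1 x hx; have h2 := Ha k.+1 x hx; have h3 := Hb k x hx.
  have h4 := eS k; have h5 := beta12 x hx; have h6 := al_bound k.+1 hx.
  set E := _^-1 in h3 h4 *; set E1 := _^-1 in h1 h2 h4.
  have h7 : `|(alpha x - (al k.+1).[x]) * beta x + (al k.+1).[x] * (beta x - (be k).[x])| <= 2 * E1 * 12 + 2 * (8 * E).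
    by rewrite (le_trans (ler_normD _ _)) // !normrM lerD // ler_pM.
  have h8 : `|y0 * P.[x] * ((alpha x - (al k.+1).[x]) * beta x + (al k.+1).[x] * (beta x - (be k).[x]))|
     <= 1 / 8 * (2 * E1 * 12 + 2 * (8 * E)).
    by rewrite normrM ler_pM ?yP.
  rewrite (le_trans (ler_normB _ _)) //.
  have h9 : `|beta x - (be k.+1).[x] - (alpha x - (al k.+1).[x])| <= 8 * E1 + 2 * E1.
    by rewrite (le_trans (ler_normB _ _)) // lerD.
  lra.
pose K1 := rho ^+ 2 * pnorm X q.
have K10 : 0 <= K1 by rewrite mulr_ge0 ?exprn_ge0 // (seminorm_ge0 (pnorm_seminorm X0)).
have yq x : `|x| <= X -> `|y0 ^+ 2 * q.[x]| <= K1.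
  move=> hx; rewrite normrM normrX ler_pM ?exprn_ge0 ?pnorm_horner //.
  by rewrite lerXn2r // nnegrE.
(* Mean value theorem for an iterate, whose derivative is the integrand built from the preceding
   iterate. *)
have diff k x t : `|x| <= X -> `|t| <= X -> exists xi, [/\ `|xi| <= X, `|xi - x| <= `|t - x|
    & (al k.+1).[t] - (al k.+1).[x] = (t - x) * (y0 ^+ 2 * q.[xi] * ((al k).[xi] ^+ 2 * (be k).[xi]))].
  move=> hx ht; have [xi [h1 h2 h3]] := poly_mean_value (al k.+1) hx ht.
  by exists xi; split=> //; rewrite h3 deriv_al !hornerM hornerC; ring.
have Lalpha : lipschitz_on X alpha.
  exists (4 + K1 * 16) => [|x t hx ht]; first by rewrite addr_ge0 // mulr_ge0.
  split; first by have := alpha4 x hx; lra.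
  apply: (@geometric_le _ _ _ 4) => k.
  have [xi [hxi _ e]] := diff k x t hx ht.
  have -> : alpha t - alpha x = (alpha t - (al k.+1).[t]) - (alpha x - (al k.+1).[x]) + ((al k.+1).[t] - (al k.+1).[x]) by ring.
  rewrite (le_trans (ler_normD _ _)) // e.
  have h1 := Ha k.+1 x hx; have h2 := Ha k.+1 t ht; have h3 := eS k.
  have h4 : `|(alpha t - (al k.+1).[t]) - (alpha x - (al k.+1).[x])| <= 4 * (2 ^+ k)^-1.
    by rewrite (le_trans (ler_normB _ _)) //; lra.
  have h5 : `|y0 ^+ 2 * q.[xi] * ((al k).[xi] ^+ 2 * (be k).[xi])| <= K1 * 16.
    rewrite normrM ler_pM ?yq // normrM normrX.
    have : `|(al k).[xi]| ^+ 2 * `|(be k).[xi]| <= 2 ^+ 2 * 4.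
      by rewrite ler_pM ?exprn_ge0 ?be_bound // lerXn2r ?nnegrE ?al_bound.
    lra.
  have h6 : `|(t - x) * (y0 ^+ 2 * q.[xi] * ((al k).[xi] ^+ 2 * (be k).[xi]))| <= `|t - x| * (K1 * 16).
    by rewrite normrM ler_wpM2l.
  have := normr_ge0 (t - x); lra.
have Lu : lipschitz_on X u by apply: lipschitz_onM Lalpha; apply: lipschitz_onM (lipschitz_onC _ _) (lipschitz_on_horner _ _).
pose g x := y0 ^+ 2 * q.[x] * (alpha x ^+ 2 * (alpha x * (1 - u x)^-1)).
have L1u : lipschitz_on X (fun x => 1 - u x).
  have -> : (fun x => 1 - u x) = fun x => 1 + -1 * u x by apply/funext => x; rewrite mulN1r.
  by apply: lipschitz_onD (lipschitz_onC _ _) _; apply: lipschitz_onM (lipschitz_onC _ _) Lu.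
have Lg : lipschitz_on X g.
  apply: lipschitz_onM; first by apply: lipschitz_onM (lipschitz_onC _ _) (lipschitz_on_horner _ _).
  apply: lipschitz_onM; last exact: lipschitz_onM Lalpha (lipschitz_onV v12 L1u).
  have -> : (fun x => alpha x ^+ 2) = fun x => alpha x * alpha x by apply/funext => x; rewrite expr2.
  exact: lipschitz_onM.
have Salpha : second_order X alpha g.
  split=> //; have [K K0 HK] := Lg; exists K => // x t hx ht.
  (* [4] comes from the two endpoint errors, [176 = 2 * 24 + 8 * 16] from replacing [alpha^2 beta]
     by its iterate, and [2 X] bounds [|t - x|]. *)
  apply: (@geometric_le _ _ _ (4 + 2 * X * (K1 * 176))) => k.
  have [xi [hxi lxi e]] := diff k x t hx ht.
  have [_ gxi] := HK x xi hx hxi.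
  have -> : alpha t - alpha x - (t - x) * g x = (alpha t - (al k.+1).[t]) - (alpha x - (al k.+1).[x])
     + (t - x) * ((g xi - g x) - (y0 ^+ 2 * q.[xi] * (alpha xi ^+ 2 * beta xi - (al k).[xi] ^+ 2 * (be k).[xi]))).
    have -> : g xi = y0 ^+ 2 * q.[xi] * (alpha xi ^+ 2 * beta xi) by rewrite /g beta_eq.
    have -> : (al k.+1).[t] = (al k.+1).[x] + (t - x) * (y0 ^+ 2 * q.[xi] * ((al k).[xi] ^+ 2 * (be k).[xi])).
      by rewrite -e addrC subrK.
    by move: (g x) => gx; ring.
  have h1 := Ha k.+1 x hx; have h2 := Ha k.+1 t ht; have h3 := eS k.
  have h4 : `|(alpha t - (al k.+1).[t]) - (alpha x - (al k.+1).[x])| <= 4 * (2 ^+ k)^-1.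
    by rewrite (le_trans (ler_normB _ _)) //; lra.
  have h5 : `|alpha xi ^+ 2 * beta xi - (al k).[xi] ^+ 2 * (be k).[xi]| <= 176 * (2 ^+ k)^-1.
    have -> : alpha xi ^+ 2 * beta xi - (al k).[xi] ^+ 2 * (be k).[xi] =
      (alpha xi - (al k).[xi]) * ((alpha xi + (al k).[xi]) * (be k).[xi]) + alpha xi ^+ 2 * (beta xi - (be k).[xi]) by ring.
    rewrite (le_trans (ler_normD _ _)) // !normrM.
    have b1 : `|alpha xi + (al k).[xi]| * `|(be k).[xi]| <= 6 * 4.
      rewrite ler_pM ?be_bound // (le_trans (ler_normD _ _)) //.
      by have := alpha4 xi hxi; have := al_bound k hxi; lra.
    have b2 : `|alpha xi - (al k).[xi]| * (`|alpha xi + (al k).[xi]| * `|(be k).[xi]|) <= 2 * (2 ^+ k)^-1 * (6 * 4).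
      by rewrite ler_pM ?mulr_ge0 ?Ha.
    have b3 : `|alpha xi| * `|alpha xi| * `|beta xi - (be k).[xi]| <= 4 * 4 * (8 * (2 ^+ k)^-1).
      by rewrite ler_pM ?mulr_ge0 ?Hb // ler_pM ?alpha4.
    lra.
  have h6 : `|y0 ^+ 2 * q.[xi] * (alpha xi ^+ 2 * beta xi - (al k).[xi] ^+ 2 * (be k).[xi])| <= K1 * (176 * (2 ^+ k)^-1).
    by rewrite normrM ler_pM ?yq.
  have h7 : `|g xi - g x| <= K * `|t - x| by apply: le_trans gxi _; rewrite ler_wpM2l.
  have tx : `|t - x| <= 2 * X by rewrite (le_trans (ler_normB _ _)) //; lra.
  rewrite (le_trans (ler_normD _ _)) // normrM.
  have h8 : `|t - x| * `|g xi - g x - y0 ^+ 2 * q.[xi] * (alpha xi ^+ 2 * beta xi - (al k).[xi] ^+ 2 * (be k).[xi])|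
      <= `|t - x| * (K * `|t - x| + K1 * (176 * (2 ^+ k)^-1)).
    by rewrite ler_wpM2l // (le_trans (ler_normB _ _)) // lerD.
  have h9 : `|t - x| * (K1 * (176 * (2 ^+ k)^-1)) <= 2 * X * (K1 * (176 * (2 ^+ k)^-1)).
    exact: ler_wpM2r (mulr_ge0 K10 (mulr_ge0 (ler0n R 176) (ltW (e0 k)))) _ _ tx.
  rewrite expr2; lra.
exists (fun x => y0 * alpha x * (1 - u x)^-1).
have al_a k : (al k).[a] = 1.
  case: k => [|k]; first by rewrite /al /= !hornerE.
  by rewrite alS hornerD hornerM prim_from_a mulr0 addr0 hornerE.
have alpha_a : alpha a = 1.
  apply/eqP; rewrite -subr_eq0; apply/eqP; apply: (@geometric_small _ _ 2) => k.
  by have := Ha k a aX; rewrite al_a.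
split.
- by rewrite /u Pa0 mulr0 mul0r subr0 invr1 alpha_a !mulr1.
- have Su := second_orderM (second_orderM (second_orderC X y0) (second_order_horner X P)) Salpha.
  have S1u := second_orderD (second_orderC X 1) (second_orderM (second_orderC X (-1)) Su).
  have v12' x : `|x| <= X -> 1 / 2 <= 1 + -1 * (y0 * P.[x] * alpha x).
    by move=> hx; rewrite mulN1r; apply: v12.
  have := second_orderM (second_orderM (second_orderC X y0) Salpha) (second_orderV v12' S1u).
  apply: eq_second_order => x hx /=; first by rewrite mulN1r.
  have v0 : 1 - u x != 0 by rewrite gt_eqF //; have := v12 x hx; lra.
  have uE : 1 + -1 * (y0 * P.[x] * alpha x) = 1 - u x by rewrite mulN1r.
  rewrite uE /g.
  set V := (1 - u x)^-1.
  (* With [V = 1 / (1 - u)], the identity [1 + u V = V] turns the product rule for [y0 alpha V] into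
     the Abel equation. *)
  have VE : y0 * P.[x] * alpha x * V = V - 1.
    by rewrite -/(u x) -(mulfV v0) -/V; ring.
  transitivity (y0 ^+ 3 * q.[x] * alpha x ^+ 3 * V ^+ 2 * (1 + y0 * P.[x] * alpha x * V)
    + P^`().[x] * (y0 * alpha x * V) ^+ 2); first by ring.
  by rewrite VE; ring.
- exists (alpha b).
    have v0 : 1 - u b != 0 by rewrite gt_eqF //; have := v12 b bX; lra.
    by rewrite -/(u b) mulfVK.
  move=> k; have := Ha k.+1 b bX.
  have -> : (al k.+1).[b] = 1 + y0 ^+ 2 * mom a b (q * (al k ^+ 2 * be k)).
    by rewrite alS hornerD hornerM prim_from_b !hornerC.
  rewrite /picard_moment horner_map_mom hornerM hornerC [(_ * (picard a P q k).2).[_]]hornerM horner_exp.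
  by move/le_trans; apply; rewrite ler_wpM2l.
Qed.

End SeriesSolution.

Local Open Scope classical_set_scope.
Local Open Scope ring_scope.

(** * Solutions of the Abel equation *)

Section AbelEquation.
Variables (R : realType) (a b : R) (p q : {poly R}).

Let rhs (y : R -> R) x := p.[x] * y x ^+ 2 + q.[x] * y x ^+ 3.

(** The quotient is multiplied out, so the case [t = x] becomes harmless. *)
Lemma abel_solutionP (y : R -> R) : abel_solution a b p q y <->
  (forall x, x \in `[a, b] -> forall e : R, 0 < e -> exists2 d : R, 0 < d &
     forall t, t \in `[a, b] -> `|t - x| < d ->
       `|y t - y x - (t - x) * rhs y x| <= e * `|t - x|).
Proof.
have E x t : t != x -> `|y t - y x - (t - x) * rhs y x| =
    `|rhs y x - (y t - y x) / (t - x)| * `|t - x|.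
  move=> tx; have tx0 : t - x != 0 by rewrite subr_eq0.
  rewrite -normrM -(normrN (y t - _ - _)) (mulrBl (t - x) (rhs y x)) divfK //; congr (`| _ |).
  by ring.
split=> H x xab.
  move=> e e0; have /cvgrPdist_le /(_ e e0) := H x xab.
  move=> [d /= d0 Hd]; exists d => // t tab td.
  have [->|tx] := eqVneq t x; first by rewrite !subrr mul0r subr0 normr0 mulr0.
  rewrite E // ler_wpM2r //; apply: Hd => //=; by rewrite distrC.
apply/cvgrPdist_le => e e0; have [d d0 Hd] := H x xab e e0.
exists d => //= t /= td tx tab.
rewrite -(ler_pM2r (_ : 0 < `|t - x|)) -?E ?normr_gt0 ?subr_eq0 //.
by apply: Hd; rewrite // distrC.
Qed.

Lemma second_order_abel_solution (X : R) (y : R -> R) : `|a| <= X -> `|b| <= X ->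
  second_order X y (rhs y) -> abel_solution a b p q y.
Proof.
move=> aX bX [_ _ [K K0 HK]]; apply/abel_solutionP => x xab e e0.
have inX z : z \in `[a, b] -> `|z| <= X.
  rewrite in_itv /= => /andP[az zb]; move: aX bX; rewrite !ler_norml => /andP[h1 h2] /andP[h3 h4].
  by apply/andP; split; lra.
exists (e / (K + 1)) => [|t tab td]; first by rewrite divr_gt0 //; lra.
apply: le_trans (HK x t (inX _ xab) (inX _ tab)) _.
rewrite expr2 mulrA ler_wpM2r //.
move: td; rewrite ltr_pdivlMr; last lra.
have := normr_ge0 (t - x); lra.
Qed.

Lemma abel_solution_continuous (y : R -> R) : abel_solution a b p q y ->
  {within `[a, b]%classic, continuous y}.
Proof.
move/abel_solutionP => H; apply/subspace_continuousP => x /= xab.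
apply/cvgrPdist_le => e e0; have [d d0 Hd] := H x xab 1 ltr01.
pose r := 1 + `|rhs y x|; have r0 : 0 < r by rewrite ltr_pwDl.
exists (Num.min d (e / r)) => /=; first by rewrite lt_min d0 divr_gt0.
move=> t /= td tab; rewrite distrC; move: td; rewrite /= lt_min (distrC x) => /andP[td te].
have := Hd t tab td; rewrite mul1r => h.
have -> : y t - y x = (y t - y x - (t - x) * rhs y x) + (t - x) * rhs y x by ring.
rewrite (le_trans (ler_normD _ _)) // normrM.
move: te; rewrite ltr_pdivlMr // /r => te.
lra.
Qed.

Lemma abel_solution_derive (y : R -> R) x : abel_solution a b p q y ->
  x \in `]a, b[ -> is_derive x 1 y (rhs y x).
Proof.
move/abel_solutionP => H xab; have := xab; rewrite in_itv /= => /andP[ax xb].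
suff C : (fun h : R => h^-1 *: (y (h *: 1 + x) - y x)) @ 0^' --> rhs y x.
  split; last exact: cvg_lim C.
  by apply/cvg_ex; exists (rhs y x).
apply/cvgrPdist_le => e e0.
have [|d d0 Hd] := H x _ e e0; first by apply: subset_itv_oo_cc.
pose m := Num.min d (Num.min (x - a) (b - x)).
have m0 : 0 < m by rewrite !lt_min d0 !subr_gt0 ax.
exists m => // h; rewrite /ball_ /= sub0r normrN !lt_min => /and3P[hd h1 h2] h0.
have -> : h *: (1 : R) + x = x + h by rewrite scaler1 addrC.
have h0' : h != 0 by [].
rewrite -(ler_pM2r (_ : 0 < `|h|)) ?normr_gt0 //.
have E : (rhs y x - h^-1 *: (y (x + h) - y x)) * h = - (y (x + h) - y x - h * rhs y x).
  by rewrite mulrBl /GRing.scale /= mulrAC mulVf // mul1r; ring.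
rewrite -normrM E normrN.
move: h1 h2; rewrite !ltr_norml => /andP[h11 h12] /andP[h21 h22].
have := Hd (x + h); rewrite in_itv /= (addrC x) addrK (addrC h); move/(_ _ hd); apply.
by apply/andP; split; lra.
Qed.

(** Gronwall: the difference satisfies [e' = m e] with [m] continuous, so for [L = max |m|] the
    nonnegative function [e^2 exp(-2 L x)] is nonincreasing; it vanishes at [a]. *)
Lemma abel_solution_unique (y z : R -> R) : a < b -> abel_solution a b p q y ->
  abel_solution a b p q z -> y a = z a -> {in `[a, b], y =1 z}.
Proof.
move=> ab Hy Hz yza.
have cy := abel_solution_continuous Hy; have cz := abel_solution_continuous Hz.
have ch (r : {poly R}) : {within `[a, b], continuous (horner r)}.
  by apply: continuous_subspaceT => x; apply: continuous_horner.
pose m (x : R) : R := p.[x] * (y x + z x) + q.[x] * (y x * y x + y x * z x + z x * z x).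
have cm : {within `[a, b], continuous (fun x => `|m x|)}.
  move=> x; apply: continuous_comp; last exact: norm_continuous.
  apply: continuousD; first by apply: continuousM; [exact: ch | apply: continuousD; [exact: cy|exact: cz]].
  apply: continuousM; first exact: ch.
  by apply: continuousD; [apply: continuousD|]; apply: continuousM; solve [exact: cy | exact: cz].
have [c _ Hc] := EVT_max (ltW ab) cm; pose L := `|m c|.
pose e (x : R) : R := y x - z x; pose E (x : R) : R := expR (- (2 * L) * x).
pose phi (x : R) : R := (e x * e x) * E x.
have De x : x \in `]a, b[ -> is_derive x 1 e (e x * m x).
  move=> xab; have h1 := abel_solution_derive Hy xab; have h2 := abel_solution_derive Hz xab.
  by apply: is_derive_eq; rewrite /m /e /rhs; ring.
have DE (x : R) : is_derive x 1 E (E x * - (2 * L)).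
  have dg : is_derive x 1 (fun t => - (2 * L) * t) (- (2 * L)).
    by apply: is_derive_eq; rewrite /GRing.scale /= mulr1.
  split; last first.
    rewrite -derive1E (@derive1_comp _ (fun t => - (2 * L) * t) expR) //.
    by rewrite !derive1E !derive_val.
  apply/derivable1_diffP; apply: (@differentiable_comp _ _ _ _ (fun t => - (2 * L) * t) expR).
    exact/derivable1_diffP.
  exact/derivable1_diffP.
have Dphi x : x \in `]a, b[ -> is_derive x 1 phi (2 * (e x * e x * E x) * (m x - L)).
  move=> xab; have h1 := De x xab; have h2 := DE x.
  apply: is_derive_eq; rewrite /GRing.scale /=; ring.
have ce : {within `[a, b], continuous e}.
  by rewrite /e => x; apply: continuousB; [exact: cy | exact: cz].
have cE : {within `[a, b], continuous E}.
  by apply: continuous_subspaceT => t; apply/differentiable_continuous/derivable1_diffP; have [] := DE t.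
have cphi : {within `[a, b], continuous phi}.
  have cee : {within `[a, b], continuous (fun x => e x * e x)}.
    by move=> x; apply: (@continuousM _ _ (e : subspace `[a, b] -> R) e); exact: ce.
  by move=> x; apply: (@continuousM _ _ ((fun x => e x * e x) : subspace `[a, b] -> R) E); [exact: cee | exact: cE].
move=> x xab.
have : phi x <= phi a.
  apply: (ler0_derive1_le_cc _ _ cphi) => //.
  - by move=> t /Dphi [].
  - move=> t tab; have Dp := Dphi t tab; rewrite derive1E derive_val.
    rewrite mulr_ge0_le0 //.
      by rewrite mulr_ge0 // mulr_ge0 ?expR_ge0 // -expr2 sqr_ge0.
    rewrite subr_le0 (le_trans (ler_norm _)) // Hc //.
    exact: subset_itv_oo_cc.
  - by rewrite in_itv /= lexx ltW.
  - by move: xab; rewrite in_itv /= => /andP[].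
rewrite /phi /e yza subrr mul0r mul0r pmulr_lle0 ?expR_gt0 // -expr2 => h.
by apply/eqP; rewrite -subr_eq0 -sqrf_eq0 eq_le h sqr_ge0.
Qed.

End AbelEquation.

(** * Integrals, norms of coefficients and the splitting of [q] *)

Lemma moment_mom (R : realType) (a b : R) (P q : {poly R}) k : a < b ->
  moment a b P q k = mom a b (P ^+ k * q).
Proof.
move=> ab; rewrite /moment /Rintegral.
rewrite (@continuous_FTC2 _ (fun x => P.[x] ^+ k * q.[x]) (horner (prim (P ^+ k * q)))) //.
- have -> : (fun x => P.[x] ^+ k * q.[x]) = horner (P ^+ k * q).
    by apply/funext => x; rewrite hornerM horner_exp.
  by apply: continuous_subspaceT => x; apply: continuous_horner.
- split=> [x _||]; first exact: derivable_horner.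
  + exact/cvg_at_right_filter/continuous_horner.
  + exact/cvg_at_left_filter/continuous_horner.
- by move=> x _; rewrite -derivE deriv_prim hornerM horner_exp.
Qed.

Lemma norm_row_coord (R : realType) n (u : 'rV[R]_n) i : `|u ord0 i| <= `|u|.
Proof.
rewrite [leRHS]mx_normrE; exact: (le_bigmax _ (fun ij => `|u ij.1 ij.2|) (ord0, i)).
Qed.

(** Equivalence of norms: [f] is continuous, and its minimum on the compact unit sphere is
    positive. *)
Lemma is_norm_rV_ge (R : realType) n (f : 'rV[R]_n.+1 -> R) : is_norm f ->
  exists2 c, 0 < c & forall u, c * `|u| <= f u.
Proof.
case=> fD fZ f_eq0.
have f0 : f 0 = 0 by rewrite -(scale0r 0) fZ normr0 mul0r.
have fN u : f (- u) = f u by rewrite -scaleN1r fZ normrN1 mul1r.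
have fge0 u : 0 <= f u by have := fD u (- u); rewrite subrr f0 fN; lra.
have fsum (I : Type) (r : seq I) (F : I -> 'rV[R]_n.+1) : f (\sum_(i <- r) F i) <= \sum_(i <- r) f (F i).
  by elim/big_rec2: _ => [|i x y _ h]; [rewrite f0 | apply: le_trans (fD _ _) _; rewrite lerD2l].
pose K := \sum_i f (delta_mx ord0 i); have K0 : 0 <= K by apply: sumr_ge0 => i _.
have f_le u : f u <= K * `|u|.
  rewrite {1}[u]row_sum_delta; apply: le_trans (fsum _ _ _) _.
  rewrite /K mulr_suml; apply: ler_sum => i _; rewrite fZ mulrC ler_wpM2l //.
  exact: norm_row_coord.
have cf : continuous f.
  move=> u; apply/(@cvgrPdist_le _ _ _ (nbhs u) (nbhs_filter u)) => e e0; apply/nbhs_ballP; exists (e / (K + 1)) => /=; first by rewrite divr_gt0 //; lra.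
  move=> v; rewrite -ball_normE /ball_ /= ltr_pdivlMr; last lra.
  move=> uv; have h1 := fD (u - v) v; have h2 := fD (v - u) u; rewrite !subrK in h1 h2.
  have h3 := f_le (u - v); have h4 : f (v - u) = f (u - v) by rewrite -fN opprB.
  have := normr_ge0 (u - v) => h5.
  rewrite ler_norml; apply/andP; split; lra.
pose S := [set u : 'rV[R]_n.+1 | `|u| = 1].
have cS : compact S.
  apply: bounded_closed_compact.
    by exists 1; split=> // x x1 u /= ->; apply: ltW.
  apply: (@closed_comp _ _ (fun u : 'rV[R]_n.+1 => `|u|) [set 1]); last exact: closed_eq.
  by move=> u _; apply: norm_continuous.
have S0 : S !=set0.
  pose v : 'rV[R]_n.+1 := const_mx 1.
  have v0 : v != 0 by apply/eqP => /rowP /(_ ord0); rewrite !mxE => /eqP; rewrite oner_eq0.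
  exists (`|v|^-1 *: v); rewrite /S /mkset normrZ normfV normr_id mulVf // normr_eq0 //.
have [c cS' Hc] := EVT_min_rV S0 cS (continuous_subspaceT cf).
rewrite inE /S /= in cS'.
have fc : 0 < f c.
  rewrite lt_neqAle fge0 andbT eq_sym; apply/eqP => /f_eq0 c0.
  by move: cS'; rewrite c0 normr0 => /esym /eqP; rewrite oner_eq0.
exists (f c) => // u; have [->|u0] := eqVneq u 0; first by rewrite normr0 mulr0 f0.
have nu0 : 0 < `|u| by rewrite normr_gt0.
rewrite -ler_pdivlMr // mulrC -[X in X * _](@ger0_norm _ `|u|^-1) ?invr_ge0 // -fZ.
by apply: Hc; rewrite inE /S /mkset normrZ normfV normr_id mulVf // gt_eqF.
Qed.

Lemma is_norm_pnorm_le (R : realType) (X : R) n (N : {poly_(n.+1) R} -> R) : 0 <= X -> is_norm N ->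
  exists2 C, 0 < C & forall q : {poly_(n.+1) R}, pnorm X q <= C * N q.
Proof.
move=> X0 [ND NZ N_eq0].
have vE u : val (rVnpoly u : {poly_(n.+1) R}) = rVpoly u.
  by rewrite /= val_insubd [_ \is a _]size_poly.
have [|c c0 Hc] := @is_norm_rV_ge R n (fun u => N (rVnpoly u)).
  split=> [u v|k v|v /N_eq0 h].
  - apply: le_trans (ND _ _); rewrite le_eqVlt; apply/orP; left; apply/eqP; congr N.
    by apply: val_inj; rewrite raddfD /= -!/(val _) !vE linearD.
  - rewrite -NZ; congr N; apply: val_inj; rewrite linearZ /=.
    by rewrite -!/(val _) !vE linearZ.
  - have vz : rVpoly v = 0 by rewrite -vE h.
    by rewrite -(rVpolyK v) vz linear0.
pose K := \sum_(i < n.+1) X ^+ i.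
have K0 : 0 <= K by apply: sumr_ge0 => i _; rewrite exprn_ge0.
exists ((K + 1) / c) => [|q]; first by rewrite divr_gt0 //; lra.
have := Hc (npoly_rV q); rewrite npoly_rV_K; set u := npoly_rV q => Hu.
have N0 : 0 <= N q by apply: le_trans Hu; rewrite mulr_ge0 // ltW.
apply: (@le_trans _ _ ((K + 1) * `|u|)); last first.
  by rewrite -mulrA ler_wpM2l ?addr_ge0 // mulrC ler_pdivlMr // mulrC.
apply: (@le_trans _ _ (K * `|u|)); last by rewrite ler_wpM2r // lerDl.
rewrite /pnorm (@wnorm_wide _ _ _ _ (normr_seminorm R) n.+1) ?size_npoly // /K mulr_suml.
apply: ler_sum => i _; rewrite mulrC ler_wpM2l ?exprn_ge0 //.
by apply: le_trans (norm_row_coord u i); rewrite /u /= mxE.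
Qed.

(** By the binomial formula the moments with [P] are combinations of those with [P - c], and the
    composition condition absorbs the constant. *)
Lemma definite_subC (R : realType) (a b c : R) (P : {poly R}) : a < b ->
  definite a b P -> definite a b (P - c%:P).
Proof.
move=> ab dP Q H.
have [|W [P1 [Q1 [Wab PE QE]]]] := dP Q; last first.
  by exists W, (P1 - c%:P), Q1; split=> //; rewrite PE comp_polyB comp_polyC.
move=> i; rewrite moment_mom // -{1}(subrK c%:P P) exprDn mulr_suml linear_sum /=.
apply: big1 => j _; rewrite -mulrnAr -polyC_exp -polyCMn mulrAC mulrC mul_polyC linearZ /=.
by rewrite -moment_mom // H mulr0.
Qed.

(** Definiteness is applied to a primitive of [z]; the common inner polynomial then feeds
    [picard_moment_comp]. *)
Lemma definite_picard_moment (R : realType) (a b : R) (P z : {poly R}) : a < b -> definite a b P ->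
  (forall j, mom a b (P ^+ j * z) = 0) -> forall k, picard_moment a b P z k = 0.
Proof.
move=> ab dP H k.
have [|W [P1 [Z1 [Wab PE ZE]]]] := dP (prim z).
  by move=> i; rewrite moment_mom // deriv_prim.
rewrite -(deriv_prim z) ZE; exact: picard_moment_comp Wab PE.
Qed.

(** [w] is a fixed linear function of the first [K] moments of [q], given by a pseudo-inverse of the
    moment matrix; [w] has these same moments. *)
Lemma moment_splitting (R : realFieldType) (a b X : R) (P : {poly R}) d K :
  0 <= X -> `|a| <= X -> `|b| <= X ->
  exists2 C, 0 <= C & forall q : {poly R}, (size q <= d)%N -> exists w : {poly R},
    [/\ (size w <= d)%N, forall j, (j < K)%N -> mom a b (P ^+ j * (q - w)) = 0,
        pnorm X w <= C * pnorm X q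
      & forall e, 0 <= e -> (forall j, (j < K)%N -> `|mom a b (P ^+ j * w)| <= e) ->
          pnorm X w <= C * e].
Proof.
move=> X0 aX bX; have nP := pnorm_seminorm X0.
pose M : 'M[R]_(d, K) := \matrix_(i, j) mom a b (P ^+ j * 'X^i).
have momE (u : 'rV[R]_d) (j : 'I_K) : (u *m M) ord0 j = mom a b (P ^+ j * rVpoly u).
  rewrite mxE [rVpoly u]poly_def mulr_sumr linear_sum /=; apply: eq_bigr => i _.
  by rewrite valK mxE -scalerAr linearZ.
pose V := pinvmx M.
pose C1 := \sum_(i < d) (\sum_j `|V j i|) * X ^+ i.
have C10 : 0 <= C1 by apply: sumr_ge0 => i _; rewrite mulr_ge0 ?exprn_ge0 ?sumr_ge0.
pose C2 := \sum_(j < K) (2 * X) * pnorm X (P ^+ j).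
have C20 : 0 <= C2 by apply: sumr_ge0 => i _; rewrite !mulr_ge0 // (seminorm_ge0 nP).
exists (C1 + C1 * C2) => [|q sq]; first by rewrite addr_ge0 // mulr_ge0.
pose w := poly_rV q *m M *m V; exists (rVpoly w).
have wM : w *m M = poly_rV q *m M by rewrite mulmxKpV // submxMl.
have qE : rVpoly (poly_rV q : 'rV[R]_d) = q by rewrite poly_rV_K.
have wbound e : 0 <= e -> (forall j, (j < K)%N -> `|mom a b (P ^+ j * q)| <= e) -> pnorm X (rVpoly w) <= C1 * e.
  move=> e0 He; rewrite /pnorm (@wnorm_wide _ _ _ _ (normr_seminorm R) d) ?size_poly //.
  rewrite /C1 mulr_suml; apply: ler_sum => i _; rewrite [leRHS]mulrAC ler_wpM2r ?exprn_ge0 //.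
  rewrite coef_rVpoly_ord /w mxE mulr_suml; apply: le_trans (ler_norm_sum _ _ _) _.
  by apply: ler_sum => j _; rewrite momE qE normrM mulrC ler_wpM2l // He.
split=> [|j jK||e e0 He]; first exact: size_poly.
- have /rowP /(_ (Ordinal jK)) := wM; rewrite !momE qE /= => h.
  by rewrite mulrBr linearB /= h subrr.
- apply: (@le_trans _ _ (C1 * (C2 * pnorm X q))).
    apply: wbound => [|j jK]; first by rewrite mulr_ge0 // (seminorm_ge0 nP).
    apply: le_trans (norm_mom X0 aX bX _) _.
    have [_ _ _ nM] := nP; rewrite /C2 (bigD1 (Ordinal jK)) //= [leRHS]mulrDl ler_wpDr //.
      by rewrite mulr_ge0 ?(seminorm_ge0 nP) // sumr_ge0 // => i _; rewrite !mulr_ge0 // (seminorm_ge0 nP).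
    by rewrite -[leRHS]mulrA ler_wpM2l ?mulr_ge0.
  by rewrite mulrA ler_wpM2r ?(seminorm_ge0 nP) // lerDr.
- apply: (@le_trans _ _ (C1 * e)); last by rewrite ler_wpM2r // lerDl mulr_ge0.
  apply: wbound => // j jK; have := He j jK.
  by have /rowP /(_ (Ordinal jK)) := wM; rewrite !momE qE /= => ->.
Qed.

(** * Isolated periodic solutions *)

Lemma geometric_le_tail (R : realType) (x c C : R) (K : nat) : 0 <= C ->
  (forall k, (K <= k)%N -> x <= c + C * (2 ^+ k)^-1) -> x <= c.
Proof.
move=> C0 H; apply: (@geometric_le _ _ _ C) => k.
apply: le_trans (H (k + K)%N (leq_addl _ _)) _.
rewrite lerD2l ler_wpM2l // lef_pV2 ?posrE ?exprn_gt0 //.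
by rewrite ler_eXn2l ?leq_addr // ltr1n.
Qed.

Section SmallPeriodic.
Variables (R : realType) (a b X rho : R) (P q : {poly R}).
Hypotheses (ab : a < b) (X0 : 0 <= X) (aX : `|a| <= X) (bX : `|b| <= X).
Hypotheses (rho0 : 0 < rho) (rhoP : rho * pnorm X P <= 1 / 8) (sq : picard_small X rho q).
Hypothesis Pa0 : P.[a] = 0.

Let H k := picard_moment a b P q k.

(** By uniqueness [y] is the series solution, and periodicity allows cancelling [y(a) <> 0] in the
    relation at [b]. *)
Lemma periodic_alpha y : periodic_solution a b P^`() q y -> `|y a| <= rho -> y a != 0 ->
  exists2 alpha, 1 - y a * P.[b] * alpha = alpha &
    forall k, `|alpha - (1 + y a ^+ 2 * (H k).[y a])| <= 2 * (2 ^+ k)^-1.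
Proof.
move=> [Hy yab] yr y0.
have [z [za Sz [al zb Hal]]] := series_solution X0 aX bX (ltW rho0) rhoP sq yr Pa0.
have zy := abel_solution_unique ab (second_order_abel_solution aX bX Sz) Hy za.
exists al => //; apply: (mulfI y0); rewrite -zb zy -?yab //.
by rewrite in_itv /= lexx ltW.
Qed.

Lemma periodic_of_moment0 y0 : P.[b] = 0 -> (forall k, pnorm rho (H k) <= 0) -> `|y0| <= rho ->
  exists2 y, periodic_solution a b P^`() q y & y a = y0.
Proof.
move=> Pb0 H0 yr.
have [z [za Sz [al zb Hal]]] := series_solution X0 aX bX (ltW rho0) rhoP sq yr Pa0.
exists z => //; split; first exact: second_order_abel_solution aX bX Sz.
suff al1 : al = 1 by move: zb; rewrite Pb0 al1 mulr0 mul0r subr0 !mulr1 za.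
apply/eqP; rewrite -subr_eq0; apply/eqP; apply: (@geometric_small _ _ 2) => k.
have := Hal k; have -> : (picard_moment a b P q k).[y0] = 0.
  apply/eqP; rewrite -normr_le0; apply: le_trans (H0 k).
  exact: pnorm_horner _ yr.
by rewrite mulr0 addr0.
Qed.

Lemma pnorm_picard_moment k : pnorm rho (H k) <= 58 * X * pnorm X q.
Proof.
have s0 : picard_small X rho 0 by rewrite /picard_small /pnorm wnorm0 mulr0.
have := picard_momentB X0 aX bX (ltW rho0) rhoP k sq s0.
have -> : picard_moment a b P 0 k = 0 by rewrite /picard_moment mul0r raddf0.
by rewrite !subr0 => /le_trans; apply; rewrite le_eqVlt; apply/orP; left; apply/eqP; ring.
Qed.

(** Periodicity gives [1 - alpha = y0 P(b) alpha], of first order in [y0], while [alpha - 1] is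
    [O(y0^2 |q|)]; for [q] small against [P(b)] this forces [y0 = 0]. *)
Lemma small_periodic_zero y : 116 * X * pnorm X q < `|P.[b]| -> rho <= 1 ->
  periodic_solution a b P^`() q y -> `|y a| <= rho -> y a = 0.
Proof.
move=> Pb rho1 Hy yr; apply/eqP; apply/negPn/negP => y0.
have [al alE Hal] := periodic_alpha Hy yr y0.
set B := 58 * X * pnorm X q.
have B0 : 0 <= B by rewrite !mulr_ge0 // (seminorm_ge0 (pnorm_seminorm X0)).
have HB k : `|(H k).[y a]| <= B.
  by apply: le_trans (pnorm_picard_moment k); exact: pnorm_horner _ yr.
have h1 : `|al - 1| <= `|y a| ^+ 2 * B.
  apply: (@geometric_le _ _ _ 2) => k.
  have -> : al - 1 = (al - (1 + y a ^+ 2 * (H k).[y a])) + y a ^+ 2 * (H k).[y a] by ring.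
  rewrite (le_trans (ler_normD _ _)) // addrC lerD // normrM normrX ler_wpM2l ?exprn_ge0 //.
(* [58 X rho^2 |q|] is 29 times the quantity that [picard_small] bounds by [1/64]. Hence
   [|alpha| >= 1/2]. *)
have h2 : `|y a| ^+ 2 * B <= 29 / 64.
  apply: (@le_trans _ _ (rho ^+ 2 * B)).
    by rewrite ler_wpM2r // lerXn2r // nnegrE // ltW.
  by move: sq; rewrite /picard_small /B; lra.
have h3 : 1 / 2 <= `|al|.
  by have := ler_normD al (1 - al); rewrite addrC subrK normr1 (distrC 1); lra.
have h4 : `|al - 1| = `|y a| * (`|P.[b]| * `|al|).
  by rewrite -{1}alE mulrA -!normrM -normrN; congr (`| _ |); ring.
have yp : 0 < `|y a| by rewrite normr_gt0.
move: h1; rewrite h4 expr2 -mulrA ler_pM2l // => h1.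
have h5 : `|y a| * B <= B by rewrite ler_piMl // (le_trans yr).
have h6 : `|P.[b]| * (1 / 2) <= `|P.[b]| * `|al| by rewrite ler_wpM2l.
rewrite /B in h1 h5; lra.
Qed.

End SmallPeriodic.

Lemma small_scalar (R : realFieldType) (c t : R) : 0 <= c -> 0 < t ->
  exists2 d, 0 < d & forall e, e <= d -> c * e <= t.
Proof.
move=> c0 t0; exists (t / (c + 1)) => [|e]; first by rewrite divr_gt0 //; lra.
rewrite ler_pdivlMr => [h|]; last lra.
have [e0|e0] := lerP 0 e; first lra.
by have := mulr_ge0_le0 c0 (ltW e0); lra.
Qed.

(** The values at [ys] are only bounded by [E / 2^k], since [picard_moment] merely approximates
    [H_q]; the limit is taken in the estimate of the moments of [w]. *)
Lemma picard_moment_zeros (R : realType) (a b X rho : R) (P : {poly R}) d :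
  a < b -> P.[a] = 0 -> P.[b] = 0 -> definite a b P -> 
  0 <= X -> `|a| <= X -> `|b| <= X -> 0 < rho -> rho <= 1 -> rho * pnorm X P <= 1 / 8 ->
  let K := (5 + d + 3 * (size P^`()).-1 ^ 2)%N in
  exists d1 r1 : R, [/\ 0 < d1, 0 < r1 &
    forall (q : {poly R}) (ys : seq R) (r E : R), (size q <= d.+1)%N -> pnorm X q <= d1 ->
      uniq ys -> size ys = K -> 0 <= r -> r <= r1 -> 0 <= E -> {in ys, forall y, `|y| <= r} ->
      (forall k, {in ys, forall y, `|(picard_moment a b P q k).[y]| <= E * (2 ^+ k)^-1}) ->
      forall k, pnorm rho (picard_moment a b P q k) <= 0].
Proof.
move=> ab Pa0 Pb0 dP X0 aX bX rho0 rho1 rhoP K.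
have nP := pnorm_seminorm X0.
have [C C0 HC] := @moment_splitting R a b X P d.+1 K X0 aX bX.
have [M M0 HM] := coef_small_of_zeros rho0 rho1 K.
pose D := 2 * X * (832 * (rho ^+ 2 * (2 * X))) * (2 + C) * rho ^- K.
have rhoge0 := ltW rho0; have rho2 : 0 <= rho ^+ 2 by apply: exprn_ge0.
have D0 : 0 <= D.
  rewrite /D; move: (832) (ler0n R 832) => n n0.
  by rewrite !mulr_ge0 ?invr_ge0 ?exprn_ge0 ?addr_ge0.
have q4 : 0 < 1 / 4 :> R by rewrite divr_gt0.
have q64 : 0 < 1 / 64 :> R by rewrite divr_gt0.
(* [d1] and [r1] make each of the two terms in the estimate of [w] at most [|w| / 4]; [d2] makes
   both [q] and [z] small enough for the iteration. *)
have [d1 d10 Hd1] := small_scalar (mulr_ge0 C0 D0) q4.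
have L0 : 0 <= rho ^+ 2 * (2 * X) * (1 + C) by rewrite !mulr_ge0 ?exprn_ge0 ?addr_ge0 // ltW.
have [d2 d20 Hd2] := small_scalar L0 q64.
have N0 : 0 <= C * (M * (58 * X)) by rewrite !mulr_ge0.
have [r1 r10 Hr1] := small_scalar N0 q4.
exists (Num.min d1 d2), (Num.min r1 (rho / 2)).
rewrite !lt_min d10 d20 r10 divr_gt0 //; split=> // q ys r E sq.
rewrite !le_min => /andP[qd1 qd2] uys sys r0 /andP[rr1 rrho] E0 ysr HE k.
have Nq0 := seminorm_ge0 nP q.
have [w [sw wmom wq wmax]] := HC q sq.
pose z := q - w.
have Nw0 := seminorm_ge0 nP w.
have zq : pnorm X z <= (1 + C) * pnorm X q by apply: le_trans (seminormB nP q w) _; rewrite mulrDl mul1r lerD2l.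
have smz : picard_small X rho z.
  by apply: le_trans (Hd2 _ qd2); rewrite -[leRHS]mulrA ler_wpM2l ?mulr_ge0.
have smq : picard_small X rho q.
  apply: le_trans (Hd2 _ qd2); rewrite -[leRHS]mulrA ler_wpM2l ?mulr_ge0 //.
  by rewrite mulrDl mul1r lerDl mulr_ge0.
have z0 : forall i, picard_moment a b P z i = 0.
  have sz : (size z <= d.+1)%N by rewrite (leq_trans (size_polyD _ _)) // size_polyN geq_max sq sw.
  have zmom := @mom_vanish R a b P z d ab Pa0 Pb0 sz wmom.
  by move=> i; exact: definite_picard_moment ab dP zmom i.
have qw : q - z = w by rewrite /z opprB addrC subrK.
have Hbound i : pnorm rho (picard_moment a b P q i) <= 58 * X * pnorm X w.
  have := picard_momentB X0 aX bX (ltW rho0) rhoP i smq smz.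
  rewrite z0 subr0 qw => /le_trans; apply; rewrite le_eqVlt; apply/orP; left; apply/eqP.
  by move: (pnorm X w) => n; ring.
have Hlin i j : (j < K)%N -> (j <= i)%N ->
    `|(picard_moment a b P q i)`_j - mom a b (P ^+ j * w)| <= D * pnorm X q * pnorm X w.
  move=> jK ji; have := picard_moment_linear X0 aX bX (ltW rho0) rhoP i smq smz.
  rewrite z0 subr0 qw => hl.
  rewrite -(coef_picard_moment0 a b P w ji) -coefB.
  apply: le_trans (pnorm_coef_le rho0 rho1 _ (ltnW jK)) _.
  apply: le_trans (ler_wpM2r _ hl) _; first by rewrite invr_ge0 exprn_ge0.
  rewrite /D; move: (832) (ler0n R 832) => n n0.
  rewrite -[leRHS]mulrA [leRHS]mulrAC ler_wpM2r ?invr_ge0 ?exprn_ge0 //.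
  rewrite -[leRHS]mulrA ler_wpM2l ?(mulr_ge0 n0) ?mulr_ge0 //.
  have zq2 : pnorm X q + pnorm X z <= (2 + C) * pnorm X q.
    by move: zq; move: (pnorm X q) (pnorm X z) => u v uv; clear -uv; lra.
  by rewrite mulrC mulrA ler_wpM2r.
clearbody D.
have [A A0 HA] := HM ys uys sys.
have mw j : (j < K)%N -> `|mom a b (P ^+ j * w)| <= (M * r * (58 * X) + D * pnorm X q) * pnorm X w.
  (* Only indices [i >= K] are used: the coefficient of index [j] of the linear term is a moment
     once [i >= j]. *)
  move=> jK; apply: (@geometric_le_tail _ _ _ (A * E) K) => [|i Ki]; first exact: mulr_ge0.
  have h1 := Hlin i j jK (leq_trans (ltnW jK) Ki).
  have e0 : 0 <= E * (2 ^+ i)^-1 by rewrite mulr_ge0 // invr_ge0 exprn_ge0.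
  have h2 := HA r (picard_moment a b P q i) _ r0 rrho e0 ysr (HE i) j jK.
  have h3 : M * r * pnorm rho (picard_moment a b P q i) <= M * r * (58 * X * pnorm X w).
    by rewrite ler_wpM2l ?Hbound // mulr_ge0.
  rewrite -(subKr (picard_moment a b P q i)`_j (mom a b _)) (le_trans (ler_normB _ _)) //.
  apply: le_trans (lerD h2 h1) _.
  by rewrite [X in _ <= X + _]mulrDl (mulrA A) addrAC !lerD2r -[leRHS]mulrA.
(* The estimates combine to [|w| <= |w| / 2]. *)
have w0 : pnorm X w <= 0.
  have th0 : 0 <= (M * r * (58 * X) + D * pnorm X q) * pnorm X w.
    by rewrite mulr_ge0 // addr_ge0 // !mulr_ge0.
  have := wmax _ th0 mw; rewrite mulrA.
  have h1 := Hr1 _ rr1; have h2 := Hd1 _ qd1.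
  have : C * (M * r * (58 * X) + D * pnorm X q) <= 1 / 2.
    have -> : C * (M * r * (58 * X) + D * pnorm X q) = C * (M * (58 * X)) * r + C * D * pnorm X q.
      by move: (pnorm X q) => n; clear; ring.
    by clear -h1 h2; lra.
  move/(ler_wpM2r Nw0) => h3 h4; have := le_trans h4 h3.
  by move: (pnorm X w); clear => n; lra.
have := ler_wpM2l (mulr_ge0 (ler0n R 58) X0) w0; rewrite mulr0.
exact/le_trans/Hbound.
Qed.

Lemma card_ngt_seq (T : choiceType) (A : set T) n : ~ (A #<= `I_n)%card ->
  exists s : seq T, [/\ uniq s, size s = n.+1 & forall x, x \in s -> A x].
Proof.
move=> An; suff [B BA nB] : exists2 B : {fset T}, [set` B] `<=` A & (n < #|` B|)%N.
  exists (take n.+1 B); split; first exact/take_uniq/fset_uniq.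
    by rewrite size_takel.
  by move=> x /mem_take xB; apply: BA.
have [finA|] := EM (finite_set A); last by move=> /(infinite_set_fset n.+1).
have [B AB] := (finite_fsetP.1 finA); exists B; first by rewrite AB.
rewrite ltnNge; apply/negP => Bn; apply: An; rewrite AB.
have /card_eq_fsetP BB : #|` B| = #|` B| by [].
by rewrite (card_le_eql BB) card_le_II.
Qed.

(** Only nonzero initial values are treated here, because [H_q] describes periodicity after division
    by powers of [y0]. *)
Lemma isolated_periodic_bound (R : realType) (a b X : R) (P : {poly R}) d :
  a < b -> P.[a] = 0 -> definite a b P -> `|a| <= X -> `|b| <= X ->
  let K := (5 + d + 3 * (size P^`()).-1 ^ 2)%N in
  exists d1 r : R, [/\ 0 < d1, 0 < r &
    forall (q : {poly R}) (ys : seq R), (size q <= d.+1)%N -> pnorm X q <= d1 ->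
      uniq ys -> size ys = K ->
      ~ {in ys, forall y0, y0 != 0 /\ exists y, [/\ isolated_periodic a b P^`() q y, y a = y0 & `|y0| < r]}].
Proof.
move=> ab Pa0 dP aX bX K.
have X0 : 0 <= X by apply: le_trans aX.
have nP := pnorm_seminorm X0.
have p8 : 0 < 1 / 8 :> R by rewrite divr_gt0.
have q64 : 0 < 1 / 64 :> R by rewrite divr_gt0.
have [d0 d00 Hd0] := small_scalar (seminorm_ge0 nP P) p8.
pose rho := Num.min 1 d0.
have rho0 : 0 < rho by rewrite lt_min ltr01.
have rho1 : rho <= 1 by rewrite ge_min lexx.
have rhoP : rho * pnorm X P <= 1 / 8 by rewrite mulrC Hd0 // ge_min lexx orbT.
have L0 : 0 <= rho ^+ 2 * (2 * X) by rewrite !mulr_ge0 ?exprn_ge0 // ltW.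
have [d2 d20 Hd2] := small_scalar L0 q64.
have [Pb0|Pb0] := eqVneq P.[b] 0; last first.
  have Pbp : 0 < `|P.[b]| / 2 by rewrite divr_gt0 // normr_gt0.
  have [d1 d10 Hd1] := small_scalar (mulr_ge0 (ler0n R 116) X0) Pbp.
  exists (Num.min d1 d2), rho; rewrite lt_min d10 d20; split=> // q ys sq.
  rewrite le_min => /andP[qd1 qd2] _ sys H.
  case: ys sys H => // y0 ys _ /(_ y0 (mem_head _ _)) [y00 [y [[Hy _] ya yr]]].
  have Pbq : 116 * X * pnorm X q < `|P.[b]| by have := Hd1 _ qd1; clear -Pbp; lra.
  have := small_periodic_zero ab X0 aX bX rho0 rhoP (Hd2 _ qd2) Pa0 Pbq rho1 Hy.
  by rewrite ya => /(_ (ltW yr)) y0E; rewrite y0E eqxx in y00.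
have [d1 [r1 [d10 r10 Hq]]] := @picard_moment_zeros R a b X rho P d ab Pa0 Pb0 dP X0 aX bX rho0 rho1 rhoP.
pose r := Num.min r1 (rho / 2).
have r0 : 0 < r by rewrite lt_min r10 divr_gt0.
have rrho : r < rho by rewrite gt_min ltr_pdivrMr // ltr_pMr // ltr1n orbT.
exists (Num.min d1 d2), r; rewrite lt_min d10 d20; split=> // q ys sq.
rewrite le_min => /andP[qd1 qd2] uys sys H.
have smq : picard_small X rho q := Hd2 _ qd2.
(* A periodic solution has [alpha = 1], so [|y0^2 H_k(y0)| <= 2 / 2^k]. Dividing by [y0^2] gives the
   error constant, summed over [ys]. *)
pose E := \sum_(y <- ys) 2 * (`|y| ^+ 2)^-1.
have E0 : 0 <= E by apply: sumr_ge0 => y _; rewrite mulr_ge0 // invr_ge0 exprn_ge0.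
have ysr : {in ys, forall y, `|y| <= r} by move=> y /H [_ [f [_ _ /ltW]]].
have H0 : forall k, pnorm rho (picard_moment a b P q k) <= 0.
  have rr1 : r <= r1 by rewrite ge_min lexx.
  apply: (Hq q ys r E) => //; first exact: ltW.
  move=> k y0 y0ys; have [y00 [y [[Hy _] ya yr]]] := H y0 y0ys.
  have yn : `|y a| <= rho by rewrite ya (le_trans (ltW yr)) // ltW.
  have ya0 : y a != 0 by rewrite ya.
  have [al] := periodic_alpha ab X0 aX bX rho0 rhoP smq Pa0 Hy yn ya0.
  rewrite Pb0 mulr0 mul0r subr0 => <- /(_ k).
  rewrite opprD addrA subrr sub0r normrN ya normrM normrX => h.
  have yp : 0 < `|y0| ^+ 2 by rewrite exprn_gt0 // normr_gt0.
  apply: (@le_trans _ _ (2 * (`|y0| ^+ 2)^-1 * (2 ^+ k)^-1)).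
    by rewrite mulrAC ler_pdivlMr // mulrC.
  rewrite ler_wpM2r ?invr_ge0 ?exprn_ge0 // /E (big_rem y0) //= lerDl.
  by apply: sumr_ge0 => t _; rewrite mulr_ge0 // invr_ge0 exprn_ge0.
case: ys sys uys H {ysr E E0} => // y0 ys _ _ /(_ y0 (mem_head _ _)) [_ [y [[Hy [e e0 Hiso]] ya yr]]].
(* As every [H_k] is zero, [y0 + t] also starts a periodic solution, closer than [e]; the bound
   [rho - r] keeps it in the domain of the iteration. *)
pose t := Num.min e (rho - r) / 2.
have m0 : 0 < Num.min e (rho - r) by rewrite lt_min e0 subr_gt0.
have t0 : 0 < t by rewrite divr_gt0.
have te : t < e by rewrite /t; have : Num.min e (rho - r) <= e by [rewrite ge_min lexx]; move: m0; move: (Num.min _ _) => m; clear; lra.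
have trho : t <= rho - r.
  by rewrite /t; have : Num.min e (rho - r) <= rho - r by [rewrite ge_min lexx orbT]; move: m0; move: (Num.min _ _) => m; clear; lra.
have yt : `|y0 + t| <= rho.
  apply: le_trans (ler_normD _ _) _; rewrite (ger0_norm (ltW t0)).
  by clear -trho yr; lra.
have [z Hz za] := periodic_of_moment0 X0 aX bX rho0 rhoP smq Pa0 Pb0 H0 yt.
have aab : a \in `[a, b] by rewrite in_itv /= lexx ltW.
have := Hiso z Hz; rewrite za ya addrC addKr (ger0_norm (ltW t0)) => /(_ te a aab).
by rewrite za ya; clear -t0; lra.
Qed.

(** By uniqueness a restricted solution is determined by its initial value, so it suffices to count
    initial values; [P] is first replaced by [P - P(a)]. *)
Theorem corollary4 (R : realType) (a b : R) (hab : a < b)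
    (P : {poly R}) (hP : definite a b P) (dq : nat)
    (N : {poly_(dq.+1) R} -> R) (hN : is_norm N) :
  exists delta rho : R,
    [/\ 0 < delta, 0 < rho &
      forall q : {poly_(dq.+1) R}, N q < delta ->
        (small_isolated_periodic a b P^`() q rho
           #<= `I_(5 + dq + 3 * (size P^`()).-1 ^ 2)%N)%card].
Proof.
pose X := `|a| + `|b|; pose c := P.[a].
have aX : `|a| <= X by rewrite lerDl.
have bX : `|b| <= X by rewrite lerDr.
have X0 : 0 <= X by rewrite addr_ge0.
have [C C0 HC] := is_norm_pnorm_le X0 hN.
have Pa0 : (P - c%:P).[a] = 0 by rewrite hornerD hornerN hornerC subrr.
have dPE : (P - c%:P)^`() = P^`() by rewrite derivB derivC subr0.
have := @isolated_periodic_bound R a b X (P - c%:P) dq hab Pa0 (definite_subC hab hP) aX bX.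
rewrite dPE; set K := (5 + _ + _)%N => -[d [r [d0 r0 H]]].
(* [C] converts the given norm into [pnorm]. *)
exists (d / C), r; split=> [||q Nq]; [by rewrite divr_gt0 | by [] |].
have qd : pnorm X q <= d.
  by apply: le_trans (HC q) _; rewrite mulrC -ler_pdivlMr // ltW.
have aab : a \in `[a, b] by rewrite in_itv /= lexx ltW.
have patch_a (y : R -> R) : (y \_ `[a, b]) a = y a by rewrite patchE mem_set.
set S := small_isolated_periodic _ _ _ _ _.
have inj_a : {in S &, injective (fun f : R -> R => f a)}.
  move=> _ _ /set_mem [y [[[Hy _] _] _] <-] /set_mem [z [[[Hz _] _] _] <-] /=.
  rewrite !patch_a => yz; apply/funext => x; rewrite !patchE.
  case: ifPn => // /set_mem xab; exact: (abel_solution_unique hab Hy Hz yz).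
rewrite -(card_le_eql (inj_card_eq inj_a)).
apply: contrapT => /card_ngt_seq [s [us ss Hs]].
(* More than [K] solutions give [K + 1] distinct initial values; discarding 0 leaves at least [K]
   nonzero ones, so the zero solution does not raise the bound. *)
pose ys := take K (rem 0 s).
apply: (H q ys (size_npoly q) qd).
- exact/take_uniq/rem_uniq.
- rewrite size_takel //; have [zs|zs] := boolP (0 \in s); first by rewrite size_rem // ss.
  by rewrite rem_id // ss.
- move=> y0 /mem_take; rewrite mem_rem_uniq // inE => /andP[y00 /Hs [_ [y [Hy yr] <-] E]].
  by move: E; rewrite patch_a => E; split=> //; exists y; rewrite -{2}E.
Qed.
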